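(* The limit $\lim_{n\to\infty} n^{-2} f^{(3)}(n;8,6)$ exists and equals $\frac{61}{330}$.
   Context: A $3$-graph is a $3$-uniform hypergraph. For positive integers $s,k$, an $(s,k)$-configuration is a $3$-graph with exactly $k$ edges and at most $s$ vertices; a $3$-graph is $(s,k)$-free if it contains no $(s,k)$-configuration as a subgraph. $f^{(3)}(n;s,k)$ denotes the maximum number of edges in an $n$-vertex $3$-graph that is $(s,k)$-free. *)

(* Defs.v *)
From HB Require Import structures.
From mathcomp Require Import all_boot all_order all_algebra.
Set Implicit Arguments. Unset Strict Implicit. Unset Printing Implicit Defensive.

Definition is_3graph (n : nat) (H : {set {set 'I_n}}) : bool :=
  [forall e in H, #|e| == 3].

Definition has_config (n s k : nat) (H : {set {set 'I_n}}) : bool :=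
  [exists F : {set {set 'I_n}}, [&& F \subset H, #|F| == k & #|cover F| <= s]].

Definition sk_free (n s k : nat) (H : {set {set 'I_n}}) : bool :=
  ~~ has_config s k H.

Definition f3 (n s k : nat) : nat :=
  \max_(H : {set {set 'I_n}} | is_3graph H && sk_free s k H) #|H|.

(* Main.v *)
Require Import Defs.
From HB Require Import structures.
From Stdlib Require Import NArith.
From mathcomp Require Import all_boot all_order all_algebra.
From mathcomp Require Import zify ring.
Set Implicit Arguments. Unset Strict Implicit. Unset Printing Implicit Defensive.

(* Upper bound.  Deleting O(n) edges leaves a family in which l <= 5 edges span at least
   l + 2 vertices and 6 edges at least 9.  Call a set of l edges on l + 2 vertices tight and a
   pair light if a tight set of at most 3 edges covers it.  Discharging shows
   165 |H| <= 61 |light H|: after reductions two edges sharing a pair form doubles, the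
   components of this relation have at most three edges, and the light pairs are distributed
   over the components.

   Lower bound.  A gadget with 61 edges attains equality, with 165 light pairs.  Copies of the
   gadget are packed into K_N so that the light pairs of the copies are disjoint, cover almost
   all pairs, and miss the pairs that are not light in their copy.  This packing is then
   blown up: each copy becomes a transversal design whose blocks y_u = s_u a + b have slopes
   depending on a 5-colouring of the gadget.  Additional coordinates, one for every choice of
   gains and translations, prevent a tight set of six edges from using several copies with
   distinct indices; the blocks over one index are handled by elementary line geometry
   (the slopes avoid the Pasch, 2 x 3 grid and hexagon degeneracies). *)

(** * Tight sets *)

(** Tight sets claim a pair only up to size three because two edge-disjoint tight triples with a
    common pair would be six edges on 8 vertices, so claims of different components hardly compete.
    The charges are exact at a single edge that hosts six doubles, two at each of its pairs, when
    each of its twelve link pairs is the apex of two more doubles; this is the gadget. Its 61 edges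
    per 165 pairs, over about n^2 / 2 pairs, give 61/330. The obstacle in the lower bound is that
    disjointness of the light pairs does not stop six edges from several copies from spanning only 8
    vertices. The blow-up turns each such coincidence into a linear relation between lines. The
    coordinates have no torsion up to 10000, so a small nonzero integer determinant can be
    cancelled, and finitely many colour patterns decide all cases. *)

Section TightSets.
Variable T : finType.
Implicit Types (e f g x : {set T}) (A B C H : {set {set T}}) (q D : {set T}).

Definition sparse H : Prop :=
  [/\ forall e, e \in H -> #|e| = 3,
      forall A, A \subset H -> 0 < #|A| <= 5 -> #|A| + 2 <= #|cover A|
    & forall A, A \subset H -> #|A| = 6 -> 9 <= #|cover A|].

Definition tight H A := [&& A \subset H, 0 < #|A| & #|cover A| <= #|A| + 2].

Lemma coverU A B : cover (A :|: B) = cover A :|: cover B.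
Proof. exact: bigcup_setU. Qed.

Lemma coverS A B : A \subset B -> cover A \subset cover B.
Proof.
move=> sAB; apply/bigcupsP => e eA; apply: bigcup_sup.
exact: (subsetP sAB).
Qed.

Lemma sub_cover A e : e \in A -> e \subset cover A.
Proof. by move=> eA; apply: bigcup_sup. Qed.

Lemma sparseS H H' : sparse H -> H' \subset H -> sparse H'.
Proof.
move=> [h1 h2 h3] sH; split.
- by move=> e /(subsetP sH)/h1.
- by move=> A sA; apply: h2; apply: subset_trans sH.
- by move=> A sA; apply: h3; apply: subset_trans sH.
Qed.

Lemma tightS H H' A : H' \subset H -> tight H' A -> tight H A.
Proof. by move=> sH /and3P[sA h1 h2]; apply/and3P; split=> //; exact: (subset_trans sA sH). Qed.

Lemma card_union_cover A B :
  #|cover (A :|: B)| + #|cover A :&: cover B| = #|cover A| + #|cover B|.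
Proof. by rewrite coverU cardsUI. Qed.

(** Inclusion-exclusion for the covers against inclusion-exclusion for the edges: two common
    vertices beyond the number of common edges absorb one of the two surpluses of 2. *)
Lemma tight_join H A B D : tight H A -> tight H B ->
  D \subset cover A -> D \subset cover B -> #|A :&: B| + 2 <= #|D| ->
  tight H (A :|: B).
Proof.
move=> /and3P[sA A0 cA] /and3P[sB B0 cB] DA DB hD.
have h := card_union_cover A B; have h' := cardsUI A B.
have : #|D| <= #|cover A :&: cover B| by apply: subset_leq_card; rewrite subsetI DA.
have : #|A| <= #|A :|: B| by apply: subset_leq_card; apply: subsetUl.
move=> h2 h3; apply/and3P; split; [by rewrite subUset sA|lia|lia].
Qed.

(** The count of [tight_join] with one more common vertex leaves one vertex too few for [sparse].
    For six edges the bound is 9, so one common vertex less suffices; this is the boolean term. *)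
Lemma tight_meetF H A B D : sparse H -> tight H A -> tight H B ->
  D \subset cover A -> D \subset cover B -> #|A :|: B| <= 6 ->
  #|A :&: B| + 3 <= #|D| + (#|A :|: B| == 6) -> False.
Proof.
move=> [_ h2 h3] /and3P[sA A0 cA] /and3P[sB B0 cB] DA DB le6 hD.
have h := card_union_cover A B; have h' := cardsUI A B.
have hs : A :|: B \subset H by rewrite subUset sA.
have : #|D| <= #|cover A :&: cover B| by apply: subset_leq_card; rewrite subsetI DA.
have : #|A| <= #|A :|: B| by apply: subset_leq_card; apply: subsetUl.
have [e6|n6] := eqVneq #|A :|: B| 6.
  by have := h3 _ hs e6; rewrite e6 eqxx in hD; lia.
by have := h2 _ hs; rewrite (negbTE n6) in hD; lia.
Qed.

Lemma tight_joinD H A B D : tight H A -> tight H B -> [disjoint A & B] ->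
  D \subset cover A -> D \subset cover B -> 2 <= #|D| -> tight H (A :|: B).
Proof.
move=> tA tB; rewrite -setI_eq0 => /eqP d dA dB hD.
by apply: (tight_join tA tB dA dB); rewrite d cards0.
Qed.

Lemma card_disjU A B : [disjoint A & B] -> #|A :|: B| = #|A| + #|B|.
Proof. by rewrite -setI_eq0 => /eqP d; rewrite -cardsUI d cards0 addn0. Qed.

Lemma tight_disjF H A B D : sparse H -> tight H A -> tight H B ->
  [disjoint A & B] -> D \subset cover A -> D \subset cover B ->
  #|A| + #|B| <= 6 -> 3 <= #|D| + (#|A| + #|B| == 6) -> False.
Proof.
move=> sp tA tB d dA dB h1 h2; apply: (tight_meetF sp tA tB dA dB);
 rewrite card_disjU //.
by move: d; rewrite -setI_eq0 => /eqP ->; rewrite cards0.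
Qed.

Lemma tight1 H e : sparse H -> e \in H -> tight H [set e].
Proof. by case=> h _ _ eH; rewrite /tight sub1set eH cards1 cover1 h. Qed.

Lemma disjoint_byF A B : (forall x, x \in A -> x \in B -> False) -> [disjoint A & B].
Proof.
move=> h; rewrite -setI_eq0; apply/eqP/setP => x; rewrite !inE; apply/negP => /andP[].
exact: h.
Qed.

Definition adj e f := (e != f) && (2 <= #|e :&: f|).

Lemma adjC e f : adj e f = adj f e.
Proof. by rewrite /adj eq_sym setIC. Qed.

Lemma tight_adj H e f : sparse H -> e \in H -> f \in H -> adj e f ->
  tight H [set e; f].
Proof.
move=> sp eH fH /andP[ne h].
apply: (@tight_joinD _ _ _ (e :&: f)) => //; rewrite ?cover1 ?subsetIl ?subsetIr //;
 try exact: tight1.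
by rewrite disjoints1 inE.
Qed.

Lemma tight_add H A e D : sparse H -> tight H A -> e \in H -> e \notin A ->
  D \subset cover A -> D \subset e -> 2 <= #|D| -> tight H (e |: A).
Proof.
move=> sp tA eH eA dA de h; apply: (@tight_joinD _ _ _ D) => //.
- exact: tight1.
- by rewrite disjoints1.
- by rewrite cover1.
Qed.

Lemma tight_addF H A e D : sparse H -> tight H A -> e \in H -> e \notin A ->
  D \subset cover A -> D \subset e -> #|A| <= 5 -> 3 <= #|D| + (#|A| == 5) ->
  False.
Proof.
move=> sp tA eH eA dA de h1 h2; apply: (@tight_disjF H [set e] A D) => //.
- exact: tight1.
- by rewrite disjoints1.
- by rewrite cover1.
- by rewrite cards1; lia.
- by rewrite cards1; move: h2; case: eqP => [->|] //=; lia.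
Qed.

Lemma tight_card H A : sparse H -> tight H A -> #|A| <= 5 -> #|cover A| = #|A| + 2.
Proof.
by move=> [_ h _] /and3P[sA A0 cA] h5; have := h _ sA; lia.
Qed.

Lemma cards3 (V : finType) (a b c : V) :
  a != b -> a != c -> b != c -> #|[set a; b; c]| = 3.
Proof.
move=> ab ac bc; rewrite setUC cardsU1 cards2 ab !inE.
by rewrite eq_sym (negbTE ac) eq_sym (negbTE bc).
Qed.

(* The pairs that are charged: deleting [k] edges that destroys at least [3 k] light pairs leaves
   [165 #|H| <= 61 #|light H|] to induction, as [165 <= 61 * 3]; otherwise [H] is
   [irreducible] below. *)
Definition light H : {set {set T}} :=
  [set q : {set T} | (#|q| == 2) && [exists A, [&& tight H A, #|A| <= 3 & q \subset cover A]]].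

Lemma lightP H q :
  reflect (#|q| = 2 /\ exists A, [/\ tight H A, #|A| <= 3 & q \subset cover A])
    (q \in light H).
Proof.
rewrite inE; apply: (iffP andP).
  by move=> [/eqP h /existsP[A /and3P[h1 h2 h3]]]; split=> //; exists A.
by move=> [h [A [h1 h2 h3]]]; split; [apply/eqP|apply/existsP; exists A; apply/and3P].
Qed.

Lemma lightS H H' : H' \subset H -> light H' \subset light H.
Proof.
move=> sH; apply/subsetP => q /lightP[h [A [h1 h2 h3]]]; apply/lightP.
by split=> //; exists A; split=> //; apply: tightS h1.
Qed.

Definition irreducible H : Prop :=
  (forall e, e \in H -> #|light H :\: light (H :\ e)| <= 2) /\
  (forall e f, e \in H -> f \in H -> e != f ->
     #|light H :\: light (H :\: [set e; f])| <= 5).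

(** Pairs with the endpoint [v] are told apart by their other endpoint, so a star of light pairs
    that all vanish with one edge has at most two rays. *)
Lemma irred_star H f v (W : {set T}) : irreducible H -> f \in H -> v \notin W ->
  (forall w, w \in W -> [set v; w] \in light H) ->
  (forall w, w \in W -> [set v; w] \notin light (H :\ f)) -> #|W| <= 2.
Proof.
move=> [h _] fH vW hW hN.
have <- : #|[set [set v; w] | w in W]| = #|W|.
  apply: card_in_imset => w w' wW w'W /setP/(_ w).
  rewrite !inE eqxx orbT; case: eqP => [wv|_ /esym/eqP->//].
  by rewrite -wv wW in vW.
apply: leq_trans (h _ fH); apply: subset_leq_card; apply/subsetP => q.
by move=> /imsetP[w wW ->]; rewrite inE hN // hW.
Qed.

End TightSets.

(** * Edges hooked onto a tight triple *)

Section Structure.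
Variable T : finType.
Implicit Types (e f g h k x y : {set T}) (A B C H : {set {set T}}) (q D : {set T}).

(** By sparseness the common edges alone cover two vertices more than their number, and [v] is a
    further common vertex, so the union is too dense. *)
Lemma overlapF H A C (v : T) : sparse H -> tight H A -> tight H C ->
  A :&: C != set0 -> v \in cover A -> v \in cover C ->
  v \notin cover (A :&: C) -> #|A| + #|C| - #|A :&: C| <= 6 -> False.
Proof.
move=> sp tA tC n0 vA vC vN le6.
have cU : #|A :|: C| <= 6 by rewrite cardsU.
have sI : A :&: C \subset H.
  by apply: subset_trans (subsetIl _ _) _; case/and3P: tA.
have h5 : 0 < #|A :&: C| <= 6.
  rewrite card_gt0 n0 /=; apply: leq_trans cU; apply: subset_leq_card.
  by apply: subset_trans (subsetIl _ _) (subsetUl _ _).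
have hI : #|A :&: C| + 2 <= #|cover (A :&: C)|.
  have [_ h2 h3] := sp; case: (ltnP 5 #|A :&: C|) => h.
    by have := h3 _ sI; lia.
  by apply: h2 => //; lia.
apply: (@tight_meetF _ H A C (v |: cover (A :&: C))) => //.
- by rewrite subUset sub1set vA coverS ?subsetIl.
- by rewrite subUset sub1set vC coverS ?subsetIr.
- by rewrite cardsU1 vN; lia.
Qed.

Lemma tight_pair_light H A q : tight H A -> #|A| <= 3 -> #|q| = 2 ->
  q \subset cover A -> q \in light H.
Proof. by move=> tA hA cq qA; apply/lightP; split=> //; exists A. Qed.


Lemma subset_set2 (U : finType) (a b : U) (S : {set U}) :
  ([set a; b] \subset S) = (a \in S) && (b \in S).
Proof. by rewrite subUset !sub1set. Qed.

Lemma two_in_set (U : finType) (S R : {set U}) :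
  S \subset R -> #|S| = 2 -> 2 <= #|R| -> #|R| <= 2 -> R = S.
Proof. by move=> sSR c2 _ cR; apply/esym/eqP; rewrite eqEcard sSR c2. Qed.

Lemma pair_exact H A e q : sparse H -> tight H A -> #|A| <= 4 -> e \in H ->
  e \notin A -> q \subset cover A -> q \subset e -> #|q| = 2 -> e :&: cover A = q.
Proof.
move=> sp tA cA eH eA qA qe cq; apply/eqP; rewrite eq_sym eqEcard subsetI qe qA /=.
rewrite cq leqNgt; apply/negP => h.
apply: (@tight_addF _ H A e (e :&: cover A)) => //; rewrite ?subsetIl ?subsetIr //.
  by lia.
by rewrite (leq_trans h) // leq_addr.
Qed.

(** Each hook adds one vertex to the five of [C]: six edges on 8 vertices. The hooks are distinct
    because each meets the cover in exactly its own pair. *)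
Lemma three_hooksF H C q1 q2 q3 x1 x2 x3 : sparse H -> tight H C -> #|C| = 3 ->
  x1 \in H -> x2 \in H -> x3 \in H -> x1 \notin C -> x2 \notin C -> x3 \notin C ->
  q1 \subset cover C -> q2 \subset cover C -> q3 \subset cover C ->
  q1 \subset x1 -> q2 \subset x2 -> q3 \subset x3 ->
  #|q1| = 2 -> #|q2| = 2 -> #|q3| = 2 -> q1 != q2 -> q1 != q3 -> q2 != q3 -> False.
Proof.
move=> sp tC cC x1H x2H x3H x1C x2C x3C q1C q2C q3C s1 s2 s3 c1 c2 c3 n12 n13 n23.
have e1 := pair_exact sp tC; rewrite cC in e1.
have ne q q' x x' : x \in H -> x \notin C -> q \subset cover C -> q \subset x ->
    #|q| = 2 -> q' \subset cover C -> q' \subset x' -> #|q'| = 2 -> q != q' -> x != x'.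
  move=> xH xC qC qx cq qC' qx' cq'; apply: contra => /eqP xx.
  by rewrite -(e1 x q) // -(e1 x q') // xx.
have m12 : x1 != x2 by apply: (ne q1 q2).
have m13 : x1 != x3 by apply: (ne q1 q3).
have m23 : x2 != x3 by apply: (ne q2 q3).
have t4 : tight H (x1 |: C) by apply: (@tight_add _ H C x1 q1); rewrite ?c1.
have x2N : x2 \notin x1 |: C by rewrite !inE eq_sym (negbTE m12).
have sub q x : q \subset cover C -> q \subset cover (x |: C).
  by move=> h; apply: subset_trans h (coverS (subsetUr _ _)).
have t5 : tight H (x2 |: (x1 |: C)).
  by apply: (@tight_add _ H _ x2 q2); rewrite ?c2 ?sub.
apply: (@tight_addF _ H _ x3 q3) t5 _ _ _ _ _ _ => //.
- by rewrite !inE ![x3 == _]eq_sym (negbTE m13) (negbTE m23).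
- by apply: subset_trans (coverS (subsetUr _ _)); apply: sub.
- by rewrite !cardsU1 x2N x1C cC.
- by rewrite !cardsU1 x2N x1C cC c3.
Qed.

Definition hooked H C (v w : T) :=
  [exists x in H, (x \notin C) && ([set v; w] \subset x)].

(** At least two of the four light pairs {v, w} survive the deletion of [f]. A set that keeps one
    light is disjoint from [C], since [f] is the only edge of [C] at [v]. With three edges it
    collides with [C], with two edges it collides with [C] and the hook [x0]; so it is a single edge
    hooked at that pair. *)
Lemma star_irred H C f (v : T) x0 q0 : sparse H -> irreducible H ->
  tight H C -> #|C| = 3 -> f \in C -> v \in f ->
  (forall y, y \in C -> v \in y -> y = f) ->
  x0 \in H -> x0 \notin C -> q0 \subset cover C -> q0 \subset x0 -> #|q0| = 2 ->
  1 < #|[set w in cover C :\ v | hooked H C v w]|.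
Proof.
move=> sp irr tC cC fC vf vN x0H x0C q0C q0x0 cq0; set W' := [set w in _ | _].
have fH : f \in H by case/and3P: tC => /subsetP h1 _ _; apply: h1.
have vC : v \in cover C by apply/bigcupP; exists f.
pose W := cover C :\ v.
have cW : #|W| = 4.
  by have := tight_card sp tC; rewrite cC => /(_ isT); rewrite (cardsD1 v) vC; rewrite /W; lia.
rewrite ltnNge; apply/negP => W'le.
suff : #|W :\: W'| <= 2.
  have := cardsID W' W; rewrite (_ : W :&: W' = W'); first by move: cW W'le; clear; lia.
  by apply/setIidPr/subsetP => w; rewrite inE => /andP[].
apply: (@irred_star _ H f v) => //.
- by rewrite inE [v \in W]in_setD1 eqxx andbF.
- move=> w; rewrite inE => /andP[]; rewrite !in_setD1 => wW1 /andP[wv wC].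
  apply: (tight_pair_light tC); rewrite ?cC ?cards2 1?eq_sym ?wv //.
  by rewrite subset_set2 vC.
move=> w wW; apply/negP => /lightP[_ [A [tA cA sA]]].
have wC : w \in cover C by move: wW; rewrite !inE => /andP[_ /andP[]].
have fA : f \notin A.
  by apply/negP => fA; case/and3P: tA => /subsetP/(_ _ fA); rewrite !inE eqxx.
have {}tA : tight H A by apply: tightS tA; apply: subD1set.
have vA : v \in cover A by apply: (subsetP sA); rewrite !inE eqxx.
have wv : v != w by move: wW; rewrite !inE eq_sym => /andP[_ /andP[]].
have cvw : #|[set v; w]| = 2 by rewrite cards2 wv.
have svw : [set v; w] \subset cover C by rewrite subset_set2 vC.
have nh : ~~ hooked H C v w.
  by move: wW; rewrite !inE wC eq_sym wv /= => /andP[].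
have [d|n0] := eqVneq (A :&: C) set0; last first.
  apply: (overlapF sp tA tC n0 vA vC); last first.
    by move: n0 cA; rewrite -card_gt0 cC; clear; lia.
  by apply/negP => /bigcupP[y]; rewrite inE => /andP[yA yC /(vN _ yC)] yf; rewrite -yf yA in fA.
have d4 : [disjoint A & C] by rewrite -setI_eq0 d.
have noe x : x \in A -> ~~ ([set v; w] \subset x).
  move=> xA; apply: contra nh => s; apply/exists_inP; exists x.
    by case/and3P: tA => /subsetP h _ _; apply: h.
  by rewrite s andbT (disjointFr d4).
have [h1|h1] := eqVneq #|A| 1.
  move/eqP/cards1P: h1 => [x Ax]; rewrite Ax cover1 in sA.
  by have := noe x; rewrite Ax inE eqxx sA => /(_ isT).
have [h2|h2] := eqVneq #|A| 2.
  (* If the double contains [x0], the two pairs differ and the covers share three vertices;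
     otherwise [x0] joins [C] and there are six edges. *)
  have [x0A|x0A] := boolP (x0 \in A).
    apply: (@tight_disjF _ H A C ([set v; w] :|: q0)); rewrite ?h2 ?cC //.
    - by rewrite subUset sA (subset_trans q0x0) ?sub_cover.
    - by rewrite subUset svw.
    - rewrite /= addn0 ltnNge; apply/negP => le2.
      have e1 : [set v; w] :|: q0 = [set v; w].
        by apply: two_in_set; rewrite ?subsetUl ?cvw // -cvw subset_leq_card // subsetUl.
      have e2 : [set v; w] :|: q0 = q0.
        by apply: two_in_set; rewrite ?subsetUr ?cq0 // -cvw subset_leq_card // subsetUl.
      by move: (noe _ x0A); rewrite -e1 e2 q0x0.
  have t4 : tight H (x0 |: C) by apply: (@tight_add _ H C x0 q0); rewrite ?cq0.
  apply: (@tight_disjF _ H A (x0 |: C) [set v; w]); rewrite ?h2 ?cvw //; try by rewrite cardsU1 x0C cC.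
    apply: disjoint_byF => y yA; rewrite !inE => /orP[/eqP yx|yC].
      by rewrite -yx yA in x0A.
    by rewrite (disjointFr d4) in yC.
  by apply: subset_trans svw (coverS (subsetUr _ _)).
have h3 : #|A| = 3 by case/and3P: tA => _ + _; move: h1 h2 cA; clear; lia.
by apply: (@tight_disjF _ H A C [set v; w]); rewrite ?h3 ?cC ?cvw.
Qed.

(** One hook would produce two at each of the private vertices [v1] and [v2]; the two stars have at
    most one pair in common, so three distinct pairs are hooked. *)
Lemma no_hook3 H C f h (v1 v2 : T) x0 q0 : sparse H -> irreducible H ->
  tight H C -> #|C| = 3 -> f \in C -> v1 \in f ->
  (forall y, y \in C -> v1 \in y -> y = f) -> h \in C -> v2 \in h ->
  (forall y, y \in C -> v2 \in y -> y = h) -> v1 != v2 ->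
  x0 \in H -> x0 \notin C -> q0 \subset cover C -> q0 \subset x0 -> #|q0| = 2 ->
  False.
Proof.
move=> sp irr tC cC fC vf vN hC vh vN' v12 x0H x0C q0C q0x0 cq0.
have /card_gt1P[w1 [w2 [+ + w12]]] := star_irred sp irr tC cC fC vf vN x0H x0C q0C q0x0 cq0.
have /card_gt1P[w3 [w4 [+ + w34]]] := star_irred sp irr tC cC hC vh vN' x0H x0C q0C q0x0 cq0.
have vC : v1 \in cover C by apply/bigcupP; exists f.
have vC' : v2 \in cover C by apply/bigcupP; exists h.
(* Then {v2, w3} misses [v1] and differs from both hooked pairs at [v1]. *)
wlog w3v : w3 w4 w34 / w3 != v1 => [th|].
  have [e|n] := eqVneq w3 v1; last exact: (th w3 w4).
  by move=> ha hb; apply: (th w4 w3) => //; rewrite -?e eq_sym.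
rewrite !inE => /andP[/andP[n3 w3C] /exists_inP[x3 x3H /andP[x3C s3]]] _.
move=> /andP[/andP[n1 w1C] /exists_inP[x1 x1H /andP[x1C s1]]].
move=> /andP[/andP[n2 w2C] /exists_inP[x2 x2H /andP[x2C s2]]].
apply: (@three_hooksF H C [set v1; w1] [set v1; w2] [set v2; w3] x1 x2 x3) => //;
  rewrite ?subset_set2 ?cards2 ?vC ?vC' ?[v1 == _]eq_sym ?[v2 == _]eq_sym ?n1 ?n2 ?n3 //.
- apply/negP => /eqP/setP/(_ w1); rewrite !inE eqxx orbT (negbTE w12) orbF.
  by rewrite (negbTE n1).
- apply/negP => /eqP/setP/(_ v1); rewrite !inE eqxx /=.
  by rewrite (negbTE v12) eq_sym (negbTE w3v).
- apply/negP => /eqP/setP/(_ v1); rewrite !inE eqxx /=.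
  by rewrite (negbTE v12) eq_sym (negbTE w3v).
Qed.

End Structure.

(** * Doubles *)

Section Doubles.
Variable T : finType.
Implicit Types (e f g h k x y : {set T}) (A B C H : {set {set T}}) (q D : {set T}).

Definition dbl H : {set {set {set T}}} := [set d : {set {set T}} | tight H d & #|d| == 2].

(* The two vertices lying in only one of the two edges of the double [d]. *)
Definition apex (d : {set {set T}}) : {set T} := cover d :\: \bigcap_(e in d) e.

Lemma coverU1 e A : cover (e |: A) = e :|: cover A.
Proof. by rewrite coverU cover1. Qed.

Lemma cover2 e f : cover [set e; f] = e :|: f.
Proof. by rewrite coverU1 cover1. Qed.

Lemma apex2 e f : apex [set e; f] = (e :|: f) :\: (e :&: f).
Proof. by rewrite /apex cover2 bigcap_setU !big_set1. Qed.

Lemma apex_sub (d : {set {set T}}) : apex d \subset cover d.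
Proof. exact: subsetDl. Qed.

Lemma dblP H (d : {set {set T}}) : sparse H -> d \in dbl H ->
  exists e f, [/\ d = [set e; f], e \in H, f \in H, e != f & #|e :&: f| = 2].
Proof.
move=> sp; rewrite inE => /andP[td /cards2P[e [f [ef dE]]]]; exists e, f.
have eH : e \in H by case/and3P: td => /subsetP h _ _; apply: h; rewrite dE !inE eqxx.
have fH : f \in H by case/and3P: td => /subsetP h _ _; apply: h; rewrite dE !inE eqxx orbT.
split=> //.
have := tight_card sp td; rewrite dE cover2 cards2 ef => /(_ isT) /=.
have [h _ _] := sp; have := cardsUI e f; rewrite (h e eH) (h f fH); lia.
Qed.

Lemma dbl_tight H d : d \in dbl H -> tight H d.
Proof. by rewrite inE => /andP[]. Qed.

Lemma dbl_card H d : d \in dbl H -> #|d| = 2.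
Proof. by rewrite inE => /andP[_ /eqP]. Qed.

Lemma dbl_cover H d : sparse H -> d \in dbl H -> #|cover d| = 4.
Proof. by move=> sp dH; rewrite (tight_card sp (dbl_tight dH)) (dbl_card dH). Qed.

Lemma adj_dbl H e f : sparse H -> e \in H -> f \in H -> adj e f -> [set e; f] \in dbl H.
Proof.
by move=> sp eH fH ef; rewrite inE tight_adj //= cards2; case/andP: ef => ->.
Qed.

Lemma apex_card H d : sparse H -> d \in dbl H -> #|apex d| = 2.
Proof.
move=> sp dH; have [e [f [dE eH fH ef h]]] := dblP sp dH.
rewrite dE apex2 cardsD (_ : _ :&: _ = e :&: f); last first.
  by apply/setIidPr; apply: subset_trans (subsetIl _ _) (subsetUl _ _).
by have := dbl_cover sp dH; rewrite dE cover2 h => ->.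
Qed.

Lemma dbl_mem H d e : sparse H -> d \in dbl H -> e \in d ->
  exists f, [/\ d = [set e; f], e \in H, f \in H, e != f & #|e :&: f| = 2].
Proof.
move=> sp dH ed; have [a [b [dE aH bH ab h]]] := dblP sp dH.
move: ed; rewrite dE !inE => /orP[]/eqP->; first by exists b.
by exists a; rewrite setUC eq_sym setIC.
Qed.

Lemma apex_nsub H d e : sparse H -> d \in dbl H -> e \in d -> ~~ (apex d \subset e).
Proof.
move=> sp dH ed; have [b [dE eH bH eb h]] := dbl_mem sp dH ed.
apply/negP => s; have [v]: exists v, v \in b :\: e.
  apply/card_gt0P; rewrite cardsD setIC h.
  by have [c _ _] := sp; rewrite (c b bH).
rewrite inE => /andP[ve vb]; case/negP: (ve); apply: (subsetP s).
by rewrite dE apex2 !inE vb orbT andbT (negbTE ve).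
Qed.

Lemma apex_light H d : sparse H -> d \in dbl H -> apex d \in light H.
Proof.
move=> sp dH; apply: (tight_pair_light (dbl_tight dH)).
- by rewrite (dbl_card dH).
- exact: apex_card dH.
- exact: apex_sub.
Qed.

Lemma tight_meet2 H A B q : sparse H -> tight H A -> tight H B -> [disjoint A & B] ->
  #|A| + #|B| <= 5 -> q \subset cover A -> q \subset cover B -> #|q| = 2 ->
  cover A :&: cover B = q.
Proof.
move=> sp tA tB d le qA qB cq; apply/eqP; rewrite eq_sym eqEcard subsetI qA qB cq /=.
rewrite leqNgt; apply/negP => h.
apply: (@tight_disjF _ H A B (cover A :&: cover B)) => //; rewrite ?subsetIl ?subsetIr //.
  by lia.
by rewrite (leq_trans h) // leq_addr.
Qed.

Lemma host_tight H d g : sparse H -> d \in dbl H -> g \in H -> g \notin d ->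
  apex d \subset g ->
  [/\ tight H (g |: d), #|g |: d| = 3, #|cover (g |: d)| = 5 & g :&: cover d = apex d].
Proof.
move=> sp dH gH gd s; have c2 := apex_card sp dH.
have t3 : tight H (g |: d).
  by apply: (@tight_add _ H d g (apex d)); rewrite ?c2 ?apex_sub //; exact: dbl_tight.
have c3 : #|g |: d| = 3 by rewrite cardsU1 gd (dbl_card dH).
split=> //; first by rewrite (tight_card sp t3) c3.
apply: (pair_exact sp (dbl_tight dH)); rewrite ?(dbl_card dH) //; exact: apex_sub.
Qed.

(** The two doubles form a tight set of four edges, on which at most one pair can be hooked. Of the
    at least seven pairs of the triple [g |: d] outside [g], all but that one vanish when both edges
    of [d] are deleted: six, where irreducibility allows five. *)
Lemma no_double_host H d0 d g : sparse H -> irreducible H -> d0 \in dbl H ->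
  d \in dbl H -> [disjoint d0 & d] -> g \in d0 -> apex d \subset g -> False.
Proof.
move=> sp irr d0H dH dis gd0 s.
have gH : g \in H.
  by case/and3P: (dbl_tight d0H) => /subsetP h _ _; apply: h.
have gd : g \notin d by rewrite (disjointFr dis).
have [t3 c3 cc3 gI] := host_tight sp dH gH gd s.
have t4 : tight H (d0 :|: d).
  apply: (@tight_joinD _ H d0 d (apex d)); rewrite ?dbl_tight //.
  - exact: subset_trans s (sub_cover gd0).
  - exact: apex_sub.
  - by rewrite (apex_card sp dH).
have c4 : #|d0 :|: d| = 4 by rewrite card_disjU // (dbl_card d0H) (dbl_card dH).
have cI : cover d0 :&: cover d = apex d.
  apply: (tight_meet2 sp); rewrite ?dbl_tight ?(dbl_card d0H) ?(dbl_card dH) ?(apex_card sp dH) //.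
    exact: subset_trans s (sub_cover gd0).
  exact: apex_sub.
have s34 : g |: d \subset d0 :|: d by rewrite setSU // sub1set.
pose P := [set q : {set T} | (q \subset cover (g |: d)) && (#|q| == 2)].
pose Q := [set q : {set T} | (q \subset g) && (#|q| == 2)].
pose L := P :\: Q.
(* Ten pairs on five vertices, less the three inside [g]. *)
have cL : 7 <= #|L|.
  have sQP : Q \subset P.
    apply/subsetP => q; rewrite !inE => /andP[h ->]; rewrite andbT.
    by rewrite (subset_trans h) // sub_cover // !inE eqxx.
  rewrite cardsD (setIidPr sQP) !cards_draws cc3.
  by have [-> // _ _] := sp.
pose K := [set q in L | [exists x in H, (x \notin d0 :|: d) && (q \subset x)]].
have LW q : q \in L -> q \subset cover (d0 :|: d).
  by rewrite !inE => /andP[_ /andP[h _]]; apply: subset_trans h (coverS s34).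
have Lc q : q \in L -> #|q| = 2 by rewrite !inE => /andP[_ /andP[_ /eqP]].
have cK : #|K| <= 1.
  rewrite leqNgt; apply/negP => /card_gt1P[q1 [q2 []]].
  rewrite inE => /andP[q1L /exists_inP[x1 x1H /andP[x1N s1]]].
  rewrite inE => /andP[q2L /exists_inP[x2 x2H /andP[x2N s2]]] q12.
  have e1 := pair_exact sp t4; rewrite c4 in e1.
  have x12 : x1 != x2.
    apply: contra q12 => /eqP xx.
    have E1 := e1 x1 q1 isT x1H x1N (LW _ q1L) s1 (Lc _ q1L).
    have E2 := e1 x2 q2 isT x2H x2N (LW _ q2L) s2 (Lc _ q2L).
    by rewrite -E1 -E2 xx.
  have t5 : tight H (x1 |: (d0 :|: d)).
    by apply: (@tight_add _ H _ x1 q1); rewrite ?LW ?Lc.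
  apply: (@tight_addF _ H _ x2 q2 sp t5 x2H) => //.
  - by rewrite in_setU1 negb_or x2N eq_sym x12.
  - by apply: subset_trans (coverS (subsetUr _ _)); apply: LW.
  - by rewrite cardsU1 x1N c4.
  - by rewrite cardsU1 x1N c4 Lc.
have [a [b [dE aH bH ab _]]] := dblP sp dH.
have [_ /(_ a b aH bH ab)] := irr; rewrite -dE leqNgt => /negP; apply.
suff sub : L :\: K \subset light H :\: light (H :\: d).
  apply: leq_trans (subset_leq_card sub).
  have := cardsID K L; rewrite (_ : L :&: K = K); first by move: cL cK; clear; lia.
  by apply/setIidPr/subsetP => q; rewrite inE => /andP[].
apply/subsetP => q; rewrite inE => /andP[qK qL].
have qC : q \subset cover (g |: d).
  by move: qL; rewrite !inE => /andP[_ /andP[]].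
rewrite inE andbC (tight_pair_light t3) ?c3 ?Lc //=.
apply/negP => /lightP[_ [A [tA cA sA]]].
have nd y : y \in A -> y \notin d.
  by move=> yA; case/and3P: tA => /subsetP/(_ _ yA); rewrite inE => /andP[].
have {}tA : tight H A by apply: tightS tA; apply: subsetDl.
have [v vq vg] : exists2 v, v \in q & v \notin g.
  apply/subsetPn; move: (qL); rewrite in_setD => /andP[+ _].
  by rewrite inE negb_and => /orP[//|]; rewrite (Lc _ qL).
have vd : v \in cover d.
  by move/subsetP: qC => /(_ _ vq); rewrite coverU1 inE (negbTE vg).
have vd0 : v \notin cover d0.
  apply: contra vg => h; have : v \in apex d by rewrite -cI inE h.
  exact: (subsetP s).
have vA : v \in cover A by apply: (subsetP sA).
have [dj|n0] := eqVneq (A :&: (d0 :|: d)) set0; last first.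
  apply: (overlapF sp tA t4 n0 vA).
  - by rewrite coverU inE vd orbT.
  - apply: contra vd0 => /bigcupP[y]; rewrite !inE => /andP[yA yd] vy.
    by apply/bigcupP; exists y => //; move: yd; rewrite (negbTE (nd _ yA)) orbF.
  - by move: n0 cA; rewrite -card_gt0 c4; clear; lia.
have d4 : [disjoint A & d0 :|: d] by rewrite -setI_eq0 dj.
have [h1|h1] := eqVneq #|A| 1.
  move/eqP/cards1P: h1 => [x Ax]; rewrite Ax cover1 in sA.
  case/negP: qK; rewrite inE qL; apply/exists_inP; exists x.
    by case/and3P: tA; rewrite Ax sub1set.
  by rewrite sA andbT; move: d4; rewrite Ax disjoints1.
have [h2|h2] := eqVneq #|A| 2.
  by apply: (@tight_disjF _ H A (d0 :|: d) q); rewrite ?h2 ?c4 ?Lc ?LW.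
have h3 : #|A| = 3 by case/and3P: tA => _ + _; move: h1 h2 cA; clear; lia.
by apply: (@tight_disjF _ H A (g |: d) q); rewrite ?h3 ?c3 ?Lc //; apply: disjointWr d4.
Qed.

(** A neighbour in [d] would have to contain the apex; any other neighbour forms with the host a
    double disjoint from [d], excluded by [no_double_host]. *)
Lemma isolated_host H d g g' : sparse H -> irreducible H -> d \in dbl H ->
  g \in H -> g \notin d -> apex d \subset g -> g' \in H -> adj g g' -> False.
Proof.
move=> sp irr dH gH gd s g'H gg'.
have [t3 c3 cc3 gI] := host_tight sp dH gH gd s.
have [g'd|g'd] := boolP (g' \in d).
  have h : g :&: g' \subset apex d.
    by rewrite -gI setIS // sub_cover.
  have /negP := apex_nsub sp dH g'd; apply.
  suff -> : apex d = g :&: g' by apply: subsetIr.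
  apply/eqP; rewrite eq_sym eqEcard h (apex_card sp dH).
  by case/andP: gg'.
apply: (no_double_host sp irr (adj_dbl sp gH g'H gg') dH _ _ s); last by rewrite !inE eqxx.
by apply: disjoint_byF => y; rewrite !inE => /orP[]/eqP->; [rewrite (negbTE gd)|rewrite (negbTE g'd)].
Qed.

(** If they shared an edge, the other edge of [d2] would meet the cover of [d1] only inside the
    shared edge, which would then contain the apex. *)
Lemma dbl_share_apex H d1 d2 : sparse H -> d1 \in dbl H -> d2 \in dbl H ->
  d1 != d2 -> apex d1 = apex d2 -> [disjoint d1 & d2].
Proof.
move=> sp d1H d2H n12 ea; apply: disjoint_byF => f f1 f2.
have [h [d2E fH hH fhn fh]] := dbl_mem sp d2H f2.
have hd1 : h \notin d1.
  apply/negP => hd1; case/negP: n12; rewrite eq_sym eqEcard (dbl_card d1H) (dbl_card d2H) d2E.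
  by rewrite subset_set2 f1 hd1.
have e1 : h :&: cover d1 = f :&: h.
  apply: (pair_exact sp (dbl_tight d1H)); rewrite ?(dbl_card d1H) ?fh //.
    by apply: subset_trans (subsetIl _ _) (sub_cover f1).
  exact: subsetIr.
have /negP := apex_nsub sp d2H f2; apply.
apply/subsetP => u ua; have u1 : u \in cover d1.
  by apply: (subsetP (apex_sub _)); rewrite ea.
have := subsetP (apex_sub d2) _ ua; rewrite d2E cover2 inE => /orP[//|uh].
have : u \in h :&: cover d1 by rewrite inE uh.
by rewrite e1 inE => /andP[].
Qed.

(** Three quadruples through one pair have at most 2 + 3 * 2 = 8 vertices, for six edges. *)
Lemma three_apexF H d1 d2 d3 q : sparse H -> d1 \in dbl H -> d2 \in dbl H ->
  d3 \in dbl H -> d1 != d2 -> d1 != d3 -> d2 != d3 ->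
  apex d1 = q -> apex d2 = q -> apex d3 = q -> False.
Proof.
move=> sp h1 h2 h3 n12 n13 n23 e1 e2 e3.
have j12 := dbl_share_apex sp h1 h2 n12 (etrans e1 (esym e2)).
have j13 := dbl_share_apex sp h1 h3 n13 (etrans e1 (esym e3)).
have j23 := dbl_share_apex sp h2 h3 n23 (etrans e2 (esym e3)).
have cq : #|q| = 2 by rewrite -e1 (apex_card sp h1).
have s1 : q \subset cover d1 by rewrite -e1 apex_sub.
have s2 : q \subset cover d2 by rewrite -e2 apex_sub.
have s3 : q \subset cover d3 by rewrite -e3 apex_sub.
have t4 : tight H (d1 :|: d2).
  by apply: (@tight_joinD _ H d1 d2 q); rewrite ?dbl_tight ?cq.
apply: (@tight_disjF _ H (d1 :|: d2) d3 q) => //.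
- exact: dbl_tight.
- by apply: disjoint_byF => y; rewrite inE => /orP[y1|y2] y3;
   [rewrite (disjointFr j13 y1) in y3|rewrite (disjointFr j23 y2) in y3].
- by apply: subset_trans s1 (coverS (subsetUl _ _)).
- by rewrite card_disjU // (dbl_card h1) (dbl_card h2) (dbl_card h3).
- by rewrite card_disjU // (dbl_card h1) (dbl_card h2) (dbl_card h3) cq.
Qed.

End Doubles.

(** * Components of the adjacency relation *)

Lemma sum_card_le (I U : finType) (A : {set I}) (G : I -> {set U}) (B : {set U}) :
  (forall i, i \in A -> G i \subset B) ->
  (forall i j q, i \in A -> j \in A -> q \in G i -> q \in G j -> i = j) ->
  \sum_(i in A) #|G i| <= #|B|.
Proof.
move=> sub inj.
rewrite (eq_bigr (fun i => \sum_(q in B) (q \in G i)%N)); last first.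
  move=> i iA; rewrite -sum1_card [RHS]big_mkcond [LHS]big_mkcond /=.
  apply: eq_bigr => q _; case: ifP => [/(subsetP (sub i iA))->//|_].
  by case: ifP.
rewrite exchange_big /= -sum1_card; apply: leq_sum => q _.
have [h|h] := boolP [exists i in A, q \in G i]; last first.
  rewrite big1 // => i iA; apply/eqP; rewrite eqb0; apply: contra h => h.
  by apply/exists_inP; exists i.
have [i iA qi] := exists_inP h.
rewrite (bigD1 i) //= qi big1 // => j /andP[jA ji]; apply/eqP; rewrite eqb0.
by apply: contra ji => qj; apply/eqP; apply: (inj _ _ q).
Qed.

Lemma sum_disjU (I : finType) (A B : {set I}) (F : I -> nat) : [disjoint A & B] ->
  \sum_(i in A :|: B) F i = \sum_(i in A) F i + \sum_(i in B) F i.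
Proof. by move=> d; rewrite -bigU //; apply: eq_bigl => i; rewrite !inE. Qed.

Section Clusters.
Variable T : finType.
Implicit Types (e f g h k x y : {set T}) (A B C H d : {set {set T}}) (q D : {set T}).

Definition edge_pairs A : {set {set T}} :=
  [set q : {set T} | (#|q| == 2) && [exists e in A, q \subset e]].

Lemma edge_pairsP A q :
  reflect (#|q| = 2 /\ exists2 e, e \in A & q \subset e) (q \in edge_pairs A).
Proof.
rewrite inE; apply: (iffP andP) => [[/eqP h /exists_inP]|[h1 h2]] //.
by split; [apply/eqP|apply/exists_inP].
Qed.

Lemma card_edge_pairs_add A e (v : T) : #|e| = 3 -> v \in e -> v \notin cover A ->
  #|edge_pairs A| + 2 <= #|edge_pairs (e |: A)|.
Proof.
move=> ce ve vA; pose S := [set [set v; w] | w in e :\ v].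
have cS : #|S| = 2.
  rewrite card_in_imset; first by move: ce; rewrite (cardsD1 v) ve; lia.
  move=> w w'; rewrite !inE => /andP[wv _] /andP[w'v _] /setP/(_ w).
  by rewrite !inE eqxx orbT (negbTE wv) => /esym/eqP.
have dS : edge_pairs A :&: S = set0.
  apply/setP => q; rewrite [RHS]inE in_setI; apply/negP => /andP[/edge_pairsP[_ [f fA qf]]].
  move=> /imsetP[w _ qE]; case/negP: vA; apply/bigcupP; exists f => //.
  by apply: (subsetP qf); rewrite qE !inE eqxx.
rewrite -cS -cardsUI dS cards0 addn0; apply: subset_leq_card.
apply/subsetP => q; rewrite in_setU => /orP[/edge_pairsP[h [f fA qf]]|/imsetP[w]].
  by apply/edge_pairsP; split=> //; exists f => //; rewrite inE fA orbT.
rewrite !inE => /andP[wv we] ->; rewrite cards2 [v == w]eq_sym wv /=.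
by apply/exists_inP; exists e; rewrite ?inE ?eqxx // subset_set2 ve.
Qed.

Lemma card_edge_pairs1 e : #|e| = 3 -> #|edge_pairs [set e]| = 3.
Proof.
move=> ce; transitivity ('C(#|e|, 2)); last by rewrite ce.
rewrite -cards_draws; apply: eq_card => q; rewrite !inE andbC; congr (_ && _).
by apply/exists_inP/idP => [[f]|h]; [rewrite inE => /eqP->|exists e; rewrite ?inE].
Qed.

Definition chains H : {set {set {set T}}} :=
  [set C : {set {set T}} | [exists a in H, [exists b in H, [exists c in H,
     [&& adj a b, adj b c, a != c & C == [set a; b; c]]]]]].

Lemma chainsP H C : C \in chains H -> exists a b c,
  [/\ [/\ a \in H, b \in H & c \in H], adj a b, adj b c, a != c & C = [set a; b; c]].
Proof.
rewrite inE => /exists_inP[a aH /exists_inP[b bH /exists_inP[c cH]]].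
by case/and4P=> ab bc ac /eqP CE; exists a, b, c.
Qed.

Lemma mem_chains H a b c : a \in H -> b \in H -> c \in H -> adj a b -> adj b c ->
  a != c -> [set a; b; c] \in chains H.
Proof.
move=> aH bH cH ab bc ac; rewrite inE.
apply/exists_inP; exists a => //; apply/exists_inP; exists b => //.
by apply/exists_inP; exists c => //; rewrite ab bc ac eqxx.
Qed.

Lemma adj_card H e f : sparse H -> e \in H -> f \in H -> adj e f -> #|e :&: f| = 2.
Proof.
move=> sp eH fH ef; have dH := adj_dbl sp eH fH ef.
have [b [E _ _ eb h]] := dbl_mem sp dH (set21 e f).
have : f \in [set e; b] by rewrite -E !inE eqxx orbT.
rewrite !inE => /orP[/eqP fe|/eqP->//].
by case/andP: ef; rewrite fe eqxx.
Qed.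

Lemma chain_apart H a b c : sparse H -> a \in H -> b \in H -> c \in H ->
  adj a b -> adj b c -> a != c ->
  [/\ tight H [set a; b; c], #|[set a; b; c]| = 3 &
   exists v, [/\ v \in c, v \notin a & v \notin b]].
Proof.
move=> sp aH bH cH ab bc ac.
have [nab nbc] : a != b /\ b != c by case/andP: ab; case/andP: bc.
have dH := adj_dbl sp aH bH ab.
have cN : c \notin [set a; b] by rewrite !inE ![c == _]eq_sym negb_or ac nbc.
have E : [set a; b; c] = c |: [set a; b] by rewrite setUC.
have t3 : tight H [set a; b; c].
  rewrite E; apply: (@tight_add _ H _ c (b :&: c)) => //; first exact: dbl_tight.
  - by apply: subset_trans (subsetIl _ _) (sub_cover _); rewrite !inE eqxx orbT.
  - exact: subsetIr.
  - by case/andP: bc.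
have c3 : #|[set a; b; c]| = 3 by rewrite cards3.
split=> //; have c5 := tight_card sp t3; rewrite c3 in c5.
have [v] : exists v, v \in cover [set a; b; c] :\: cover [set a; b].
  apply/card_gt0P; rewrite cardsD (setIidPr (coverS _)) ?subsetUl //.
  by rewrite c5 // (dbl_cover sp dH).
rewrite E coverU1 cover2 !inE negb_or => /andP[/andP[va vb]].
by rewrite (negbTE va) (negbTE vb) !orbF => vc; exists v.
Qed.

Lemma chain_tight H C : sparse H -> C \in chains H -> tight H C.
Proof.
move=> sp /chainsP[a [b [c [[aH bH cH] ab bc ac ->]]]].
by case: (chain_apart sp aH bH cH ab bc ac).
Qed.

Lemma chain_card H C : sparse H -> C \in chains H -> #|C| = 3.
Proof.
move=> sp /chainsP[a [b [c [[aH bH cH] ab bc ac ->]]]].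
by case: (chain_apart sp aH bH cH ab bc ac).
Qed.

(** Each end of a chain has a vertex of its own, so [no_hook3] applies. *)
Lemma chain_nohook H C x q : sparse H -> irreducible H -> C \in chains H ->
  x \in H -> x \notin C -> q \subset cover C -> q \subset x -> #|q| = 2 -> False.
Proof.
move=> sp irr /chainsP[a [b [c [[aH bH cH] ab bc ac E]]]] xH xC qC qx cq.
have [t3 c3 [v [vc va vb]]] := chain_apart sp aH bH cH ab bc ac.
have ca : c != a by rewrite eq_sym.
have ba : adj b a by rewrite adjC.
have cb : adj c b by rewrite adjC.
have [_ _ [u [ua uc ub]]] := chain_apart sp cH bH aH cb ba ca.
have aC : a \in C by rewrite E !inE eqxx.
have cC : c \in C by rewrite E !inE eqxx orbT.
have uN y : y \in C -> u \in y -> y = a.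
  by rewrite E !inE => /orP[/orP[/eqP->//|/eqP->]|/eqP->];
  rewrite ?(negbTE ub) ?(negbTE uc).
have vN y : y \in C -> v \in y -> y = c.
  by rewrite E !inE => /orP[/orP[/eqP->|/eqP->]|/eqP->//];
  rewrite ?(negbTE va) ?(negbTE vb).
have uv : u != v by apply: contra va => /eqP<-.
rewrite -E in t3 c3.
exact: (no_hook3 sp irr t3 c3 aC ua uN cC vc vN uv xH xC qC qx cq).
Qed.

Lemma chain_closed H C x y : sparse H -> irreducible H -> C \in chains H ->
  x \in H -> y \in C -> adj x y -> x \in C.
Proof.
move=> sp irr CH xH yC xy; apply/negPn/negP => xC.
have yH : y \in H by case/and3P: (chain_tight sp CH) => /subsetP s _ _; apply: s.
apply: (@chain_nohook H C x (x :&: y)) => //.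
- by apply: subset_trans (subsetIr _ _) (sub_cover yC).
- exact: subsetIl.
- exact: adj_card sp xH yH xy.
Qed.

(* In an irreducible sparse family these are the components of [adj], of size 1, 2, 3. *)
Definition singles H := [set e in H | [forall f in H, ~~ adj e f]].
Definition pures H := [set d in dbl H | ~~ [exists C in chains H, d \subset C]].
Definition clusters H := ([set [set e] | e in singles H] :|: pures H) :|: chains H.

Lemma singlesP H e : reflect (e \in H /\ forall f, f \in H -> ~~ adj e f) (e \in singles H).
Proof.
rewrite inE; apply: (iffP andP) => [[h /forall_inP]|[h h']] //.
by split=> //; apply/forall_inP.
Qed.

Lemma pure_dbl H d : d \in pures H -> d \in dbl H.
Proof. by rewrite inE => /andP[]. Qed.

Lemma dbl_adj H d e f : sparse H -> d \in dbl H -> e \in d -> f \in d -> e != f -> adj e f.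
Proof.
move=> sp dH ed fd ef; have [b [E _ _ eb h]] := dbl_mem sp dH ed.
move: fd; rewrite E !inE eq_sym (negbTE ef) => /eqP->.
by rewrite /adj eb h.
Qed.

Lemma dbl_memH H d e : d \in dbl H -> e \in d -> e \in H.
Proof. by move/dbl_tight => /and3P[/subsetP s _ _]; apply: s. Qed.

Lemma puresP H d : reflect (d \in dbl H /\ forall C, C \in chains H -> ~~ (d \subset C))
  (d \in pures H).
Proof.
rewrite [_ \in pures H]inE; apply: (iffP andP) => [[h /exists_inPn]|[h h']] //.
by split=> //; apply/exists_inPn.
Qed.

Variant cluster_spec H : {set {set T}} -> Prop :=
| ClusterSingle e of e \in singles H : cluster_spec H [set e]
| ClusterPure d of d \in pures H : cluster_spec H d
| ClusterChain C of C \in chains H : cluster_spec H C.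

Lemma clusterP H K : K \in clusters H -> cluster_spec H K.
Proof.
rewrite 2!in_setU -orbA => /or3P[/imsetP[e eS ->]|KP|KC].
- exact: ClusterSingle.
- exact: ClusterPure.
- exact: ClusterChain.
Qed.

(** An outside edge adjacent to a pure double would complete it to a chain, and chains admit no
    hook. *)
Lemma cluster_closed H K x y : sparse H -> irreducible H -> K \in clusters H ->
  x \in H -> y \in K -> adj x y -> x \in K.
Proof.
move=> sp irr KH xH; case: (clusterP KH) => [e /singlesP[eH he]|d dP|C CH] yK xy.
- by move: yK xy; rewrite inE => /eqP->; rewrite adjC (negbTE (he _ xH)).
- have [dH dN] := puresP _ _ dP.
  have [f [dE yH fH yf _]] := dbl_mem sp dH yK.
  apply/negPn/negP => xd; have /negP : ~~ (d \subset [set x; y; f]); last apply.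
    apply: dN; apply: mem_chains => //.
      by apply: (dbl_adj sp dH) => //; rewrite dE !inE eqxx orbT.
    by apply: contra xd => /eqP->; rewrite dE !inE eqxx orbT.
  by rewrite dE; apply/subsetP => z; rewrite !inE => /orP[]->; rewrite ?orbT.
- exact: (@chain_closed H C x y).
Qed.

Lemma cluster_sub H K K' e : sparse H -> irreducible H -> K \in clusters H ->
  K' \in clusters H -> e \in K -> e \in K' -> K \subset K'.
Proof.
move=> sp irr KH KH' eK eK'.
have cl x y : x \in H -> y \in K' -> adj x y -> x \in K' by apply: (@cluster_closed H).
case: (clusterP KH) eK => [f _|d dP|C CH] eK.
- by move: eK; rewrite inE => /eqP <-; rewrite sub1set.
- have dH := pure_dbl dP.
  apply/subsetP => x xK; have [->//|xe] := eqVneq x e.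
  apply: (cl x e) => //; first exact: dbl_memH dH xK.
  exact: (dbl_adj sp dH).
have [a [b [c [[aH bH cH] ab bc ac E]]]] := chainsP CH.
have ba : adj b a by rewrite adjC.
have cb : adj c b by rewrite adjC.
have bK : b \in K'.
  move: eK; rewrite E !inE => /orP[/orP[]|] /eqP ee; rewrite -?ee //.
    by apply: (cl b e) => //; rewrite ee.
  by apply: (cl b e) => //; rewrite ee.
rewrite E; apply/subsetP => x; rewrite !inE => /orP[/orP[]|] /eqP-> //.
  exact: (cl a b).
exact: (cl c b).
Qed.

Lemma cluster_eq H K K' e : sparse H -> irreducible H -> K \in clusters H ->
  K' \in clusters H -> e \in K -> e \in K' -> K = K'.
Proof.
move=> sp irr h h' ek ek'; apply/eqP.
by rewrite eqEsubset !(@cluster_sub H _ _ e).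
Qed.

Lemma single_cluster H e : e \in singles H -> [set e] \in clusters H.
Proof. by move=> h; rewrite 2!in_setU imset_f. Qed.
Lemma pure_cluster H d : d \in pures H -> d \in clusters H.
Proof. by move=> h; rewrite 2!in_setU h orbT. Qed.
Lemma chain_cluster H d : d \in chains H -> d \in clusters H.
Proof. by move=> h; rewrite 2!in_setU h orbT. Qed.

Lemma card_chain_dbl H C d : sparse H -> C \in chains H -> d \in pures H -> C = d -> False.
Proof.
by move=> sp /(chain_card sp) c3 /pure_dbl/dbl_card c2 e; rewrite e c2 in c3.
Qed.

Lemma cluster_subH H K e : sparse H -> K \in clusters H -> e \in K -> e \in H.
Proof.
move=> sp /clusterP[f /singlesP[fH _]|d /pure_dbl dH|C CH].
- by rewrite inE => /eqP->.
- exact: dbl_memH.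
- by case/and3P: (chain_tight sp CH) => /subsetP s _ _; apply: s.
Qed.

Lemma edges_cover H : sparse H ->
  #|H| <= #|singles H| + 2 * #|pures H| + 3 * #|chains H|.
Proof.
move=> sp; have sub : H \subset singles H :|: cover (pures H) :|: cover (chains H).
  apply/subsetP => e eH; rewrite 2!in_setU.
  have [//|/singlesP es] /= := boolP (e \in singles H).
  have [/exists_inP[f fH ef]|/exists_inPn nf] := boolP [exists f in H, adj e f]; last first.
    by case: es; split.
  have dH := adj_dbl sp eH fH ef.
  have [/exists_inP[C CH sC]|nC] := boolP [exists C in chains H, [set e; f] \subset C].
    apply/orP; right; apply/bigcupP; exists C => //.
    by apply: (subsetP sC); rewrite !inE eqxx.
  apply/orP; left; apply/bigcupP; exists [set e; f]; last by rewrite !inE eqxx.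
  by rewrite inE dH.
apply: leq_trans (subset_leq_card sub) _.
have cU (V : finType) (P Q : {set V}) : #|P :|: Q| <= #|P| + #|Q|.
  by rewrite -cardsUI leq_addr.
have h1 : #|cover (pures H)| <= 2 * #|pures H|.
  apply: leq_trans (leq_card_cover _) _; rewrite mulnC -sum_nat_const.
  by apply: leq_sum => d /pure_dbl/dbl_card->.
have h2 : #|cover (chains H)| <= 3 * #|chains H|.
  apply: leq_trans (leq_card_cover _) _; rewrite mulnC -sum_nat_const.
  by apply: leq_sum => d /(chain_card sp)->.
apply: leq_trans (cU _ _ _) (leq_add _ h2).
exact: leq_trans (cU _ _ _) (leq_add _ h1).
Qed.

(** Edges sharing a pair are adjacent, hence in one cluster, so the clusters count disjoint sets of
    pairs. The first edge of a cluster has three, and each further one adds two at a new vertex. *)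
Lemma edge_pairs_count H : sparse H -> irreducible H ->
  3 * #|singles H| + 5 * #|pures H| + 7 * #|chains H| <= #|edge_pairs H|.
Proof.
move=> sp irr.
have := @sum_card_le _ _ (clusters H) edge_pairs (edge_pairs H).
have s1 K : K \in clusters H -> edge_pairs K \subset edge_pairs H.
  move=> KH; apply/subsetP => q /edge_pairsP[h [e eK qe]]; apply/edge_pairsP.
  by split=> //; exists e => //; apply: cluster_subH KH eK.
have s2 K K' q : K \in clusters H -> K' \in clusters H -> q \in edge_pairs K ->
    q \in edge_pairs K' -> K = K'.
  move=> KH KH' /edge_pairsP[h [e eK qe]] /edge_pairsP[_ [f fK qf]].
  apply: (@cluster_eq H K K' f) => //.
  have [<-//|fe] := eqVneq e f.
  apply: (@cluster_closed H K f e) => //; first exact: cluster_subH KH' fK.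
  by rewrite /adj eq_sym fe -h subset_leq_card // subsetI qf.
move=> /(_ s1 s2); apply: leq_trans.
have [c3 _ _] := sp.
have sz1 K : K \in [set [set e] | e in singles H] -> #|edge_pairs K| = 3.
  by move=> /imsetP[e /singlesP[eH _] ->]; rewrite card_edge_pairs1 ?c3.
have sz2 K : K \in pures H -> 5 <= #|edge_pairs K|.
  move=> /pure_dbl KD; have [e [f [E eH fH ef h]]] := dblP sp KD.
  have [v] : exists v, v \in e :\: f by apply/card_gt0P; rewrite cardsD h c3.
  rewrite inE => /andP[vf ve].
  have := @card_edge_pairs_add [set f] e v; rewrite cover1 card_edge_pairs1 ?c3 // -E.
  by apply.
have sz3 K : K \in chains H -> 7 <= #|edge_pairs K|.
  move=> /chainsP[a [b [c [[aH bH cH] ab bc ac ->]]]].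
  have [_ _ [v [vc va vb]]] := chain_apart sp aH bH cH ab bc ac.
  have dH := adj_dbl sp aH bH ab.
  have [v'] : exists v, v \in a :\: b by apply/card_gt0P; rewrite cardsD (adj_card sp aH bH ab) c3.
  rewrite inE => /andP[vb' va'].
  have := @card_edge_pairs_add [set b] a v'; rewrite cover1 card_edge_pairs1 ?c3 // => /(_ erefl va' vb').
  have := @card_edge_pairs_add [set a; b] c v; rewrite cover2 c3 // in_setU negb_or va vb.
  rewrite (_ : [set a; b; c] = c |: [set a; b]); last by rewrite setUC.
  by move=> /(_ erefl vc isT) h1 h2; apply: leq_trans h1; rewrite -(leq_add2r 2) in h2.
rewrite /clusters sum_disjU; last first.
  apply: disjoint_byF => K; rewrite in_setU => /orP[/imsetP[e _ E]|KP] KC.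
    by have := chain_card sp KC; rewrite E cards1.
  exact: (@card_chain_dbl H K K).
rewrite leq_add //; last first.
  by rewrite mulnC -sum_nat_const; apply: leq_sum => K /sz3.
rewrite sum_disjU; last first.
  by apply: disjoint_byF => K /imsetP[e _ E] /pure_dbl/dbl_card; rewrite E cards1.
rewrite leq_add //; last first.
  by rewrite mulnC -sum_nat_const; apply: leq_sum => K /sz2.
rewrite (eq_bigr (fun=> 3)) // sum_nat_const mulnC card_imset //.
by move=> e f /setP/(_ e); rewrite !inE eqxx => /esym/eqP.
Qed.

End Clusters.

(** * Single edges that contain the apex of a pure double *)

Section Hosts.
Variable T : finType.
Implicit Types (e f g h k x y : {set T}) (A B C H d : {set {set T}}) (q D : {set T}).

Definition chain_apexes H : {set {set T}} :=
  \bigcup_(C in chains H) [set apex d | d in [set d in dbl H | d \subset C]].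

(* Besides its own five pairs a pure double is charged to its apex, or, when the apex lies
   in a single edge [e], to the pairs in [link e d]. *)
Definition guests H e := [set d in pures H | apex d \subset e].

Definition link e d : {set {set T}} :=
  [set q : {set T} | [&& #|q| == 2, q \subset cover (e |: d), ~~ (q \subset e)
                       & ~~ (q \subset cover d)]].

Definition links H e : {set {set T}} := \bigcup_(d in guests H e) link e d.

(** An outside edge through the apex would be a hook on the chain; an edge of the chain has a
    neighbour, against [isolated_host]. *)
Lemma dbl_chain_nedge H C d x : sparse H -> irreducible H -> C \in chains H ->
  d \in dbl H -> d \subset C -> x \in H -> apex d \subset x -> False.
Proof.
move=> sp irr CH dH dC xH s.
have xd : x \notin d by apply/negP => xd; have := apex_nsub sp dH xd; rewrite s.
have [xC|xC] := boolP (x \in C); last first.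
  apply: (@chain_nohook _ H C x (apex d)) => //; last exact: apex_card dH.
  exact: subset_trans (apex_sub _) (coverS dC).
have [a [b [c [[aH bH cH] ab bc ac E]]]] := chainsP CH.
have [y yH xy] : exists2 y, y \in H & adj x y.
  move: xC; rewrite E !inE => /orP[/orP[]|]/eqP->; [by exists b| |]; last first.
    by exists b => //; rewrite adjC.
  by exists c.
exact: (isolated_host sp irr dH xH xd s yH xy).
Qed.

Lemma pure_or_chain H d : d \in dbl H -> d \in pures H \/ exists2 C, C \in chains H & d \subset C.
Proof.
move=> dH; have [/exists_inP|h] := boolP [exists C in chains H, d \subset C]; first by right.
by left; rewrite inE dH.
Qed.

Lemma guestsP H e d : sparse H -> irreducible H -> e \in singles H ->
  d \in guests H e ->
  [/\ d \in dbl H, apex d \subset e, e \notin d & e \in H].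
Proof.
move=> sp irr /singlesP[eH he]; rewrite in_set => /andP[/pure_dbl dH s]; split=> //.
by apply/negP => ed; have := apex_nsub sp dH ed; rewrite s.
Qed.

Lemma guest_of_apex H e d : sparse H -> irreducible H -> e \in singles H ->
  d \in dbl H -> apex d \subset e -> d \in guests H e.
Proof.
move=> sp irr /singlesP[eH _] dH s; rewrite in_set s andbT.
have [//|[C CH dC]] := pure_or_chain dH.
by case: (dbl_chain_nedge sp irr CH dH dC eH s).
Qed.

Lemma linkP e d q : q \in link e d ->
  exists t p, [/\ q = [set t; p], t != p, t \in e, t \notin cover d & (p \in cover d) && (p \notin e)].
Proof.
rewrite inE => /and4P[/eqP cq s /subsetPn[p pq pe] /subsetPn[t tq td]].
have in_U u : u \in q -> (u \in e) || (u \in cover d).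
  by move/(subsetP s); rewrite coverU1 inE.
have tp : t != p by apply: contra pe => /eqP<-; move: (in_U _ tq); rewrite (negbTE td) orbF.
exists t, p; split=> //.
- apply/eqP; rewrite eq_sym eqEcard cards2 tp cq andbT.
  by rewrite subset_set2 tq.
- by move: (in_U _ tq); rewrite (negbTE td) orbF.
- by rewrite pe andbT; move: (in_U _ pq); rewrite (negbTE pe).
Qed.

Lemma mem_link e d (t p : T) : t \in e -> t \notin cover d -> p \in cover d -> p \notin e ->
  [set t; p] \in link e d.
Proof.
move=> te td pd pe; rewrite inE !subset_set2 coverU1 !inE te pd orbT (negbTE td) (negbTE pe) /= ?andbF ?andbT.
by rewrite cards2 (_ : t != p) //; apply: contra pe => /eqP<-.
Qed.

Lemma link_top H e d : sparse H -> d \in dbl H -> e \in H -> e \notin d -> apex d \subset e ->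
  exists t, [/\ t \in e, t \notin cover d & e = t |: apex d].
Proof.
move=> sp dH eH ed s; have [t3 c3 c5 E] := host_tight sp dH eH ed s.
have [ce _ _] := sp; have c2 := apex_card sp dH.
have [t] : exists t, t \in e :\: cover d by apply/card_gt0P; rewrite cardsD E c2 ce.
rewrite inE => /andP[td te]; exists t; split=> //.
apply/eqP; rewrite eq_sym eqEcard subUset sub1set te s /=.
rewrite ce // cardsU1 c2; case: (t \in apex d) (subsetP (apex_sub d) t) => // /(_ isT) h.
by rewrite h in td.
Qed.

Lemma link_card H e d : sparse H -> d \in dbl H -> e \in H -> e \notin d -> apex d \subset e ->
  2 <= #|link e d|.
Proof.
move=> sp dH eH ed s; have [t3 c3 c5 E] := host_tight sp dH eH ed s.
have [t [te td eE]] := link_top sp dH eH ed s.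
have : #|cover d :\: e| = 2.
  by rewrite cardsD setIC E (apex_card sp dH) (dbl_cover sp dH).
have <- : #|[set [set t; p] | p in cover d :\: e]| = #|cover d :\: e|.
  apply: card_in_imset => p p'; rewrite !inE => /andP[pe _] _ /setP/(_ p).
  by rewrite !inE eqxx orbT => /esym/orP[/eqP pt|/eqP//]; rewrite pt te in pe.
move=> <-; apply: subset_leq_card; apply/subsetP => q /imsetP[p].
by rewrite inE => /andP[pe pd] ->; apply: mem_link.
Qed.

Lemma tri_pure H e d : sparse H -> irreducible H -> e \in singles H ->
  d \in guests H e -> [/\ tight H (e |: d), #|e |: d| = 3 & #|cover (e |: d)| = 5].
Proof.
move=> sp irr eS dG; have [dH s ed eH] := guestsP sp irr eS dG.
by have [] := host_tight sp dH eH ed s.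
Qed.

Lemma link_cover e d q : q \in link e d -> q \subset cover (e |: d).
Proof. by rewrite inE => /and4P[]. Qed.

Lemma link_size e d q : q \in link e d -> #|q| = 2.
Proof. by rewrite inE => /and4P[/eqP]. Qed.

Lemma single_notin_dbl H e d : sparse H -> e \in singles H -> d \in dbl H -> e \notin d.
Proof.
move=> sp /singlesP[eH he] dH; apply/negP => ed.
have [f [E _ fH ef _]] := dbl_mem sp dH ed.
have := he _ fH; rewrite (dbl_adj sp dH) //.
by rewrite E !inE eqxx orbT.
Qed.

Lemma pure_disjoint H d d' : sparse H -> irreducible H -> d \in pures H ->
  d' \in dbl H -> d != d' -> [disjoint d & d'].
Proof.
move=> sp irr dP d'H n; apply: disjoint_byF => e ed ed'.
have dK := pure_cluster dP.
suff /negP : ~~ (d' \subset d).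
  apply; apply/subsetP => x xd'; have [->//|xe] := eqVneq x e.
  apply: (cluster_closed sp irr dK _ ed); first exact: dbl_memH xd'.
  exact: (dbl_adj sp d'H).
apply: contra n => s; rewrite eq_sym eqEcard s.
by rewrite (dbl_card d'H) (dbl_card (pure_dbl dP)).
Qed.

Lemma link_light H e d q : sparse H -> irreducible H -> e \in singles H ->
  d \in guests H e -> q \in link e d -> q \in light H.
Proof.
move=> sp irr eS dG qL; have [t3 c3 _] := tri_pure sp irr eS dG.
by apply: (tight_pair_light t3); rewrite ?c3 ?(link_size qL) ?link_cover.
Qed.

Lemma guest_pure H e d : d \in guests H e -> d \in pures H.
Proof. by rewrite in_set => /andP[]. Qed.

Lemma tri_disjoint H e d A : sparse H -> e \notin A -> [disjoint d & A] -> [disjoint e |: d & A].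
Proof.
move=> sp eA dA; apply: disjoint_byF => x; rewrite !inE => /orP[/eqP->|xd] xA.
  by rewrite xA in eA.
by rewrite (disjointFr dA xd) in xA.
Qed.

(** Different hosts and doubles give disjoint tight triples, which cannot share a pair. With the
    same host, the cover of [d'] meets the other triple only in its apex, inside the host, while a
    link pair leaves the host. One apex in two single edges would make them adjacent. *)
Lemma link_inj H e e' d d' q : sparse H -> irreducible H -> e \in singles H ->
  e' \in singles H -> d \in guests H e -> d' \in guests H e' ->
  q \in link e d -> q \in link e' d' -> e = e' /\ d = d'.
Proof.
move=> sp irr eS eS' dG dG' qL qL'.
have [dH s ed eH] := guestsP sp irr eS dG.
have [dH' s' ed' eH'] := guestsP sp irr eS' dG'.
have [t3 c3 c5] := tri_pure sp irr eS dG.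
have [t3' c3' c5'] := tri_pure sp irr eS' dG'.
have ne : e' \notin d by apply: single_notin_dbl sp eS' dH.
have ne' : e \notin d' by apply: single_notin_dbl sp eS dH'.
have [dd|dd] := eqVneq d d'.
  split=> //; apply/eqP/negPn/negP => ee.
  have /singlesP[_ /(_ e' eH')] := eS; rewrite /adj ee /=.
  rewrite -(apex_card sp dH) subset_leq_card //.
  by rewrite subsetI s dd s'.
have j := pure_disjoint sp irr (guest_pure dG) dH' dd.
have [ee|ee] := eqVneq e e'; last first.
  exfalso; apply: (@tight_disjF _ H (e |: d) (e' |: d') q) => //.
  - apply: (tri_disjoint sp); first by rewrite in_setU1 negb_or ee.
    rewrite disjoint_sym; apply: (tri_disjoint sp) => //.
    by rewrite disjoint_sym.
  - exact: link_cover qL.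
  - exact: link_cover qL'.
  - by rewrite c3 c3'.
  - by rewrite c3 c3' (link_size qL).
subst e'.
have E : cover (e |: d) :&: cover d' = apex d'.
  apply: (tight_meet2 sp t3 (dbl_tight dH')).
  - exact: (tri_disjoint sp).
  - by rewrite c3 (dbl_card dH').
  - by rewrite coverU1 (subset_trans s') // subsetUl.
  - exact: apex_sub.
  - exact: (apex_card sp dH').
have [t [p [qE tp te td /andP[pd pe]]]] := linkP qL'.
have : p \in cover (e |: d) :&: cover d'.
  rewrite inE pd andbT; apply: (subsetP (link_cover qL)).
  by rewrite qE !inE eqxx orbT.
by rewrite E => /(subsetP s'); rewrite (negbTE pe).
Qed.

Lemma link_nchain H e d q : sparse H -> irreducible H -> e \in singles H ->
  d \in guests H e -> q \in link e d -> q \notin chain_apexes H.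
Proof.
move=> sp irr eS dG qL; apply/negP => /bigcupP[C CH /imsetP[d']].
rewrite in_set => /andP[dH' dC] qE.
have [dH s ed eH] := guestsP sp irr eS dG.
have [t3 c3 c5] := tri_pure sp irr eS dG.
have CK := chain_cluster CH.
apply: (@tight_disjF _ H (e |: d) C q) => //.
- exact: chain_tight.
- apply: (tri_disjoint sp).
    apply/negP => eC; have E := cluster_eq sp irr (single_cluster eS) CK (set11 e) eC.
    by have := chain_card sp CH; rewrite -E cards1.
  apply: disjoint_byF => x xd xC.
  exact: (card_chain_dbl sp CH (guest_pure dG) (cluster_eq sp irr CK (pure_cluster (guest_pure dG)) xC xd)).
- exact: link_cover qL.
- by rewrite qE (subset_trans (apex_sub _)) // coverS.
- by rewrite c3 (chain_card sp CH).
- by rewrite c3 (chain_card sp CH) (link_size qL).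
Qed.

Lemma cover_dbl_cases H d q : sparse H -> d \in dbl H -> #|q| = 2 -> q \subset cover d ->
  (exists2 x, x \in d & q \subset x) \/ q = apex d.
Proof.
move=> sp dH cq s; have [a [b [dE aH bH ab h]]] := dblP sp dH.
have [qa|/subsetPn[u uq ua]] := boolP (q \subset a).
  by left; exists a; rewrite // dE !inE eqxx.
have [qb|/subsetPn[v vq vb]] := boolP (q \subset b).
  by left; exists b; rewrite // dE !inE eqxx orbT.
right; apply/eqP; rewrite eqEcard cq (apex_card sp dH) leqnn andbT.
have inab w : w \in q -> (w \in a) || (w \in b).
  by move/(subsetP s); rewrite dE cover2 inE.
have qE : q = [set u; v].
  apply/eqP; rewrite eq_sym eqEcard cq cards2 subset_set2 uq vq /=.
  by case: eqP => // uv; move: (inab _ uq); rewrite (negbTE ua) uv (negbTE vb).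
rewrite dE apex2 {1}qE subset_set2 !inE inab // inab // (negbTE ua) (negbTE vb).
by rewrite andbF.
Qed.

(* A pair of the third vertex t of a single edge with another vertex of the
   tight triple {e} u d is light after deleting e only because of edges
   disjoint from that triple. *)
Lemma tri_light_del H e d (t w : T) : sparse H -> irreducible H -> e \in singles H ->
  d \in guests H e -> t \in e -> t \notin cover d -> w \in cover d ->
  [set t; w] \in light (H :\ e) ->
  (exists x, [/\ x \in H, x \notin e |: d & [set t; w] \subset x]) \/
  (exists d', [/\ d' \in dbl H, [disjoint d' & e |: d] & apex d' = [set t; w]]).
Proof.
move=> sp irr eS dG te td wd /lightP[cq [A [tA cA sA]]].
have [dH s ed eH] := guestsP sp irr eS dG.
have [t3 c3 c5] := tri_pure sp irr eS dG.
have eA : e \notin A.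
  by apply/negP => eA; case/and3P: tA => /subsetP/(_ _ eA); rewrite !inE eqxx.
have {}tA : tight H A by apply: tightS tA; apply: subD1set.
have tC : t \in cover (e |: d) by rewrite coverU1 inE te.
have wC : w \in cover (e |: d) by rewrite coverU1 inE wd orbT.
have sC : [set t; w] \subset cover (e |: d) by rewrite subset_set2 tC.
have [dj|n0] := eqVneq (A :&: (e |: d)) set0; last first.
  exfalso; apply: (overlapF sp tA t3 n0 _ tC).
  - by apply: (subsetP sA); rewrite !inE eqxx.
  - apply: contra td => /bigcupP[y]; rewrite !inE => /andP[yA /orP[/eqP ye|yd]] ty.
      by rewrite ye (negbTE eA) in yA.
    by apply/bigcupP; exists y.
  - by move: n0 cA; rewrite -card_gt0 c3; clear; lia.
have dj' : [disjoint A & e |: d] by rewrite -setI_eq0 dj.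
have [h1|h1] := eqVneq #|A| 1.
  move/eqP/cards1P: h1 => [x Ax]; rewrite Ax cover1 in sA.
  left; exists x; split=> //; first by case/and3P: tA; rewrite Ax sub1set.
  by move: dj'; rewrite Ax disjoints1.
have [h2|h2] := eqVneq #|A| 2.
  have AH : A \in dbl H by rewrite inE tA h2.
  have [[x xA sx]|E] := cover_dbl_cases sp AH cq sA.
    left; exists x; split=> //; first exact: dbl_memH xA.
    by rewrite (disjointFr dj').
  by right; exists A.
have h3 : #|A| = 3 by case/and3P: tA => _ + _; move: h1 h2 cA; clear; lia.
exfalso; apply: (@tight_disjF _ H A (e |: d) [set t; w]); rewrite ?h3 ?c3 ?cq //.
Qed.

(** Triple and hooks are five tight edges, and a neighbour of [x1] would be the sixth; a guest of
    [x1] would add two edges to the triple and [x1]. A guestless single keeps its whole surplus to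
    pay for others. *)
Lemma triple_single_hook H e d x1 x2 q1 q2 : sparse H -> irreducible H -> e \in singles H ->
  d \in guests H e -> q1 \in link e d -> q2 \in link e d -> q1 != q2 ->
  x1 \in H -> x2 \in H -> x1 \notin e |: d -> x2 \notin e |: d ->
  q1 \subset x1 -> q2 \subset x2 -> x1 \in singles H /\ guests H x1 = set0.
Proof.
move=> sp irr eS dG q1L q2L q12 x1H x2H x1N x2N s1 s2.
have [dH s ed eH] := guestsP sp irr eS dG.
have [t3 c3 c5] := tri_pure sp irr eS dG.
have c1 := link_size q1L; have c2 := link_size q2L.
have q1C := link_cover q1L; have q2C := link_cover q2L.
have E1 : x1 :&: cover (e |: d) = q1 by apply: (pair_exact sp t3); rewrite ?c3.
have E2 : x2 :&: cover (e |: d) = q2 by apply: (pair_exact sp t3); rewrite ?c3.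
have x12 : x1 != x2 by apply: contra q12 => /eqP xx; rewrite -E1 -E2 xx.
have t4 : tight H (x1 |: (e |: d)) by apply: (@tight_add _ H _ x1 q1); rewrite ?c1.
have c4 : #|x1 |: (e |: d)| = 4 by rewrite cardsU1 x1N c3.
have x2N4 : x2 \notin x1 |: (e |: d) by rewrite in_setU1 negb_or eq_sym x12.
have q2C4 : q2 \subset cover (x1 |: (e |: d)).
  by apply: subset_trans q2C (coverS (subsetUr _ _)).
have E2' : x2 :&: cover (x1 |: (e |: d)) = q2.
  by apply: (pair_exact sp t4); rewrite ?c4.
have t5 : tight H (x2 |: (x1 |: (e |: d))).
  by apply: (@tight_add _ H _ x2 q2); rewrite ?c2.
have c5' : #|x2 |: (x1 |: (e |: d))| = 5 by rewrite cardsU1 x2N4 c4.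
have [t [p [q1E tp te td /andP[pd pe]]]] := linkP q1L.
have x1S : x1 \in singles H.
  apply/singlesP; split=> // y yH; apply/negP => ay.
  have cI := adj_card sp x1H yH ay.
  have [yN|] := boolP (y \notin x2 |: (x1 |: (e |: d))).
    apply: (@tight_addF _ H _ y (x1 :&: y) sp t5 yH yN).
    - apply: subset_trans (subsetIl _ _) (sub_cover _).
      by rewrite !inE eqxx orbT.
    - exact: subsetIr.
    - by rewrite c5'.
    - by rewrite c5' cI.
  rewrite negbK in_setU1 => /orP[/eqP yx|]; last first.
    rewrite in_setU1 => /orP[/eqP yx|].
      by case/andP: ay; rewrite yx eqxx.
    rewrite in_setU1 => /orP[/eqP ye|yd].
      by have /singlesP[_ /(_ _ x1H)] := eS; rewrite -ye adjC ay.
    have : x1 :&: y \subset [set p].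
      apply/subsetP => z; rewrite in_setI => /andP[zx zy].
      have : z \in q1.
        rewrite -E1 in_setI zx; apply/bigcupP; exists y => //.
        by rewrite in_setU1 yd orbT.
      rewrite q1E !inE => /orP[/eqP zt|//].
      by case/negP: td; apply/bigcupP; exists y; rewrite // -zt.
    by move/subset_leq_card; rewrite cI cards1.
  have : x1 :&: y \subset q1 :&: q2.
    apply/subsetP => z /setIP[zx zy].
    have z2 : z \in q2.
      rewrite -E2' in_setI -yx zy; apply/bigcupP; exists x1 => //.
      by rewrite in_setU1 eqxx.
    by rewrite in_setI z2 andbT -E1 in_setI zx (subsetP q2C).
  move/subset_leq_card; rewrite cI => h.
  case/negP: q12; rewrite eqEcard c1 c2 andbT.
  have /eqP <- : q1 :&: q2 == q1 by rewrite eqEcard subsetIl c1.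
  exact: subsetIr.
split=> //; apply/setP => d'; rewrite [in RHS]inE; apply/negP => dG'.
have [dH' s' ed' _] := guestsP sp irr x1S dG'.
have [dd|dd] := eqVneq d d'.
  have : apex d = q1.
    apply/eqP; rewrite eqEcard c1 (apex_card sp dH) leqnn andbT -E1 subsetI dd s' /=.
    by rewrite coverU1 -dd (subset_trans s) // subsetUl.
  move=> E; case/negP: td; apply: (subsetP (apex_sub d)).
  by rewrite E q1E !inE eqxx.
have j := pure_disjoint sp irr (guest_pure dG) dH' dd.
apply: (@tight_disjF _ H (x1 |: (e |: d)) d' (apex d')) => //.
- exact: dbl_tight.
- apply: (tri_disjoint sp) => //; apply: (tri_disjoint sp) => //.
  exact: single_notin_dbl sp eS dH'.
- by apply: subset_trans s' (sub_cover _); rewrite !inE eqxx.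
- exact: apex_sub.
- by rewrite c4 (dbl_card dH').
- by rewrite c4 (dbl_card dH') (apex_card sp dH').
Qed.

End Hosts.

(** * Discharging *)

Section Discharging.
Variable T : finType.
Implicit Types (e f g h k x y : {set T}) (A B C H d : {set {set T}}) (q D : {set T}).

Lemma apex_le2 H (S : {set {set {set T}}}) q : sparse H -> S \subset dbl H ->
  (forall d, d \in S -> apex d = q) -> #|S| <= 2.
Proof.
move=> sp sS aS; rewrite leqNgt; apply/negP => /card_gt2P[d1 [d2 [d3 [[h1 h2 h3] [n12 n23 n31]]]]].
apply: (@three_apexF _ H d1 d2 d3 q); rewrite ?aS ?(subsetP sS) //.
by rewrite eq_sym.
Qed.

(** A host with two guests is a tight set of five edges; an edge containing a link pair would be the
    sixth. *)
Lemma many_guests H e d d' q : sparse H -> irreducible H -> e \in singles H ->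
  d \in guests H e -> d' \in guests H e -> d != d' -> q \in link e d ->
  q \notin edge_pairs H.
Proof.
move=> sp irr eS dG dG' dd qL; apply/negP => /edge_pairsP[cq [x xH qx]].
have [dH s ed eH] := guestsP sp irr eS dG.
have [dH' s' ed' _] := guestsP sp irr eS dG'.
have [t3 c3 c5] := tri_pure sp irr eS dG.
have j := pure_disjoint sp irr (guest_pure dG) dH' dd.
have j3 : [disjoint e |: d & d'] by apply: (tri_disjoint sp).
have s3 : apex d' \subset cover (e |: d) by rewrite coverU1 (subset_trans s') // subsetUl.
have c2' := apex_card sp dH'.
have t5 : tight H ((e |: d) :|: d').
  apply: (@tight_joinD _ H (e |: d) d' (apex d')) => //; first exact: dbl_tight.
  - exact: apex_sub.
  by rewrite c2'.
have cc5 : #|(e |: d) :|: d'| = 5 by rewrite card_disjU // c3 (dbl_card dH').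
have [t [p [qE tp te td /andP[pd pe]]]] := linkP qL.
have tq : t \in q by rewrite qE !inE eqxx.
have pq : p \in q by rewrite qE !inE eqxx orbT.
apply: (@tight_addF _ H _ x q sp t5 xH).
- rewrite !in_setU !negb_or -andbA; apply/and3P; split.
  + by rewrite inE; apply: contra pe => /eqP <-; apply: (subsetP qx).
  + by apply: contra td => xd; apply/bigcupP; exists x => //; apply: (subsetP qx).
  apply: contra pe => xd'.
  have E : cover (e |: d) :&: cover d' = apex d'.
    apply: (tight_meet2 sp t3 (dbl_tight dH')) => //; rewrite ?apex_sub //.
    by rewrite c3 (dbl_card dH').
  apply: (subsetP s'); rewrite -E inE (subsetP (link_cover qL)) //.
  by apply/bigcupP; exists x => //; apply: (subsetP qx).
- exact: subset_trans (link_cover qL) (coverS (subsetUl _ _)).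
- exact: qx.
- by rewrite cc5.
- by rewrite cc5 cq.
Qed.

Lemma guests_le6 H e : sparse H -> irreducible H -> e \in singles H -> #|guests H e| <= 6.
Proof.
move=> sp irr eS; have eH : e \in H by case/singlesP: eS.
have [ce _ _] := sp.
rewrite -sum1_card (partition_big (@apex T) (mem (edge_pairs [set e]))) /=; last first.
  move=> d dG; have [dH s _ _] := guestsP sp irr eS dG.
  by apply/edge_pairsP; split; [exact: apex_card dH|exists e; rewrite ?inE].
apply: (@leq_trans (\sum_(q in edge_pairs [set e]) 2)); last first.
  by rewrite sum_nat_const card_edge_pairs1 ?ce.
apply: leq_sum => q _; rewrite sum1_card.
rewrite -[X in X <= _]cardsE; apply: (@apex_le2 H _ q sp).
  by apply/subsetP => d; rewrite in_set => /andP[/(guestsP sp irr eS)[]].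
by move=> d; rewrite in_set => /andP[_ /eqP].
Qed.

(** A link pair stays light without [e]: otherwise it would form with the two pairs of [e] at [t] a
    star of three lost pairs. What keeps it light is an edge or a double; once one link lies in an
    edge, a double at the other is excluded by counting, so both links are hooked. *)
Lemma one_guest H e d : sparse H -> irreducible H -> e \in singles H ->
  guests H e = [set d] ->
  (forall q, q \in link e d -> q \notin edge_pairs H) \/
  (forall q, q \in link e d ->
     exists x, [/\ x \in singles H, q \subset x & guests H x = set0]).
Proof.
move=> sp irr eS Gd; have dG : d \in guests H e by rewrite Gd inE.
have [dH s ed eH] := guestsP sp irr eS dG.
have [t3 c3 c5] := tri_pure sp irr eS dG.
have [t [te td eE]] := link_top sp dH eH ed s.
have del p : p \in cover d -> p \notin e -> [set t; p] \in light (H :\ e).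
  move=> pd pe; apply/negPn/negP => nl.
  have tN : t \notin p |: apex d.
    rewrite in_setU1 negb_or; apply/andP; split; first by apply: contra pe => /eqP<-.
    by apply: contra td; apply: (subsetP (apex_sub d)).
  have Wd w : w \in p |: apex d -> w \in cover d.
    by rewrite in_setU1 => /orP[/eqP->//|]; apply: (subsetP (apex_sub d)).
  have tw w : w \in cover d -> t != w by move=> wd; apply: contra td => /eqP->.
  suff : #|p |: apex d| <= 2.
    rewrite cardsU1 (apex_card sp dH); case: (p \in apex d) (subsetP s p) => //.
    by move=> /(_ isT); rewrite (negbTE pe).
  apply: (@irred_star _ H e t _ irr eH tN) => w wW.
    apply: (tight_pair_light t3); rewrite ?c3 ?cards2 ?tw ?Wd // subset_set2 coverU1 !in_setU.
    by rewrite te (Wd w wW) ?orbT.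
  have [->//|wp] := eqVneq w p.
  have wa : w \in apex d by move: wW; rewrite in_setU1 (negbTE wp).
  have twe : [set t; w] \subset e by rewrite subset_set2 te (subsetP s).
  apply/negP => /(tri_light_del sp irr eS dG te td (Wd _ wW))[[x [xH xN sx]]|[d' [dH' j ad']]].
    have /singlesP[_ /(_ x xH)] := eS; rewrite /adj.
    have -> /= : e != x by apply: contra xN => /eqP<-; rewrite !inE eqxx.
    have <- : #|[set t; w]| = 2 by rewrite cards2 tw ?Wd.
    by rewrite subset_leq_card // subsetI twe.
  have : d' \in guests H e by apply: guest_of_apex => //; rewrite ad'.
  rewrite Gd inE => /eqP dd; move: j; rewrite dd => j.
  have /card_gt0P[x xd] : 0 < #|d| by rewrite (dbl_card dH).
  by have := disjointFr j xd; rewrite in_setU1 xd orbT.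
have linkE q : q \in link e d -> exists p, [/\ q = [set t; p], p \in cover d & p \notin e].
  move=> /linkP[t' [p [-> tp t'e t'd /andP[pd pe]]]]; exists p; split=> //.
  suff -> : t' = t by [].
  move: t'e; rewrite eE in_setU1 => /orP[/eqP//|/(subsetP (apex_sub d))].
  by rewrite (negbTE t'd).
have nin q x : q \in link e d -> q \subset x -> x \notin e |: d.
  rewrite inE => /and4P[_ _ qe qd] qx; rewrite in_setU1 negb_or; apply/andP; split.
    by apply: contra qe => /eqP<-.
  by apply: contra qd => xd; apply: subset_trans qx (sub_cover xd).
have [/exists_inP[q1 q1L /edge_pairsP[cq1 [x1 x1H s1]]]|/exists_inPn no] :=
  boolP [exists q in link e d, q \in edge_pairs H]; last by left.
right.
have x1N := nin _ _ q1L s1.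
have t4 : tight H (x1 |: (e |: d)).
  by apply: (@tight_add _ H _ x1 q1); rewrite ?cq1 ?link_cover.
have c4 : #|x1 |: (e |: d)| = 4 by rewrite cardsU1 x1N c3.
have hook q2 : q2 \in link e d -> q1 != q2 -> exists x, x \in H /\ q2 \subset x.
  move=> q2L q12; have [p [q2E pd pe]] := linkE _ q2L.
  have := del _ pd pe; rewrite -q2E => ql; have cq2 := link_size q2L.
  have := tri_light_del sp irr eS dG te td pd; rewrite -q2E => /(_ ql).
  case=> [[x [xH xN sx]]|[d' [dH' j ad']]]; first by exists x.
  exfalso; have [x1d|x1d] := boolP (x1 \in d').
    apply: (@tight_disjF _ H d' (e |: d) (q1 :|: q2)) => //.
    - exact: dbl_tight.
    - by rewrite subUset (subset_trans s1 (sub_cover x1d)) -ad' apex_sub.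
    - by rewrite subUset !link_cover.
    - by rewrite c3 (dbl_card dH').
    - rewrite c3 (dbl_card dH') addn0 ltnNge; apply: contra q12 => le2.
      have e1 : q1 :|: q2 = q1 by apply: two_in_set; rewrite ?subsetUl // -cq1 subset_leq_card // subsetUl.
      have e2 : q1 :|: q2 = q2 by apply: two_in_set; rewrite ?subsetUr // -cq2 subset_leq_card // subsetUr.
      by rewrite -e1 {1}e2.
  apply: (@tight_disjF _ H (x1 |: (e |: d)) d' q2) => //.
  - exact: dbl_tight.
  - by apply: (tri_disjoint sp) => //; rewrite disjoint_sym.
  - by apply: subset_trans (link_cover q2L) (coverS (subsetUr _ _)).
  - by rewrite -ad' apex_sub.
  - by rewrite c4 (dbl_card dH').
  - by rewrite c4 (dbl_card dH') cq2.
move=> q qL; have [->|qq] := eqVneq q q1; last first.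
  have [|x [xH sx]] := hook q qL; first by rewrite eq_sym.
  have [] := triple_single_hook sp irr eS dG qL q1L qq xH x1H (nin _ _ qL sx) x1N sx s1.
  by exists x.
have [q2 q2L q12] : exists2 q2, q2 \in link e d & q1 != q2.
  have /card_gt1P[a [b [aL bL ab]]] := link_card sp dH eH ed s.
  have [qa|qa] := eqVneq q1 a; last by exists a.
  by exists b; rewrite // qa.
have [x [xH sx]] := hook q2 q2L q12.
have [] := triple_single_hook sp irr eS dG q1L q2L q12 x1H xH x1N (nin _ _ q2L sx) s1 sx.
by exists x1.
Qed.

Definition free_links H := (\bigcup_(e in singles H) links H e) :\: edge_pairs H.

Lemma links_ge H e : sparse H -> irreducible H -> e \in singles H ->
  2 * #|guests H e| <= #|links H e|.
Proof.
move=> sp irr eS; apply: leq_trans (_ : \sum_(d in guests H e) #|link e d| <= _).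
  rewrite mulnC -sum_nat_const; apply: leq_sum => d dG.
  by have [dH s ed eH] := guestsP sp irr eS dG; apply: link_card dH eH ed s.
apply: sum_card_le => [d dG|d d' q dG dG' qL qL']; first exact: bigcup_sup.
by case: (link_inj sp irr eS eS dG dG' qL qL').
Qed.

(** A guest needs 25; its host gives 18 and every free link 11. With g >= 2 guests there are at
    least 2 g free links, and 25 g <= 18 + 22 g amounts to g <= 6. A host of one guest without two
    free links owes 7, paid by the guestless singles containing its links. *)
Lemma guests_bound H : sparse H -> irreducible H ->
  25 * \sum_(e in singles H) #|guests H e| <= 18 * #|singles H| + 11 * #|free_links H|.
Proof.
move=> sp irr; set S := singles H.
pose x e := #|links H e :\: edge_pairs H|.
have hx : \sum_(e in S) x e <= #|free_links H|.
  apply: sum_card_le => [e eS|e e' q eS eS'].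
    by apply: setSD; apply: bigcup_sup.
  rewrite !in_setD => /andP[_ /bigcupP[d dG qL]] /andP[_ /bigcupP[d' dG' qL']].
  by case: (link_inj sp irr eS eS' dG dG' qL qL').
pose bad := [set e in S | (#|guests H e| == 1) && (x e < 2)].
pose S0 := [set e in S | #|guests H e| == 0].
have badP e : e \in bad -> forall q, q \in links H e ->
    exists f, [/\ f \in S0, q \subset f & #|q| = 2].
  rewrite inE => /and3P[eS /cards1P[d Gd] xe] q qL.
  have lE : links H e = link e d by rewrite /links Gd big_set1.
  have [no|yes] := one_guest sp irr eS Gd.
    have := links_ge sp irr eS; rewrite Gd cards1 => h.
    move: xe; rewrite /x (_ : _ :\: _ = links H e); first by rewrite ltnNge h.
    by apply/setDidPl/disjoint_byF => q' q'L; apply/negP; apply: no; rewrite -lE.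
  rewrite lE in qL; have [f [fS qf Gf]] := yes _ qL.
  by exists f; rewrite (link_size qL) inE fS Gf cards0.
(* A bad host has two links at least, a guestless single only three pairs; hence 7 for each bad host
   is covered by 18 for each element of [S0]. *)
have hbad : 2 * #|bad| <= 3 * #|S0|.
  apply: (@leq_trans (\sum_(e in bad) #|links H e|)).
    rewrite mulnC -sum_nat_const; apply: leq_sum => e.
    rewrite inE => /and3P[eS /eqP g1 _].
    by have := links_ge sp irr eS; rewrite g1.
  apply: (@leq_trans #|\bigcup_(f in S0) edge_pairs [set f]|).
    apply: sum_card_le => [e eB|e e' q].
      apply/subsetP => q /(badP e eB)[f [fS qf cq]]; apply/bigcupP; exists f => //.
      by apply/edge_pairsP; split=> //; exists f; rewrite ?inE.
    rewrite [e \in _]in_set [e' \in _]in_set => /and3P[eS _ _] /and3P[eS' _ _] /bigcupP[d dG qL] /bigcupP[d' dG' qL'].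
    by case: (link_inj sp irr eS eS' dG dG' qL qL').
  rewrite mulnC -sum_nat_const; apply: (@leq_trans (\sum_(f in S0) #|edge_pairs [set f]|)).
    elim/big_rec2: _ => [|f A n fS le]; first by rewrite cards0.
    apply: leq_trans (leq_add (leqnn _) le); rewrite -cardsUI; exact: leq_addr.
  apply: leq_sum => f; rewrite inE => /andP[/singlesP[fH _] _].
  by rewrite card_edge_pairs1 //; case: sp => ->.
have per e : e \in S -> 25 * #|guests H e| + 18 * (e \in S0) <= 18 + 11 * x e + 7 * (e \in bad).
  move=> eS.
  have -> : (e \in S0) = (#|guests H e| == 0) by rewrite in_set eS.
  have -> : (e \in bad) = (#|guests H e| == 1) && (x e < 2) by rewrite in_set eS.
  have [g0|g0] := eqVneq #|guests H e| 0; first by rewrite g0 /=; clear; lia.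
  have [g1|g1] := eqVneq #|guests H e| 1.
    by rewrite g1 /=; case: (ltnP (x e) 2) => h /=; move: h; clear; lia.
  have g6 := guests_le6 sp irr eS.
  suff : 2 * #|guests H e| <= x e by move: g0 g1 g6; clear; lia.
  apply: leq_trans (links_ge sp irr eS) _; apply: subset_leq_card.
  apply/subsetP => q qL; rewrite in_setD qL andbT.
  have /bigcupP[d dG qd] := qL.
  have [d' dG' dd] : exists2 d', d' \in guests H e & d != d'.
    have /card_gt1P[a [b [aL bL ab]]] : 1 < #|guests H e| by move: g0 g1; clear; lia.
    have [da|da] := eqVneq d a; last by exists a.
    by exists b; rewrite // da.
  exact: many_guests sp irr eS dG dG' dd qd.
have : \sum_(e in S) (25 * #|guests H e| + 18 * (e \in S0)) <=
  \sum_(e in S) (18 + 11 * x e + 7 * (e \in bad)) by apply: leq_sum.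
have D m (F : {set T} -> nat) : \sum_(e in S) m * F e = m * \sum_(e in S) F e.
  by rewrite big_distrr.
rewrite big_split /= !D big_split /= D big_split /= D.
have mem_sum (R : {set {set T}}) : R \subset S -> \sum_(e in S) (e \in R)%N = #|R|.
  move=> RS; rewrite -sum1_card [RHS]big_mkcond [LHS]big_mkcond; apply: eq_bigr => e _.
  by case: (boolP (e \in R)) => [/(subsetP RS)->|_] //; case: ifP.
have sS0 : S0 \subset S by apply/subsetP => e; rewrite inE => /andP[].
have sbad : bad \subset S by apply/subsetP => e; rewrite inE => /andP[].
have -> : \sum_(e in S) 18 = #|S| * 18 by rewrite sum_nat_const.
rewrite !mem_sum //; move: hx hbad; set a := \sum_(e in S) x e; set b := \sum_(e in S) _.
by move: #|S0| #|bad| #|S| #|free_links H| a b; clear; lia.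
Qed.

Lemma edge_pairs_light H : sparse H -> edge_pairs H \subset light H.
Proof.
move=> sp; apply/subsetP => q /edge_pairsP[cq [e eH qe]].
by apply: (tight_pair_light (tight1 sp eH)); rewrite ?cards1 ?cover1.
Qed.

(** Two doubles of a chain share the middle edge, so their apexes differ; different chains are
    disjoint tight triples and cannot cover a common apex. *)
Lemma chain_apexes_card H : sparse H -> irreducible H ->
  2 * #|chains H| <= #|chain_apexes H|.
Proof.
move=> sp irr; apply: leq_trans (_ : \sum_(C in chains H)
   #|[set apex d | d in [set d in dbl H | d \subset C]]| <= _).
  rewrite mulnC -sum_nat_const; apply: leq_sum => C CH.
  have [a [b [c [[aH bH cH] ab bc ac E]]]] := chainsP CH.
  apply/card_gt1P; exists (apex [set a; b]), (apex [set b; c]); split.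
  - apply: imset_f; rewrite inE adj_dbl //= E; apply/subsetP => x; rewrite !inE.
    by move=> /orP[]->; rewrite ?orbT.
  - apply: imset_f; rewrite inE adj_dbl //= E; apply/subsetP => x; rewrite !inE.
    by move=> /orP[]->; rewrite ?orbT.
  apply/negP => /eqP ee.
  have n : [set a; b] != [set b; c].
    apply/negP => /eqP/setP/(_ a); rewrite !inE eqxx /= (negbTE ac) orbF => /esym/eqP ab'.
    by case/andP: ab; rewrite ab' eqxx.
  have := dbl_share_apex sp (adj_dbl sp aH bH ab) (adj_dbl sp bH cH bc) n ee.
  have bb : b \in [set a; b] by rewrite !inE eqxx orbT.
  by move=> j; have := disjointFr j bb; rewrite !inE eqxx.
apply: sum_card_le => [C CH|C C' q CH CH' /imsetP[d] + -> /imsetP[d']].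
  exact: (bigcup_sup C).
rewrite [d \in _]in_set [d' \in _]in_set => /andP[dH dC] /andP[dH' dC'] ee.
apply/eqP/negPn/negP => CC.
apply: (@tight_disjF _ H C C' (apex d)) => //.
- exact: chain_tight.
- exact: chain_tight.
- apply: disjoint_byF => x xC xC'; case/negP: CC; apply/eqP.
  exact: cluster_eq sp irr (chain_cluster CH) (chain_cluster CH') xC xC'.
- exact: subset_trans (apex_sub _) (coverS dC).
- by rewrite ee; exact: subset_trans (apex_sub _) (coverS dC').
- by rewrite !(chain_card sp).
- by rewrite !(chain_card sp) // (apex_card sp dH).
Qed.

(** An edge costs 165 and a light pair pays 61. After its own pairs a single has a surplus of 183 -
    165 = 18, a pure double lacks 330 - 305 = 25 and a chain 495 - 427 = 68 <= 2 * 36. A light pair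
    in no edge can pay for two pure apexes and a link, 50 + 11, or for one pure apex and a chain
    apex, 25 + 36. *)
Lemma irreducible_bound H : sparse H -> irreducible H -> 165 * #|H| <= 61 * #|light H|.
Proof.
move=> sp irr.
have h1 := edges_cover sp; have h2 := edge_pairs_count sp irr.
have h3 := guests_bound sp irr; have h4 := chain_apexes_card sp irr.
set EP := edge_pairs H in h2; set X := free_links H in h3; set CA := chain_apexes H in h4.
set S := singles H in h1 h2 h3; set P := pures H in h1 h2; set C := chains H in h1 h2 h4.
set K := \sum_(e in S) _ in h3.
pose N := light H :\: EP.
have hN : #|light H| = #|EP| + #|N|.
  by rewrite -(cardsID EP (light H)) (setIidPr (edge_pairs_light sp)).
pose t q := #|[set d in P | apex d == q]|.
pose PA := [set d in P | apex d \notin EP].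
have sCA : CA \subset N.
  apply/subsetP => q /bigcupP[C0 CH /imsetP[d]]; rewrite in_set => /andP[dH dC] ->.
  rewrite in_setD apex_light // andbT; apply/negP => /edge_pairsP[_ [x xH sx]].
  exact: dbl_chain_nedge sp irr CH dH dC xH sx.
have sX : X \subset N.
  apply/subsetP => q; rewrite !in_setD => /andP[-> /bigcupP[e eS /bigcupP[d dG qL]]] /=.
  exact: link_light sp irr eS dG qL.
have hP : #|P| <= #|PA| + K.
  rewrite -(cardsID PA P) (_ : P :&: PA = PA); last first.
    by apply/setIidPr/subsetP => d; rewrite inE => /andP[].
  rewrite leq_add2l; apply: (@leq_trans #|\bigcup_(e in S) guests H e|).
    apply: subset_leq_card; apply/subsetP => d; rewrite in_setD [d \in PA]in_set => /andP[+ dP].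
    rewrite dP negbK => /edge_pairsP[_ [g gH sg]].
    have dH := pure_dbl dP.
    have gd : g \notin d by apply/negP => gd; have := apex_nsub sp dH gd; rewrite sg.
    apply/bigcupP; exists g; last by rewrite inE dP.
    apply/singlesP; split=> // f fH; apply/negP => gf.
    exact: isolated_host sp irr dH gH gd sg fH gf.
  rewrite /K; elim/big_rec2: _ => [|e A n eS le]; first by rewrite cards0.
  by apply: leq_trans (leq_add (leqnn _) le); rewrite -cardsUI; exact: leq_addr.
have hPA : #|PA| <= \sum_(q in N) t q.
  rewrite -sum1_card (partition_big (@apex T) (mem N)) /=; last first.
    move=> d; rewrite [d \in _]in_set => /andP[dP ne].
    by rewrite in_setD ne apex_light // pure_dbl.
  apply: leq_sum => q _; rewrite sum1_card -[X in X <= _]cardsE subset_leq_card //.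
  apply/subsetP => d; rewrite [d \in _]in_set => /andP[dA aq].
  by rewrite in_set aq andbT; move: dA; rewrite [d \in _]in_set => /andP[].
have per q : q \in N -> 25 * t q + 36 * (q \in CA) + 11 * (q \in X) <= 61.
  move=> qN; have sub (R : {set {set {set T}}}) : R \subset P -> R \subset dbl H.
    by move=> sR; apply: subset_trans sR _; apply/subsetP => d; exact: pure_dbl.
  have t2 : t q <= 2.
    apply: (@apex_le2 H _ q sp); last by move=> d; rewrite inE => /andP[_ /eqP].
    by apply: sub; apply/subsetP => d; rewrite inE => /andP[].
  have [qC|qC] := boolP (q \in CA); last by move: t2; case: (q \in X); clear; lia.
  have -> : q \in X = false.
    apply/negP; rewrite in_setD => /andP[_ /bigcupP[e eS /bigcupP[d dG qL]]].
    by have := link_nchain sp irr eS dG qL; rewrite qC.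
  suff : t q <= 1 by clear; lia.
  move: qC => /bigcupP[C0 CH /imsetP[d]]; rewrite in_set => /andP[dH dC] qE.
  have dP : d \notin P.
    apply/negP => /puresP[_ /(_ _ CH)]; by rewrite dC.
  have : #|d |: [set d in P | apex d == q]| <= 2.
    apply: (@apex_le2 H _ q sp).
      rewrite subUset sub1set dH /=; apply: sub; apply/subsetP => d'.
      by rewrite inE => /andP[].
    by move=> d'; rewrite !inE => /orP[/eqP->//|/andP[_ /eqP]].
  by rewrite cardsU1 inE (negbTE dP) /=.
have : \sum_(q in N) (25 * t q + 36 * (q \in CA) + 11 * (q \in X)) <= \sum_(q in N) 61.
  by apply: leq_sum.
have D m (F : {set T} -> nat) : \sum_(e in N) m * F e = m * \sum_(e in N) F e.
  by rewrite big_distrr.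
have -> : \sum_(q in N) 61 = #|N| * 61 by rewrite sum_nat_const.
rewrite big_split /= D big_split /= !D.
have mem_sum (R : {set {set T}}) : R \subset N -> \sum_(e in N) (e \in R)%N = #|R|.
  move=> RS; rewrite -sum1_card [RHS]big_mkcond [LHS]big_mkcond; apply: eq_bigr => e _.
  by case: (boolP (e \in R)) => [/(subsetP RS)->|_] //; case: ifP.
rewrite !mem_sum // => h5.
move: h1 h2 h3 h4 hN hP hPA h5; set a := \sum_(e in N) t e.
move: #|H| #|S| #|P| #|C| #|EP| K #|X| #|CA| #|N| #|light H| #|PA| a; clear.
by move=> *; lia.
Qed.

Lemma sparse_bound H : sparse H -> 165 * #|H| <= 61 * #|light H|.
Proof.
have [n] := ubnP #|H|; elim: n H => // n IHn H ltn sp.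
have del (E : {set {set T}}) (k : nat) : E \subset H -> 165 * #|E| <= 61 * k -> 0 < #|E| ->
    k <= #|light H :\: light (H :\: E)| -> 165 * #|H| <= 61 * #|light H|.
  move=> sE hE E0 lost.
  have cH : #|H :\: E| + #|E| = #|H| by rewrite -(cardsID E H) (setIidPr sE) addnC.
  have sL : light (H :\: E) \subset light H by apply: lightS; apply: subsetDl.
  have cL := cardsID (light (H :\: E)) (light H); rewrite (setIidPr sL) in cL.
  have := IHn (H :\: E); have := sparseS sp (subsetDl H E).
  move=> sp' /(_ _ sp'); move: cH cL hE E0 lost ltn; clear.
  by move=> h1 h2 h3 h4 h5 h6 h7; have {}h7 : 165 * #|H :\: E| <= 61 * #|light (H :\: E)|;
    [apply: h7; lia|lia].
have [/exists_inP[e eH h]|/exists_inPn h1] :=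
  boolP [exists e in H, 2 < #|light H :\: light (H :\ e)|].
  by apply: (del [set e] 3) => //; rewrite ?sub1set ?cards1.
have [/exists_inP[e eH /exists_inP[f fH /andP[ef h]]]|h2] :=
  boolP [exists e in H, [exists f in H, (e != f) && (5 < #|light H :\: light (H :\: [set e; f])|)]].
  by apply: (del [set e; f] 6) => //; rewrite ?subset_set2 ?eH ?cards2 ?ef.
apply: irreducible_bound => //; split=> [e eH|e f eH fH ef].
  by rewrite leqNgt; apply: h1.
rewrite leqNgt; apply: contra h2 => h; apply/exists_inP; exists e => //.
by apply/exists_inP; exists f => //; rewrite ef.
Qed.

End Discharging.

(** * The upper bound *)

Section Sparsification.
Variable T : finType.
Implicit Types (e f g : {set T}) (A B H R : {set {set T}}).

(** After the edges of one set [A] with [P] are removed, the remaining such sets have covers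
    disjoint from that of [A]. Each round thus uses up a vertex and costs [k] edges. *)
Lemma hitting_edges (P : pred {set {set T}}) (k : nat) H :
  (forall A, P A -> #|A| = k /\ cover A != set0) ->
  (forall A B, A \subset H -> B \subset H -> P A -> P B ->
     [disjoint A & B] -> [disjoint cover A & cover B]) ->
  exists R, [/\ R \subset H, #|R| <= k * #|T| & forall A, A \subset H :\: R -> ~~ P A].
Proof.
move=> hk; pose U H := \bigcup_(A : {set {set T}} | (A \subset H) && P A) cover A.
suff main : (forall A B, A \subset H -> B \subset H -> P A -> P B ->
     [disjoint A & B] -> [disjoint cover A & cover B]) ->
  exists R, [/\ R \subset H, #|R| <= k * #|U H| & forall A, A \subset H :\: R -> ~~ P A].
  move=> /main[R [sR cR hR]]; exists R; split=> //.
  by apply: leq_trans cR _; rewrite leq_mul2l max_card orbT.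
have [n] := ubnP #|H|; elim: n H => // n IHn H ltn dis.
have [/existsP[A /andP[sA PA]]|/existsPn no] := boolP [exists A : {set {set T}}, (A \subset H) && P A]; last first.
  exists set0; rewrite sub0set cards0; split=> // A; rewrite setD0 => sA.
  by have := no A; rewrite sA.
have [kA /set0Pn[v vA]] := hk A PA.
have A0 : A != set0.
  by apply: contraL vA => /eqP->; rewrite /cover big_set0 inE.
have cH : #|H :\: A| + #|A| = #|H| by rewrite -(cardsID A H) (setIidPr sA) addnC.
have sD := subsetDl H A.
have [||R [sR cR hR]] := IHn (H :\: A).
- by move: A0 cH ltn; rewrite -card_gt0; clear; lia.
- by move=> B C sB sC; apply: dis; apply: subset_trans sD.
exists (A :|: R); split=> [||B].
- by rewrite subUset sA (subset_trans sR).
- apply: leq_trans (_ : #|A| + #|R| <= _); first by rewrite -cardsUI leq_addr.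
  have : #|v |: U (H :\: A)| <= #|U H|.
    apply: subset_leq_card; rewrite subUset sub1set; apply/andP; split.
      by apply/bigcupP; exists A; rewrite // sA.
    apply/bigcupsP => B /andP[sB PB]; apply: (bigcup_sup B).
    by rewrite PB (subset_trans sB).
  rewrite cardsU1 (_ : v \notin U _); last first.
    apply/negP => /bigcupP[B /andP[sB PB] vB].
    have d : [disjoint A & B].
      by rewrite disjoint_sym; move: sB; rewrite subsetD => /andP[].
    by have := disjointFr (dis A B sA (subset_trans sB sD) PA PB d) vA; rewrite vB.
  rewrite kA => h; apply: leq_trans (_ : k * (1 + #|U (H :\: A)|) <= _).
    by rewrite mulnDr muln1 leq_add2l.
  by rewrite leq_mul2l h orbT.
by rewrite -setDDl; apply: hR.
Qed.

Lemma disjoint_covers A B :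
  (forall v, v \in cover A -> v \in cover B -> False) -> [disjoint cover A & cover B].
Proof.
move=> h; rewrite -setI_eq0; apply/eqP/setP => v; rewrite !inE; apply/negP => /andP[].
exact: h.
Qed.

(* The complements in [W := cover B :\ v] of the edges of [B] cannot be pairwise
   disjoint: they are nonempty, and that of an edge through [v] has two elements. *)
Lemma two_edges_at B v : (forall e, e \in B -> #|e| = 3) -> #|B| = 4 ->
  #|cover B| <= 5 -> v \in cover B ->
  exists e f, [/\ e \in B, f \in B, e != f & #|(e :|: f) :\ v| <= 3].
Proof.
move=> B3 B4 c5 vB; set W := cover B :\ v.
have [|/exists_inPn no] := boolP [exists e in B, [exists f in B, (e != f) && (#|(e :|: f) :\ v| <= 3)]].
  by move=> /exists_inP[e eB /exists_inP[f fB /andP[ef h]]]; exists e, f.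
exfalso; have cW : #|W| <= 4 by move: c5; rewrite (cardsD1 v (cover B)) vB.
have sW e : e \in B -> e :\ v \subset W by move=> eB; apply: setSD; apply: sub_cover.
have cE e : e \in B -> #|W :\: e| = #|W| - #|e :\ v|.
  move=> eB; rewrite -(cardsID (e :\ v) W) (setIidPr (sW _ eB)) addKn; apply: eq_card => x.
  by rewrite !inE; case: (x == v); rewrite ?andbF.
have : \sum_(e in B) #|W :\: e| <= #|W|.
  apply: sum_card_le => [e _|e f x eB fB]; first exact: subsetDl.
  move=> /setDP[xW xe] /setDP[_ xf]; apply/eqP/negPn/negP => ef.
  have /exists_inPn/(_ f fB) := no e eB; rewrite ef /= -ltnNge => h4.
  have : (e :|: f) :\ v \subset W :\ x.
    rewrite subsetD1 setDUl subUset !sW //= !inE negb_or !negb_and.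
    by rewrite (negbTE xe) (negbTE xf) !orbT.
  by move=> /subset_leq_card; move: h4 cW; rewrite (cardsD1 x W) xW; clear; lia.
have /bigcupP[e eB ve] := vB.
have c3 f : f \in B -> #|f :\ v| + (v \in f) = 3 by move=> fB; rewrite -(B3 f fB) (cardsD1 v f) addnC.
have W4 : #|W| = 4.
  have [f fB fe] : exists2 f, f \in B & e != f.
    have /card_gt1P[a [b [aB bB ab]]] : 1 < #|B| by rewrite B4.
    by have [ea|ea] := eqVneq e a; [exists b; rewrite // ea|exists a].
  have /exists_inPn/(_ f fB) := no e eB; rewrite fe /= -ltnNge => h4.
  apply/eqP; rewrite eqn_leq cW (leq_trans h4) // subset_leq_card //.
  by rewrite setDUl subUset !sW.
rewrite (bigD1 e) //= cE // W4.
have : \sum_(i in B | i != e) 1 <= \sum_(i in B | i != e) #|W :\: i|.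
  by apply: leq_sum => f /andP[fB _]; rewrite cE // W4; have := c3 f fB; clear; lia.
have -> : \sum_(i in B | i != e) 1 = 3.
  have := B4; rewrite (cardsD1 e B) eB => -[<-]; rewrite sum1_card -[LHS]cardsE.
  by apply: eq_card => x; rewrite !inE andbC.
have := c3 e eB; rewrite ve; move: #|_ :\ v| (\sum_(i in B | _) _) => a b; clear; lia.
Qed.

(** [P k] means k edges on at most k + 1 vertices. Two edge-disjoint such sets whose covers meet
    give six edges on 8 vertices: 4 + 4 for k = 3, even with disjoint covers; 5 + 3 for k = 4, using
    two edges of the other set; 6 + 2 for k = 5, using one. Deletion costs 3 + 4 + 5 = 12 edges per
    vertex. *)
Lemma sparsify H : (forall e, e \in H -> #|e| = 3) ->
  (forall A, A \subset H -> #|A| = 6 -> 9 <= #|cover A|) ->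
  exists H', [/\ H' \subset H, sparse H' & #|H| <= #|H'| + 12 * #|T|].
Proof.
move=> H3 H6; pose P k A := [&& #|A| == k, cover A != set0 & #|cover A| <= k.+1].
have hk k A : P k A -> #|A| = k /\ cover A != set0 by case/and3P=> /eqP.
have big A B : A \subset H -> B \subset H -> [disjoint A & B] -> #|A| + #|B| = 6 ->
    #|cover A :|: cover B| <= 8 -> False.
  move=> sA sB d c6 c8; have := H6 (A :|: B); rewrite subUset sA sB card_disjU // coverU.
  by move=> /(_ isT c6); rewrite ltnNge c8.
have [R3 [s3 c3 n3]] : exists R, [/\ R \subset H, #|R| <= 3 * #|T| & forall A, A \subset H :\: R -> ~~ P 3 A].
  apply: hitting_edges (hk 3) _ => A B sA sB /and3P[/eqP a3 _ cA] /and3P[/eqP b3 _ cB] d.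
  exfalso; apply: (big A B) => //; rewrite ?a3 ?b3 // cardsU.
  by move: cA cB; clear; lia.
have [R5 [s5 c5 n5]] : exists R, [/\ R \subset H, #|R| <= 5 * #|T| & forall A, A \subset H :\: R -> ~~ P 5 A].
  apply: hitting_edges (hk 5) _ => A B sA sB /and3P[/eqP a5 _ cA] /and3P[/eqP b5 _ cB] d.
  apply: disjoint_covers => v vA /bigcupP[e eB ve].
  apply: (big A [set e]) => //.
  - by rewrite sub1set (subsetP sB).
  - by rewrite disjoint_sym disjoints1; have := disjointFl d eB => ->.
  - by rewrite a5 cards1.
  rewrite cover1 cardsU (H3 e) ?(subsetP sB) //.
  have : 0 < #|cover A :&: e| by apply/card_gt0P; exists v; rewrite inE vA.
  by move: cA; clear; lia.
have [R4 [s4 c4 n4]] : exists R, [/\ R \subset H, #|R| <= 4 * #|T| & forall A, A \subset H :\: R -> ~~ P 4 A].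
  apply: hitting_edges (hk 4) _ => A B sA sB /and3P[/eqP a4 _ cA] /and3P[/eqP b4 _ cB] d.
  apply: disjoint_covers => v vA vB.
  have [|e [f [eB fB ef c]]] := @two_edges_at B v _ b4 cB vB.
    by move=> e /(subsetP sB)/H3.
  apply: (big A [set e; f]) => //.
  - by rewrite subset_set2 !(subsetP sB).
  - apply: disjoint_byF => x xA; rewrite !inE => /orP[]/eqP xe; move: xA; rewrite xe.
      by have := disjointFl d eB => ->.
    by have := disjointFl d fB => ->.
  - by rewrite a4 cards2 ef.
  have -> : cover A :|: cover [set e; f] = cover A :|: ((e :|: f) :\ v).
    rewrite coverU !cover1; apply/setP => x; rewrite !inE.
    by case: eqVneq => [->|] //; rewrite vA.
  by rewrite cardsU; move: cA c; clear; lia.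
exists (H :\: (R3 :|: R4 :|: R5)); split; first exact: subsetDl.
  split=> [e|A sA /andP[A0 A5]|A sA].
  - by rewrite inE => /andP[_ /H3].
  - have sAH : A \subset H := subset_trans sA (subsetDl _ _).
    have [e eA] : exists e, e \in A by apply/card_gt0P.
    have ne : cover A != set0.
      have /card_gt0P[v ve] : 0 < #|e| by rewrite (H3 e) ?(subsetP sAH).
      by apply/set0Pn; exists v; apply/bigcupP; exists e.
    have nR k R : R \subset R3 :|: R4 :|: R5 -> (forall A, A \subset H :\: R -> ~~ P k A) ->
        #|A| = k -> k + 2 <= #|cover A|.
      move=> sR nP ck; have := nP A; rewrite (subset_trans sA) ?setDS // => /(_ isT).
      by rewrite /P ck eqxx ne /= -ltnNge addn2.
    have [a3|n33] := eqVneq #|A| 3.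
      by rewrite a3; apply: (nR 3 R3 _ n3 a3); rewrite -setUA subsetUl.
    have [a4|n43] := eqVneq #|A| 4.
      by rewrite a4; apply: (nR 4 R4 _ n4 a4); rewrite setUAC subsetUr.
    have [a5|n53] := eqVneq #|A| 5.
      by rewrite a5; apply: (nR 5 R5 _ n5 a5); rewrite subsetUr.
    have sub g : g \in A -> g \subset cover A /\ #|g| = 3.
      by move=> gA; split; [apply: sub_cover|apply: H3; apply: (subsetP sAH)].
    have [se e3] := sub e eA.
    have [a1|a1] := eqVneq #|A| 1.
      by rewrite a1 (leq_trans _ (subset_leq_card se)) ?e3.
    have a2 : #|A| = 2 by move: A0 A5 a1 n53 n43 n33; clear; lia.
    have /card_gt1P[f [g [fA gA fg]]] : 1 < #|A| by rewrite a2.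
    have [sf f3] := sub f fA; have [sg g3] := sub g gA.
    rewrite a2 ltnNge; apply: contra fg => le3.
    have all h : h \in A -> h = cover A.
      move=> hA; have [sh h3] := sub h hA.
      by apply/eqP; rewrite eqEcard sh h3.
    by rewrite (all f fA) (all g gA).
  - by apply: H6; apply: subset_trans sA (subsetDl _ _).
rewrite -(cardsID (R3 :|: R4 :|: R5) H) addnC leq_add2l.
apply: (@leq_trans #|R3 :|: R4 :|: R5|); first by rewrite subset_leq_card // subsetIr.
have [h1 _] := leq_card_setU (R3 :|: R4) R5; have [h2 _] := leq_card_setU R3 R4.
by move: h1 h2 c3 c4 c5; clear; lia.
Qed.

End Sparsification.

(** The linear term is 330 times the 12 n deleted edges. *)
Lemma f3_upper n : 330 * f3 n 8 6 <= 61 * n ^ 2 + 3960 * n.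
Proof.
rewrite /f3; elim/big_ind: _ => [|x y hx hy|H /andP[/forall_inP u /existsPn nf]].
- by [].
- by rewrite maxnE; move: hx hy; case: (leqP x y); lia.
have H3 e : e \in H -> #|e| = 3 by move=> /u/eqP.
have [A sA c6|H' [sH' sp cH]] := sparsify H3.
  by have := nf A; rewrite sA c6 /= -ltnNge.
have := sparse_bound sp.
have : #|light H'| <= 'C(n, 2).
  apply: leq_trans (_ : #|[set A : {set 'I_n} | #|A| == 2]| <= _).
    by apply: subset_leq_card; apply/subsetP => q; rewrite !inE => /andP[].
  by rewrite card_draws card_ord.
rewrite bin2; have : (n * n.-1)./2.*2 <= n ^ 2.
  rewrite -mulnn; apply: leq_trans (_ : n * n.-1 <= _).
    by rewrite -[X in _ <= X]odd_double_half leq_addl.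
  by rewrite leq_mul2l leq_pred orbT.
move: cH; rewrite card_ord -muln2; move: #|H| #|H'| #|light H'| (_./2) (n ^ 2); clear.
by move=> *; lia.
Qed.

(** * The gadget *)

(* The central edge [{0, 1, 2}] carries two doubles at each of its three pairs; each of
   these six inner doubles [{p, q, a}, {p, q, b}], with [c] the third central vertex, has
   two outer doubles at each of the pairs [{c, p}] and [{c, q}]. *)
Definition sides : seq (nat * nat * nat) := [:: (0, 1, 2); (0, 2, 1); (1, 2, 0)].
Definition inner_pair (d : nat) : nat * nat * nat := nth (0, 1, 2) sides d./2.
Definition inner_p (d : nat) : nat := 3 + d.*2.
Definition inner_q (d : nat) : nat := 4 + d.*2.
Definition outer_pair (o : nat) : nat * nat :=
  let d := o./2./2 in ((inner_pair d).2, if odd o./2 then inner_q d else inner_p d).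
Definition outer_r (o : nat) : nat := 15 + o.*2.
Definition outer_s (o : nat) : nat := 16 + o.*2.

Definition double_edges (t : nat * nat * nat * nat) : seq (seq nat) :=
  let: (r, s, a, b) := t in [:: [:: a; r; s]; [:: b; r; s]].
Definition inner_double (d : nat) :=
  (inner_p d, inner_q d, (inner_pair d).1.1, (inner_pair d).1.2).
Definition outer_double (o : nat) :=
  (outer_r o, outer_s o, (outer_pair o).1, (outer_pair o).2).
Definition doubles := map inner_double (iota 0 6) ++ map outer_double (iota 0 24).

Definition gedges : seq (seq N) := Eval vm_compute in
  map (map N.of_nat) ([:: 0; 1; 2] :: flatten (map double_edges doubles)).

(* The ordered light pairs of the gadget. *)
Definition gpairs : seq (N * N) := Eval vm_compute in
  let l := [:: (0, 1); (0, 2); (1, 2)] ++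
    flatten [seq let: (r, s, a, b) := t in [:: (r, s); (r, a); (s, a); (r, b); (s, b)] | t <- doubles] ++
    flatten [seq [:: ((inner_pair d).2, inner_p d); ((inner_pair d).2, inner_q d)] | d <- iota 0 6] in
  map (fun t => (N.of_nat t.1, N.of_nat t.2)) (l ++ map (fun t => (t.2, t.1)) l).

(** Two of the three colours absent from the pair to which the outer double is attached; inner pairs
    always have colours 3 and 4, the centre 0, 1 and 2. *)
Definition outer_colours (a b : nat) : nat * nat :=
  let l := [seq c <- iota 0 5 | (c != a) && (c != b)] in (nth 0 l 0, nth 0 l 1).
Definition inner_colours : seq nat := [:: 0; 1; 2; 3; 4; 3; 4; 3; 4; 3; 4; 3; 4; 3; 4].
Definition gcolours : seq nat := Eval vm_compute in
  inner_colours ++ flatten [seq let t := outer_pair o in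
    let c := outer_colours (nth 0 inner_colours t.1) (nth 0 inner_colours t.2) in
    [:: c.1; c.2] | o <- iota 0 24].

(** Entry [i] belongs to edge [i]: the common pair of its double, then the two apex vertices. The
    central edge repeats its third vertex to fit the format. *)
Definition gframes : seq (seq N) := Eval vm_compute in
  map (map N.of_nat) ([:: 0; 1; 2; 2] ::
    flatten [seq let: (r, s, a, b) := t in [:: [:: r; s; a; b]; [:: r; s; a; b]] | t <- doubles]).

Definition gverts : seq N := Eval vm_compute in map N.of_nat (iota 0 63).

Definition add_verts (cv e : seq N) : seq N :=
  foldr (fun v c => if v \in c then c else v :: c) cv e.

(** * Exhaustive search over small sets of edges *)

Section SubsetSearch.
Variables (test : nat -> seq N -> bool) (bd : nat).

(* [j] edges with vertex list [cv] have been chosen; at most [k] more are taken from [l]. *)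
Fixpoint search (k j : nat) (cv : seq N) (l : seq (seq N)) : bool :=
  if l is e :: l' then
    search k j cv l' &&
    (if k is k'.+1 then
      let cv' := add_verts cv e in
      if bd < size cv' then true else test j.+1 cv' && search k' j.+1 cv' l' else true)
  else true.

Lemma size_add_verts cv e : size cv <= size (add_verts cv e).
Proof. by elim: e => //= v e le; case: ifP => //= _; apply: leq_trans le _. Qed.

Lemma size_foldl_verts s cv : size cv <= size (foldl add_verts cv s).
Proof. by elim: s cv => //= e s IHs cv; apply: leq_trans (size_add_verts _ _) (IHs _). Qed.

(** Vertex lists only grow, so a branch cut beyond [bd] contains no set that fits into [bd]
    vertices. *)
Lemma search_sound l k j cv : search k j cv l ->
  forall s, subseq s l -> 0 < size s <= k -> size (foldl add_verts cv s) <= bd ->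
  test (j + size s) (foldl add_verts cv s).
Proof.
elim: l k j cv => [|e l IHl] k j cv; first by move=> _ [|].
rewrite [search _ _ _ _]/= => /andP[h1 h2] [|x s]; first by [].
rewrite [subseq _ _]/=; case: eqP => [->|_] sub; last exact: IHl h1 _ sub.
case: k {h1} h2 => // k h2; rewrite [size _]/= ltnS => /= le lb.
move: h2; rewrite ltnNge (leq_trans (size_foldl_verts s _) lb) /= => /andP[t1 h].
case: s sub le lb => [|y s] sub le lb; first by rewrite addn1.
by rewrite -addSnnS; apply: (IHl k) => //.
Qed.

End SubsetSearch.

(** * The gadget as a hypergraph *)

Notation gvert := 'I_63.
Definition vnum (u : gvert) : N := N.of_nat u.
Definition vset (l : seq N) : {set gvert} := [set u | vnum u \in l].
Definition gadget : {set {set gvert}} := [set X in map vset gedges].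
Definition gjoin (u v : gvert) : bool := (vnum u, vnum v) \in gpairs.
Definition gcol (u : gvert) : nat := nth 0 gcolours u.

Lemma vnum_inj : injective vnum.
Proof. by move=> u v /Nnat.Nat2N.inj/val_inj. Qed.

Lemma gvertsP x : x \in gverts -> exists u, vnum u = x.
Proof.
have -> : gverts = map N.of_nat (iota 0 63) by vm_compute.
move=> /mapP[n]; rewrite mem_iota /= add0n => ln ->; by exists (Ordinal ln).
Qed.

(** Every listed edge equals the vertex list filtered by membership, which depends only on the
    set. *)
Lemma vset_inj l1 l2 : l1 \in gedges -> l2 \in gedges -> vset l1 = vset l2 -> l1 = l2.
Proof.
have canon (l : seq N) : l \in gedges -> l = [seq x <- gverts | x \in l].
  have /allP h : all (fun l : seq N => l == [seq x <- gverts | x \in l]) gedges by vm_compute.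
  by move=> /h/eqP.
move=> h1 h2 /setP e; rewrite (canon _ h1) (canon _ h2); apply: eq_in_filter => x.
by move=> /gvertsP[u <-]; have := e u; rewrite !inE.
Qed.

Lemma card_vset l : uniq l -> {subset l <= gverts} -> #|vset l| = size l.
Proof.
move=> ul sl; rewrite cardE -(size_map vnum); apply/eqP; rewrite -uniq_size_uniq //.
  by rewrite map_inj_uniq ?enum_uniq //; apply: vnum_inj.
move=> x; apply/idP/mapP => [xl|[u]]; last by rewrite mem_enum inE => h ->.
have [u ux] := gvertsP (sl x xl); exists u => //.
by rewrite mem_enum inE ux.
Qed.

Lemma add_verts_spec cv e : uniq cv ->
  uniq (add_verts cv e) /\ (add_verts cv e =i [predU cv & e]).
Proof.
move=> ucv; elim: e => [|v e [u IHe]] /=; first by split=> // x; rewrite !inE orbF.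
case: ifP => vin; [split=> // x|split=> [|x]; first by rewrite /= vin].
  rewrite IHe !inE; case: (x =P v) => [->|] //=.
  by rewrite orbT; move: vin; rewrite IHe inE.
by rewrite inE IHe !inE orbCA.
Qed.

Lemma foldl_verts_spec s cv : uniq cv -> uniq (foldl add_verts cv s) /\
  forall x, (x \in foldl add_verts cv s) = (x \in cv) || has (fun e => x \in e) s.
Proof.
elim: s cv => [|e s IHs] cv ucv /=; first by split=> // x; rewrite orbF.
have [u1 h1] := add_verts_spec e ucv; have [u2 h2] := IHs _ u1; split=> // x.
by rewrite h2 h1 !inE orbA.
Qed.

Lemma gadget_subset (E : {set {set gvert}}) : E \subset gadget -> exists s, [/\ subseq s gedges, size s = #|E|,
  E = [set X in map vset s], uniq (foldl add_verts [::] s) &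
  cover E = vset (foldl add_verts [::] s) /\ #|cover E| = size (foldl add_verts [::] s)].
Proof.
move=> sE.
have [s [ss um Es]] : exists s, [/\ subseq s gedges, uniq (map vset s) &
    E = [set X in map vset s]].
  exists [seq l <- gedges | vset l \in E]; split; first exact: filter_subseq.
    rewrite map_inj_in_uniq; first by rewrite filter_uniq //; vm_compute.
    move=> l1 l2; rewrite !mem_filter => /andP[_ h1] /andP[_ h2]; exact: vset_inj.
  apply/setP => X; rewrite inE; apply/idP/mapP => [XE|[l]].
    have := subsetP sE _ XE; rewrite inE => /mapP[l lg Xl]; exists l => //.
    by rewrite mem_filter -Xl XE.
  by rewrite mem_filter => /andP[h _] ->.
have [u h] := @foldl_verts_spec s [::] isT.
have cE : cover E = vset (foldl add_verts [::] s).
  apply/setP => v; rewrite inE h /=; apply/bigcupP/hasP => [[X]|[l ls vl]].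
    by rewrite Es inE => /mapP[l ls ->]; rewrite inE; exists l.
  by exists (vset l); rewrite ?inE // Es inE map_f.
have /allP gv : all (fun l : seq N => all (mem gverts) l) gedges by vm_compute.
exists s; split; [exact: ss| |exact: Es|exact: u|].
  rewrite Es cardsE (card_uniqP um) size_map; reflexivity.
split; first exact: cE.
rewrite cE card_vset // => x; rewrite h /= => /hasP[l ls xl].
exact: (allP (gv l (mem_subseq ss ls))).
Qed.

(** The search tests only sets on at most 8 vertices, where six edges are already a violation; hence
    [j < 6]. *)
Definition sparse_test (j : nat) (c : seq N) : bool := (j + 2 <= size c) && (j < 6).

Lemma gadget_search : search sparse_test 8 6 0 [::] gedges.
Proof. by vm_compute. Qed.

Lemma gadget_sparse : sparse gadget.
Proof.
have key (E : {set {set gvert}}) : E \subset gadget -> 0 < #|E| <= 6 ->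
    #|cover E| <= 8 -> (#|E| + 2 <= #|cover E|) && (#|E| < 6).
  move=> sE cE c8; have [s [ss sz _ _ [_ cc]]] := gadget_subset sE.
  have := search_sound gadget_search ss; rewrite sz -cc add0n => /(_ cE c8).
  by rewrite /sparse_test -cc.
split=> [e|E sE /andP[E0 E5]|E sE E6].
- rewrite inE => /mapP[l lg ->]; rewrite card_vset.
  + have /allP h : all (fun l : seq N => size l == 3) gedges by vm_compute.
    exact/eqP/h.
  + have /allP h : all uniq gedges by vm_compute.
    exact: h.
  + have /allP h : all (fun l : seq N => all (mem gverts) l) gedges by vm_compute.
    by apply/allP; apply: h.
- have [c8|c8] := leqP #|cover E| 8; last by move: c8 E5; clear; lia.
  by have := key E sE; rewrite E0 (leq_trans E5) // => /(_ isT c8)/andP[].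
- rewrite ltnNge; apply/negP => c8; have := key E sE; rewrite E6 => /(_ isT c8).
  by rewrite andbF.
Qed.

Lemma card_gadget : #|gadget| = 61.
Proof.
rewrite cardsE (card_uniqP _) ?size_map // map_inj_in_uniq; first by vm_compute.
exact: vset_inj.
Qed.

Definition join_test (j : nat) (c : seq N) : bool :=
  (j + 2 < size c) || all (fun x => all (fun y => (x == y) || ((x, y) \in gpairs)) c) c.

Lemma join_search : search join_test 5 3 0 [::] gedges.
Proof. by vm_compute. Qed.

Lemma gadget_light (E : {set {set gvert}}) u v : E \subset gadget -> 0 < #|E| <= 3 -> #|cover E| <= #|E| + 2 ->
  u \in cover E -> v \in cover E -> u != v -> gjoin u v.
Proof.
move=> sE cE ct uE vE uv; have [s [ss sz _ _ [Es cc]]] := gadget_subset sE.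
have := search_sound join_search ss; rewrite sz -cc add0n => /(_ cE).
have -> : #|cover E| <= 5 by case/andP: cE ct; clear; lia.
rewrite /join_test -cc ltnNge ct /= => /(_ isT)/allP h.
move: uE vE; rewrite Es !inE => /h/allP h' /h'.
by rewrite (inj_eq vnum_inj) (negbTE uv).
Qed.

Lemma card_gjoin : #|[set w : gvert * gvert | gjoin w.1 w.2]| <= 330.
Proof.
have -> : 330 = size gpairs by vm_compute.
pose f (w : gvert * gvert) := (vnum w.1, vnum w.2).
have finj : injective f by move=> [a b] [c d] [/vnum_inj-> /vnum_inj->].
rewrite cardE -(size_map f); apply: uniq_leq_size; first by rewrite map_inj_uniq ?enum_uniq.
by move=> x /mapP[w]; rewrite mem_enum inE => h ->.
Qed.

Lemma gjoinC u v : gjoin u v = gjoin v u.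
Proof.
have sub u' v' : gjoin u' v' -> gjoin v' u'.
  have /allP h : all (fun t => (t.2, t.1) \in gpairs) gpairs by vm_compute.
  by move=> /h.
by apply/idP/idP; apply: sub.
Qed.

Lemma gcol_lt u : gcol u < 5.
Proof.
have /allP h : all (fun c => c < 5) gcolours by vm_compute.
by apply: h; rewrite mem_nth.
Qed.

Lemma gjoin_col u v : gjoin u v -> gcol u != gcol v.
Proof.
pose cN (x : N) := nth 0 gcolours (N.to_nat x).
have /allP h : all (fun t => cN t.1 != cN t.2) gpairs by vm_compute.
by move=> /h; rewrite /cN /vnum /= !Nnat.Nat2N.id.
Qed.

Lemma gjoin_neq u v : gjoin u v -> u != v.
Proof. by move=> /gjoin_col; apply: contra => /eqP->. Qed.

(* Every nonempty set of edges has a private pair [r], [s]: it lies only in edges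
   [{r, s, a}] and [{r, s, b}] of the set, and these contain both or none of [r], [s]. *)
Record frame (E : {set {set gvert}}) (r s a b : gvert) : Prop := Frame {
  frame_used : exists2 e, e \in E & r \in e;
  frame_edges : forall e : {set gvert}, e \in E -> r \in e \/ s \in e ->
    e = [set r; s; a] \/ e = [set r; s; b] :> {set gvert};
  frame_ra : [&& gjoin r s, gjoin r a & gjoin s a];
  frame_rb : gjoin r b && gjoin s b }.

Definition frame_test (i : nat) : bool :=
  if nth [::] gframes i is [:: r; s; a; b] then
    [&& r \in nth [::] gedges i, all (fun x => x \in gverts) [:: r; s; a; b],
        all (fun e => ((r \in e) || (s \in e)) ==>
             (all (fun x => (x \in e) == (x \in [:: r; s; a])) (e ++ [:: r; s; a])
             || all (fun x => (x \in e) == (x \in [:: r; s; b])) (e ++ [:: r; s; b])))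
           (take i.+1 gedges),
        all (mem gpairs) [:: (r, s); (r, a); (s, a)] & all (mem gpairs) [:: (r, b); (s, b)]]
  else false.

Lemma frame_search : all frame_test (iota 0 61).
Proof. by vm_compute. Qed.

(** The frame is that of the last edge of [E] in the order of [gedges]: its common pair occurs in no
    earlier edge outside its double, so [frame_test] inspects only the edges up to it. *)
Lemma frame_exists (E : {set {set gvert}}) : E \subset gadget -> E != set0 -> exists r s a b, frame E r s a b.
Proof.
move=> sE /set0Pn[X0 X0E].
have ex : exists n, (n < 61) && (vset (nth [::] gedges n) \in E).
  have := subsetP sE _ X0E; rewrite inE => /mapP[l lg Xl].
  exists (index l gedges); rewrite nth_index // -Xl X0E andbT.
  by move: lg; rewrite -index_mem.
have [i /andP[i61 iE] imax] := ex_maxnP ex (fun n h => ltnW (andP h).1).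
have := allP frame_search i; rewrite mem_iota /= => /(_ i61).
rewrite /frame_test; case: (nth _ gframes i) => [|r [|s [|a [|b [|]]]]] //.
move=> /and5P[ri /allP gv /allP he /and4P[rs ra sa _] /and3P[rb sb _]].
have [|r' rE] := @gvertsP r; first by apply: gv; rewrite !inE eqxx.
have [|s' sE'] := @gvertsP s; first by apply: gv; rewrite !inE eqxx orbT.
have [|a' aE] := @gvertsP a; first by apply: gv; rewrite !inE eqxx !orbT.
have [|b' bE] := @gvertsP b; first by apply: gv; rewrite !inE eqxx !orbT.
exists r', s', a', b'; split.
- by exists (vset (nth [::] gedges i)); rewrite ?inE ?rE.
- move=> e eE; have := subsetP sE _ eE; rewrite inE => /mapP[l lg el].
  have li : index l gedges <= i.
    apply: imax; rewrite nth_index // -el eE andbT.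
    by move: lg; rewrite -index_mem.
  have lt : l \in take i.+1 gedges by rewrite in_take_leq // ltnS.
  rewrite el !inE rE sE' => /orP h.
  have conv x x' : vnum x' = x ->
      all (fun y => (y \in l) == (y \in [:: r; s; x])) (l ++ [:: r; s; x]) ->
      vset l = [set r'; s'; x'].
    move=> xE; rewrite all_cat => /andP[/allP h1 /allP h2]; apply/setP => u.
    rewrite !inE -!(inj_eq vnum_inj) rE sE' xE -orbA.
    have [ul|ul] := boolP (vnum u \in l).
      by have := h1 _ ul; rewrite ul !inE => /eqP.
    apply/esym/negbTE; apply: contra ul => ul.
    by have := h2 (vnum u); rewrite !inE ul => /(_ isT)/eqP->.
  by have := implyP (he l lt) h => /orP[/(conv _ _ aE)|/(conv _ _ bE)]; [left|right].
- by rewrite /gjoin rE sE' aE; apply/and3P; split.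
- by rewrite /gjoin rE sE' bE; apply/andP; split.
Qed.

(** * A near-perfect packing *)

Section NearPacking.
Import GRing.Theory.
Local Open Scope ring_scope.

Lemma natr_Fp_inj (p a b : nat) : prime p -> (a < p)%N -> (b < p)%N ->
  a%:R = b%:R :> 'F_p -> a = b.
Proof.
move=> pp la lb /(congr1 val) /=; rewrite !val_Fp_nat //.
by rewrite !modn_small.
Qed.

Variables (V : finType) (J : rel V) (q p : nat).
Hypotheses (Jsym : symmetric J) (q_pr : prime q) (p_pr : prime p).
Hypotheses (ltVq : (#|V| < q)%N) (ltqp : (q < p)%N).
Local Notation m := #|[set w : V * V | J w.1 w.2]|.
Variable N : nat.
Hypothesis ltNp : (m * N < p)%N.

Local Notation Q := 'F_q.
Local Notation P := 'F_p.

Definition lab (u : V) : Q := (enum_rank u : nat)%:R.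

Lemma lab_inj : injective lab.
Proof.
move=> u v /natr_Fp_inj h; apply: enum_rank_inj; apply: val_inj; apply: h => //.
- by apply: ltn_trans ltVq; apply: ltn_ord.
- by apply: ltn_trans ltVq; apply: ltn_ord.
Qed.

(** The last component numbers repetitions of one affine image, which [code] keeps apart. *)
Definition affmap := ({g : Q | g != 0} * Q * 'I_N)%type.
Definition amap (T : affmap) (u : V) : Q := val T.1.1 * lab u + T.1.2.

Lemma amap_inj T : injective (amap T).
Proof. by move=> u v /addIr/(mulfI (valP T.1.1))/lab_inj. Qed.

Definition emb (x : Q) : P := (x : nat)%:R.
Definition hole : P := q%:R.

Lemma ltQq (x : Q) : (x < q)%N.
Proof. by rewrite -[X in (_ < X)%N](Fp_cast q_pr) ltn_ord. Qed.

Lemma emb_inj : injective emb.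
Proof.
move=> x y /natr_Fp_inj h; apply: val_inj; apply: h => //.
- exact: ltn_trans (ltQq _) ltqp.
- exact: ltn_trans (ltQq _) ltqp.
Qed.

Lemma emb_hole x : emb x != hole.
Proof.
apply/eqP => /natr_Fp_inj h; have := ltQq x.
by rewrite h ?ltnn // (ltn_trans (ltQq _)).
Qed.

(* A pair of points over [x], [x'] has class [\sum_c (y_c - y'_c) / (xi x c - xi x' c)];
   since column [None] and the columns [Some x], [Some x'] see different denominators,
   the translations [shift] realise arbitrary classes of the pairs of a copy. *)
Definition xi (x : Q) (i : option Q) : P := if i == Some x then hole else emb x.

Lemma xi_neq x x' i : x != x' -> xi x i - xi x' i != 0.
Proof.
move=> ne; rewrite subr_eq0 /xi; case: (i =P Some x) => [->|_].
  by rewrite (inj_eq Some_inj) (negbTE ne) eq_sym emb_hole.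
by case: (i =P Some x') => _; rewrite ?emb_hole // (inj_eq emb_inj).
Qed.

(** The successor avoids 0, the class of all pairs that are not joined. *)
Definition code (j : 'I_N) (w : V * V) : nat :=
  (index w (enum [set w : V * V | J w.1 w.2]) + m * j).+1.

Lemma code_inj j j' w w' : J w.1 w.2 -> J w'.1 w'.2 ->
  (code j w)%:R = (code j' w')%:R :> P -> j = j' /\ w = w'.
Proof.
have idx (w0 : V * V) : J w0.1 w0.2 -> (index w0 (enum [set w : V * V | J w.1 w.2]) < m)%N.
  by move=> h; rewrite cardE index_mem mem_enum inE.
have lt j0 w0 : J w0.1 w0.2 -> (code j0 w0 < p)%N.
  move=> /idx h; apply: leq_ltn_trans ltNp.
  have le : (m * j0.+1 <= m * N)%N by rewrite leq_mul2l ltn_ord orbT.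
  by apply: leq_trans le; rewrite mulnS /code -addSn leq_add2r.
move=> h h' /natr_Fp_inj; rewrite !lt // => /(_ p_pr isT isT) [e].
have e1 := idx _ h; have e2 := idx _ h'.
have m0 : (0 < m)%N by case: (m) e1.
have ej : j = j' :> nat.
  move: (congr1 (fun n => n %/ m)%N e); rewrite -!(addnC (m * _)%N) !(mulnC m).
  by rewrite !divnMDl // !divn_small // !addn0.
split; first exact: val_inj.
move: e; rewrite ej => /addIn e; apply: (@index_inj _ w (enum [set w : V * V | J w.1 w.2])).
- by rewrite mem_enum inE.
- by rewrite mem_enum inE.
- exact: e.
Qed.

Lemma code_neq0 j w : J w.1 w.2 -> (code j w)%:R != 0 :> P.
Proof.
move=> h; apply/eqP => e.
have lt : (code j w < p)%N.
  have idx : (index w (enum [set w : V * V | J w.1 w.2]) < m)%N.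
    by rewrite cardE index_mem mem_enum inE.
  apply: leq_ltn_trans ltNp.
  have le : (m * j.+1 <= m * N)%N by rewrite leq_mul2l ltn_ord orbT.
  by apply: leq_trans le; rewrite mulnS /code -addSn leq_add2r.
by have := @natr_Fp_inj p (code j w) 0 p_pr lt (prime_gt0 p_pr) e.
Qed.

(* The class of the flag [(T, u, v)]; it depends only on the unordered pair. *)
Definition flag_class (T : affmap) (u v : V) : P :=
  if J u v then
    (if (amap T u < amap T v)%N then code T.2 (u, v) else code T.2 (v, u))%:R
  else 0.

Lemma flag_classC T u v : u != v -> flag_class T u v = flag_class T v u.
Proof.
move=> uv; rewrite /flag_class Jsym; case: ifP => // _; congr (_%:R).
case: (ltngtP (amap T u) (amap T v)) => // e.
by case/eqP: uv; apply: (@amap_inj T); exact: val_inj e.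
Qed.

Lemma flag_class_inj T T' u v u' v' : J u v -> u != v -> u' != v' ->
  amap T u = amap T' u' -> amap T v = amap T' v' ->
  flag_class T u v = flag_class T' u' v' -> [/\ T = T', u = u' & v = v'].
Proof.
move=> Juv uv uv' eu ev e.
have Juv' : J u' v'.
  apply/negPn/negP => nJ; move: e; rewrite /flag_class Juv (negbTE nJ).
  by case: ifP => _ /eqP; rewrite (negbTE (code_neq0 _ _)) //= Jsym.
have [ej euv] : T.2 = T'.2 /\ (u, v) = (u', v').
  move: e; rewrite /flag_class Juv Juv' eu ev.
  case: ifP => _ /code_inj; first by apply.
  by move=> h; have [||-> [-> ->]] := h; rewrite //= Jsym.
case: euv eu ev => -> -> eu ev; split=> //.
case: T T' ej eu ev {e} => [[[g g0] h] j] [[[g' g0'] h'] j'] /= -> eu ev.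
have eg : g = g'.
  have : (g - g') * (lab u' - lab v') = 0.
    move: eu ev; rewrite /amap /= => eu ev.
    have -> : (g - g') * (lab u' - lab v') =
      (g * lab u' + h) - (g * lab v' + h) - ((g' * lab u' + h') - (g' * lab v' + h')).
      by rewrite !mulrBl !mulrBr; ring.
    by rewrite eu ev subrr.
  move/eqP; rewrite mulf_eq0 !subr_eq0 (inj_eq lab_inj) (negbTE uv') orbF.
  by move/eqP.
have eh : h = h' by move: eu; rewrite /amap /= eg => /addrI.
by rewrite eh; do 2 congr (_, _); apply: val_inj.
Qed.

Notation rank := (fun u : V => enum_rank u : nat).

(** The denominator is the coefficient of the surviving column in [two_columns]. *)
Definition weight (T : affmap) (u v : V) : P :=
  flag_class T u v /
  ((emb (amap T u) - hole)^-1 - (emb (amap T u) - emb (amap T v))^-1).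

(** A vertex is shifted only in the columns of vertices of smaller rank, which makes the system for
    the classes triangular; column [None] brings the sum of its shifts to zero. *)
Definition shift (T : affmap) (u : V) (c : option Q) : P :=
  if c is Some z then \sum_(v | (rank v < rank u)%N && (amap T v == z)) weight T u v
  else - \sum_(v | (rank v < rank u)%N) weight T u v.

Definition slope (a : {ffun Q -> P}) (c : option Q) : P :=
  if c is Some z then a z else - \sum_z a z.

Definition coord (T : affmap) (a : {ffun Q -> P}) (b : {ffun option Q -> P}) u c : P :=
  slope a c * xi (amap T u) c + b c + shift T u c.

Lemma sum_option (F : option Q -> P) : \sum_c F c = F None + \sum_z F (Some z).
Proof.
rewrite (bigD1 None) //=; congr (_ + _).
by rewrite (reindex_omap Some id) //= => [|[z|]] //; apply: eq_bigl => z; rewrite eqxx.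
Qed.

Lemma sum_slope a : \sum_c slope a c = 0.
Proof. by rewrite sum_option /= addNr. Qed.

Lemma sum_shift T u : \sum_c shift T u c = 0.
Proof.
rewrite sum_option /=; apply/eqP; rewrite addrC subr_eq0; apply/eqP/esym.
by rewrite (partition_big (amap T) predT).
Qed.

Lemma shift_old T u v : (rank u <= rank v)%N -> shift T u (Some (amap T v)) = 0.
Proof.
move=> le; rewrite /shift big1 // => w /andP[lt /eqP/amap_inj wv].
by move: lt; rewrite wv ltnNge le.
Qed.

Lemma shift_new T u v : (rank v < rank u)%N -> shift T u (Some (amap T v)) = weight T u v.
Proof.
move=> lt; rewrite /shift (big_pred1 v) // => w.
by rewrite (inj_eq (@amap_inj T)) /=; case: eqP => [->|]; rewrite ?andbF ?andbT.
Qed.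

(** Every other column has denominator [D]; subtracting its inverse throughout changes nothing, as
    [f] sums to zero, and leaves two terms. *)
Lemma two_columns (f : option Q -> P) x x' : x != x' -> \sum_c f c = 0 ->
  \sum_c f c / (xi x c - xi x' c) =
    f (Some x) * ((hole - emb x')^-1 - (emb x - emb x')^-1) +
    f (Some x') * ((emb x - hole)^-1 - (emb x - emb x')^-1).
Proof.
move=> ne f0; set D := emb x - emb x'.
have -> : \sum_c f c / (xi x c - xi x' c) =
    \sum_c f c * ((xi x c - xi x' c)^-1 - D^-1).
  under [RHS]eq_bigr => c _ do rewrite mulrBr.
  by rewrite sumrB -mulr_suml f0 mul0r subr0.
rewrite (bigD1 (Some x)) //= (bigD1 (Some x')) /=; last first.
  by rewrite (inj_eq Some_inj) eq_sym.
rewrite big1 ?addr0 => [|c /andP[cx cx']].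
  rewrite /xi !eqxx !(inj_eq Some_inj) (negbTE ne) eq_sym (negbTE ne).
  by [].
by rewrite /xi (negbTE cx) (negbTE cx') subrr mulr0.
Qed.

(** The slopes sum to zero and the translations cancel, so the class depends on neither [a] nor [b];
    of the shifts only that of the later vertex in the column of the earlier one remains. *)
Lemma pair_class T a b u v : u != v ->
  \sum_c (coord T a b u c - coord T a b v c) / (xi (amap T u) c - xi (amap T v) c)
  = flag_class T u v.
Proof.
wlog lt : u v / (rank v < rank u)%N => [hw uv|].
  have [lt|gt|e] := ltngtP (rank v) (rank u); first exact: hw.
    rewrite flag_classC // -hw // 1?eq_sym //; apply: eq_bigr => c _.
    by rewrite -[coord T a b u c - _]opprB -[xi (amap T u) c - _]opprB invrN mulrNN.
  by case/eqP: uv; apply: enum_rank_inj; apply: val_inj.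
move=> uv; set x := amap T u; set x' := amap T v.
have ne : x != x' by rewrite (inj_eq (@amap_inj T)).
under eq_bigr => c _.
  have -> : coord T a b u c - coord T a b v c =
    slope a c * (xi x c - xi x' c) + (shift T u c - shift T v c).
    by rewrite /coord -/x -/x'; ring.
  rewrite mulrDl mulfK ?xi_neq //; over.
rewrite big_split /= sum_slope add0r two_columns //; last first.
  by rewrite sumrB !sum_shift subrr.
rewrite /x /x' !(shift_old T (leqnn _)) (shift_old T (ltnW lt)) shift_new //.
rewrite subr0 mul0r add0r subr0 /weight divfK //.
rewrite subr_eq0 (inj_eq invr_inj) (inj_eq (addrI _)) (inj_eq oppr_inj).
by rewrite eq_sym emb_hole.
Qed.

Definition copies := (affmap * {ffun Q -> P} * {ffun option Q -> P})%type.
Definition place (i : copies) (u : V) : Q * {ffun option Q -> P} :=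
  (amap i.1.1 u, [ffun c => coord i.1.1 i.1.2 i.2 u c]).

Lemma place_inj i : injective (place i).
Proof. by move=> u v /(congr1 fst)/amap_inj. Qed.

(** The class of the pair reveals [T], [u] and [v], and two points over distinct abscissae then
    determine slopes and translations. Nothing is assumed on [u'] and [v']: unjoined pairs have
    class 0, so a joined pair of one copy is never an unjoined pair of another. *)
Lemma place_join i j u v u' v' : place i u = place j u' -> place i v = place j v' ->
  u != v -> J u v -> i = j.
Proof.
case: i j => [[T a] b] [[T' a'] b'] eu0 ev0 uv Juv.
have xu : amap T u = amap T' u' := congr1 fst eu0.
have xv : amap T v = amap T' v' := congr1 fst ev0.
have /ffunP yu := congr1 snd eu0; have /ffunP yv := congr1 snd ev0.
have ne : amap T u != amap T v by rewrite (inj_eq (@amap_inj T)).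
have uv' : u' != v' by move: ne; rewrite xu xv (inj_eq (@amap_inj T')).
have {}yu c : coord T a b u c = coord T' a' b' u' c by move: (yu c); rewrite !ffunE.
have {}yv c : coord T a b v c = coord T' a' b' v' c by move: (yv c); rewrite !ffunE.
have [eT eu ev] : [/\ T = T', u = u' & v = v'].
  apply: (flag_class_inj Juv uv uv' xu xv).
  rewrite -(pair_class T a b uv) -(pair_class T' a' b' uv').
  by apply: eq_bigr => c _; rewrite yu yv xu xv.
move: yu yv; rewrite -eT -eu -ev => yu yv.
have ea c : slope a c = slope a' c.
  apply: (mulIf (xi_neq c ne)).
  have E a0 b0 : slope a0 c * (xi (amap T u) c - xi (amap T v) c) =
      coord T a0 b0 u c - coord T a0 b0 v c - (shift T u c - shift T v c).
    by rewrite /coord; ring.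
  by rewrite (E a b) (E a' b') yu yv.
have eb : b = b'.
  by apply/ffunP => c; have := yu c; rewrite /coord ea => /addIr/addrI.
have -> : a = a' by apply/ffunP => z; have := ea (Some z).
by rewrite eb.
Qed.

Lemma card_place_space : #|{: Q * {ffun option Q -> P}}| = (q * p ^ q.+1)%N.
Proof. by rewrite card_prod card_ffun card_option !card_Fp. Qed.

Lemma card_copies : #|{: copies}| = ((q - 1) * q * N * p ^ q * p ^ q.+1)%N.
Proof.
rewrite !card_prod !card_ffun card_option !card_Fp // card_ord card_sig.
suff -> : #|[pred g : Q | g != 0]| = (q - 1)%N by [].
by rewrite cardC1 card_Fp // subn1.
Qed.

End NearPacking.

Lemma near_packing (V : finType) (J : rel V) (k : nat) : symmetric J ->
  0 < #|[set w : V * V | J w.1 w.2]| -> 0 < k ->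
  exists (I X : finType) (T : I -> V -> X),
    [/\ forall i, injective (T i),
        forall i j u v u' v', T i u = T j u' -> T i v = T j v' ->
          u != v -> J u v -> i = j,
        0 < #|X|
      & #|X| ^ 2 * k <= #|X| ^ 2 + k * #|[set w : V * V | J w.1 w.2]| * #|I|].
Proof.
move=> Jsym; set m := #|_| => m0 k0.
(* The condition g != 0 loses a fraction 1 / q of the pairs and rounding (p - 1) / m at most m / p;
   both are below 1 / (2 k). *)
have [q hq q_pr] := prime_above (#|V| + 2 * k).
have [p hp p_pr] := prime_above (q + 2 * k * m).
have ltVq : #|V| < q by move: hq; clear; lia.
have ltqp : q < p by move: hp; clear; lia.
pose N := (p.-1 %/ m)%N.
have ltNp : m * N < p.
  by rewrite mulnC -[X in _ < X]prednK ?prime_gt0 // ltnS leq_trunc_div.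
exists (copies q p N), ('F_q * {ffun option 'F_q -> 'F_p})%type,
  (@place V J q p N); split.
- by move=> i; apply: (place_inj q_pr ltVq).
- by move=> i j u v u' v'; apply: (place_join Jsym q_pr p_pr ltVq ltqp ltNp).
- by rewrite card_place_space // muln_gt0 expn_gt0 !prime_gt0.
rewrite card_place_space // card_copies // -/m.
have hN : p <= m * N + m.
  by have := ltn_ceil p.-1 m0; rewrite -/N mulSn mulnC => h; move: h (prime_gt0 p_pr); clear; lia.
have key : q * p * k <= q * p + k * (m * N) * (q - 1).
  have h1 : q * p * k <= q * (m * N + m) * k by rewrite leq_mul2r leq_mul2l hN !orbT.
  move: hq hp h1 hN; clear; nia.
have -> : (q * p ^ q.+1) ^ 2 = q * p * (q * p ^ q * p ^ q.+1).
  by rewrite expnMn !expnS; ring.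
have -> : k * m * ((q - 1) * q * N * p ^ q * p ^ q.+1) =
    k * (m * N) * (q - 1) * (q * p ^ q * p ^ q.+1).
  by move: (q - 1) (p ^ q) (p ^ q.+1) => x y z; ring.
by rewrite -mulnDl mulnAC leq_mul2r key orbT.
Qed.

(** * The lift *)

(** These values make the determinants in [pasch_colours], [grid_colours] and [hexagon_colours]
    nonzero and at most 10000 in absolute value. *)
Definition cslope (c : nat) : nat := nth 0 [:: 0; 1; 2; 3; 8] c.
Definition gslope (u : gvert) : nat := cslope (gcol u).

(** * Linear relations among slopes of distinct colours *)

Section ColourWeights.
Import GRing.Theory Num.Theory.
Local Open Scope ring_scope.

(* Up to a common factor, [col_weight m c] is the Lagrange coefficient
   [1 / \prod_(d <- m | d != c) (cslope c - cslope d)]. *)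
Definition col_weight (m : seq nat) (c : nat) : int :=
  foldr (fun d z => foldr (fun e z' => ((cslope e)%:Z - (cslope d)%:Z) * z') z
                     [seq e <- m | (e != c) && (d < e)%N])
    ((-1) ^+ count (ltn c) m) [seq d <- m | d != c].

Definition col_weight_test (m : seq nat) : bool :=
  [&& all (fun c => (0 < `|col_weight m c|)%N && (`|col_weight m c| < 10000)%N) m,
      foldr (fun c z => col_weight m c + z) 0 m == 0
    & foldr (fun c z => col_weight m c * (cslope c)%:Z + z) 0 m == 0].

Fixpoint masks (n : nat) : seq bitseq :=
  if n is n'.+1 then [seq b :: l | b <- [:: true; false], l <- masks n'] else [:: [::]].

Lemma mem_masks n (b : bitseq) : size b = n -> b \in masks n.
Proof.
elim: n b => [|n IHn] [|x b] //= [sb]; rewrite !mem_cat.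
by case: x; rewrite map_f ?orbT ?IHn.
Qed.

Lemma col_weights : all (fun b => (2 < size (mask b (iota 0 5)))%N ==>
  col_weight_test (mask b (iota 0 5))) (masks 5).
Proof. by vm_compute. Qed.

Lemma big_foldr (R : nmodType) (I : Type) (s : seq I) (F : I -> R) :
  \sum_(i <- s) F i = foldr (fun i z => F i + z) 0 s.
Proof. by elim: s => [|i s IHs]; rewrite ?big_nil // big_cons IHs. Qed.

Lemma intr_Fp_eq0 (p : nat) (z : int) : prime p -> (`|z| < p)%N ->
  z%:~R = 0 :> 'F_p -> z = 0.
Proof.
move=> pp lt h; suff : `|z|%N = 0%N by lia.
apply: (@natr_Fp_inj p) => //; first exact: prime_gt0.
have : `|z|%N%:R = z%:~R :> 'F_p \/ `|z|%N%:R = - z%:~R :> 'F_p.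
  by clear; case: z => n; [left|right; rewrite NegzE intrN opprK].
by case=> ->; rewrite h ?oppr0.
Qed.

(** Pairwise joined vertices have distinct colours, hence distinct slopes, and Lagrange coefficients
    on at least three slopes annihilate all affine functions. Their size below [p] keeps them
    nonzero modulo [p]. *)
Lemma colour_relation (p : nat) (S : {set gvert}) : prime p -> (10000 < p)%N ->
  {in S &, forall u v, u != v -> gjoin u v} -> (2 < #|S|)%N ->
  exists w : gvert -> 'F_p, [/\ {in S, forall u, w u != 0},
    \sum_(u in S) w u = 0 & \sum_(u in S) w u * (gslope u)%:R = 0].
Proof.
move=> pp lp SJ S3; pose L := [seq c <- iota 0 5 | c \in map gcol (enum S)].
have ug : uniq (map gcol (enum S)).
  rewrite map_inj_in_uniq ?enum_uniq // => u v; rewrite !mem_enum => uS vS e.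
  apply/eqP/negPn/negP => uv; have := gjoin_col (SJ u v uS vS uv).
  by rewrite e eqxx.
have pL : perm_eq (map gcol (enum S)) L.
  apply: uniq_perm => // [|c]; first by rewrite filter_uniq // iota_uniq.
  rewrite mem_filter andb_idr // => /mapP[u _ ->].
  by rewrite mem_iota /= add0n gcol_lt.
have sumL (R : nmodType) (F : nat -> R) : \sum_(u in S) F (gcol u) = \sum_(c <- L) F c.
  by rewrite -(perm_big _ pL) big_map big_enum_cond; apply: eq_bigl => u; rewrite andbT.
have [b sb Lb] : exists2 b, size b = 5 & L = mask b (iota 0 5).
  by exists (map [pred c | c \in map gcol (enum S)] (iota 0 5)); rewrite // -filter_mask.
have := allP col_weights b (mem_masks sb); rewrite -Lb -(perm_size pL) size_map -cardE S3.
move=> /= /and3P[/allP h1 /eqP h2 /eqP h3].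
exists (fun u => (col_weight L (gcol u))%:~R); split.
- move=> u uS; have /h1/andP[w0 w1] : gcol u \in L.
    by rewrite -(perm_mem pL) map_f // mem_enum.
  apply/eqP => /intr_Fp_eq0 e; move: w0; rewrite e //.
  exact: ltn_trans w1 lp.
- by rewrite (sumL _ (fun c => (col_weight L c)%:~R)) -rmorph_sum big_foldr h2.
- rewrite (sumL _ (fun c => (col_weight L c)%:~R * (cslope c)%:R)).
  under eq_bigr => c _ do rewrite -[(cslope c)%:R]/((cslope c)%:Z%:~R) -intrM.
  by rewrite -rmorph_sum big_foldr h3.
Qed.

End ColourWeights.

(** * The blow-up of a copy *)

Section Lift.
Import GRing.Theory Num.Theory.
Local Open Scope ring_scope.
Variables (I X : finType) (T : I -> gvert -> X) (p M : nat).
Hypotheses (p_pr : prime p) (ltp : (10000 < p)%N).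
Hypothesis T_inj : forall i, injective (T i).

(* One coordinate for every choice of gains and translations. *)
Definition lift_index := {ffun I * gvert -> 'F_p * 'F_p}.
(** The untwisted factor ['Z_M] adapts the size to n while [p] stays fixed. *)
Definition lift_coord := ({ffun lift_index -> 'F_p} * 'Z_M)%type.
Definition line := (lift_coord * lift_coord)%type.
Definition eval (l : line) (u : gvert) : lift_coord := l.1 *+ gslope u + l.2.
(** Zero is replaced by 1 so that every choice gives a bijection. *)
Definition gain (k : lift_index) (i : I) (u : gvert) : 'F_p :=
  if (k (i, u)).1 == 0 then 1 else (k (i, u)).1.
Definition lift_value (i : I) (u : gvert) (x : lift_coord) : lift_coord :=
  ([ffun k : lift_index => gain k i u * x.1 k + (k (i, u)).2], x.2).
Definition lift_point (c : I * line) (u : gvert) : X * lift_coord :=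
  (T c.1 u, lift_value c.1 u (eval c.2 u)).

Lemma gain_neq0 k i u : gain k i u != 0.
Proof. by rewrite /gain; case: ifP => [_|/negbT] //; rewrite oner_neq0. Qed.

Lemma lift_value_inj i u : injective (lift_value i u).
Proof.
move=> [a b] [a' b'] [/ffunP e ->]; congr (_, _); apply/ffunP => k.
by have := e k; rewrite !ffunE => /addIr/(mulfI (gain_neq0 _ _ _)).
Qed.

Lemma lift_pointE i l l' u u' :
  lift_point (i, l) u = lift_point (i, l') u' <-> u = u' /\ eval l u = eval l' u.
Proof.
split=> [e|[<- e]]; last first.
  by rewrite /lift_point; congr (_, _); apply: (congr1 (lift_value i u)).
have eu : u = u' by apply: (@T_inj i); exact: (congr1 fst e).
by split=> //; move: e; rewrite -eu => /(congr1 snd)/lift_value_inj.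
Qed.

Lemma eval_fst (l : line) u k : (eval l u).1 k = l.1.1 k * (gslope u)%:R + l.2.1 k.
Proof.
rewrite /eval; case: l => [[a b] [a' b']] /=; rewrite ffunE; congr (_ + _).
rewrite mulr_natr; elim: (gslope u) => [|n IHn]; first by rewrite !mulr0n ffunE.
by rewrite !mulrS ffunE IHn.
Qed.

(* Over distinct indices [i] the gains and translations of a single lift coordinate can
   be chosen freely, so that the incidences of the bodies force a false linear relation. *)
Lemma distinct_index_free (body : finType) (Ps : {set body}) (cp : body -> I * line)
    (ls : body -> {set gvert}) (pts := fun B => lift_point (cp B) @: ls B) :
  (0 < #|Ps| < 10000)%N -> {in Ps &, injective (fun B => (cp B).1)} ->
  {in Ps, forall B, {in ls B &, forall u v, u != v -> gjoin u v}} ->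
  {in Ps, forall B, (2 < #|pts B :&: \bigcup_(B' in Ps | B' != B) pts B'|)%N} ->
  False.
Proof.
move=> /andP[P0 P1] inji lsJ core3.
pose cpts B := pts B :&: \bigcup_(B' in Ps | B' != B) pts B'.
pose core B := [set u in ls B | lift_point (cp B) u \in cpts B].
have pinj B : injective (lift_point (cp B)).
  by move=> u v; case: (cp B) => i l /lift_pointE[].
have coreE B : cpts B = lift_point (cp B) @: core B.
  apply/setP => x; apply/idP/imsetP => [xc|[u]]; last by rewrite inE => /andP[_ ?] ->.
  move: (xc); rewrite inE => /andP[/imsetP[u uB xu] _]; exists u => //.
  by rewrite inE uB -xu.
have ex B : exists w : gvert -> 'F_p, B \in Ps ->
    [/\ {in core B, forall u, w u != 0}, \sum_(u in core B) w u = 0 &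
        \sum_(u in core B) w u * (gslope u)%:R = 0].
  case: (boolP (B \in Ps)) => BP; last by exists (fun=> 0).
  have [||w hw] := @colour_relation p (core B) p_pr ltp; last by exists w.
    move=> u v; rewrite [u \in _]in_set [v \in _]in_set => /andP[uB _] /andP[vB _].
    exact: (lsJ B BP).
  by have := core3 B BP; rewrite -/(cpts B) coreE card_imset.
have [w wP] := fin_all_exists ex.
pose Mp x := [set B in Ps | x \in cpts B].
(* Nonzero weights that sum to zero over the bodies through [x]: a chosen body gets minus the number
   of the others. *)
pose om B x : 'F_p := if [pick B' in Mp x] == Some B then - (#|Mp x|.-1)%:R else 1.
have om_sum x : \sum_(B in Mp x) om B x = 0.
  rewrite /om; case: pickP => [B0 B0M|M0]; last first.
    by rewrite big_pred0.
  rewrite (bigD1 B0) //= eqxx (eq_bigr (fun=> 1)) => [|B /andP[_ ne]]; last first.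
    by rewrite (inj_eq Some_inj) eq_sym (negbTE ne).
  rewrite sumr_const (cardD1 B0) B0M /= addrC; apply/eqP; rewrite subr_eq0; apply/eqP.
  by congr (_%:R); apply: eq_card => B; rewrite unfold_in /= andbC !inE.
have Mp2 B x : B \in Ps -> x \in cpts B -> (1 < #|Mp x|)%N.
  move=> BP xB; move: (xB); rewrite inE => /andP[xb /bigcupP[B' /andP[BP' ne] xb']].
  apply/card_gt1P; exists B, B'; split; rewrite ?inE ?BP ?BP' 1?eq_sym //=.
    by move: xB; rewrite inE.
  rewrite xb' /=; apply/bigcupP; exists B => //.
  by rewrite BP eq_sym.
have om_neq0 B x : B \in Ps -> x \in cpts B -> om B x != 0.
  move=> BP xB; rewrite /om; case: ifP => _; last exact: oner_neq0.
  have m2 := Mp2 B x BP xB; have m1 : (#|Mp x| <= #|Ps|)%N.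
    by apply: subset_leq_card; apply/subsetP => B'; rewrite inE => /andP[].
  rewrite oppr_eq0; apply/eqP => /(@natr_Fp_inj p _ 0) e.
  by move: m1 m2 P1 ltp e (prime_gt0 p_pr); clear -p_pr; case: #|Mp x| => //= n; lia.
have /card_gt0P[B0 B0P] := P0.
have [u0 u0B] : exists u0, u0 \in core B0.
  apply/card_gt0P; rewrite -(card_imset _ (@pinj B0)) -coreE.
  exact: leq_trans (core3 B0 B0P).
(* The gains turn the slope relation of each body into one with weights [om]; the single translation
   1, at [u0] on [B0], unbalances the total. *)
pose k : lift_index := [ffun t => 
  (if [pick B in Ps | (cp B).1 == t.1] is Some B then
     w B t.2 / om B (lift_point (cp B) t.2) else 1,
   (t == ((cp B0).1, u0))%:R)].
have kE B u : B \in Ps -> k ((cp B).1, u) =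
    (w B u / om B (lift_point (cp B) u), ((B == B0) && (u == u0))%:R).
  move=> BP; rewrite ffunE /=; congr (_, _).
    case: pickP => [B' /andP[BP' /eqP/inji->]|/(_ B)] //.
    by rewrite BP eqxx.
  by rewrite -pair_eqE /= (inj_in_eq inji).
pose phi (x : X * lift_coord) : 'F_p := x.2.1 k.
have rel B : B \in Ps -> \sum_(u in core B) om B (lift_point (cp B) u) *
    (phi (lift_point (cp B) u) - ((B == B0) && (u == u0))%:R) = 0.
  move=> BP; have [w0 w1 w2] := wP B BP.
  have -> : \sum_(u in core B) om B (lift_point (cp B) u) *
    (phi (lift_point (cp B) u) - ((B == B0) && (u == u0))%:R) =
    \sum_(u in core B) ((w B u * (gslope u)%:R) * (cp B).2.1.1 k + w B u * (cp B).2.2.1 k).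
    apply: eq_bigr => u uB; have om0 : om B (lift_point (cp B) u) != 0.
      by apply: om_neq0 => //; rewrite coreE imset_f.
    rewrite [phi _]ffunE /gain kE //= mulf_eq0 invr_eq0 (negbTE om0) orbF.
    rewrite (negbTE (w0 u uB)) addrK mulrA mulrCA mulfV // mulr1 eval_fst.
    by rewrite mulrDr mulrA mulrAC.
  by rewrite big_split /= -!mulr_suml w2 w1 !mul0r addr0.
(* In this sum the terms in [phi] cancel point by point, and only minus the nonzero weight at the
   translated vertex is left. *)
have : \sum_(B in Ps) \sum_(u in core B) om B (lift_point (cp B) u) *
    (phi (lift_point (cp B) u) - ((B == B0) && (u == u0))%:R) = 0.
  by rewrite big1 // => B /rel.
under eq_bigr => B _ do under eq_bigr => u _ do rewrite mulrBr.
under eq_bigr => B _ do rewrite sumrB.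
rewrite sumrB.
have -> : \sum_(B in Ps) \sum_(u in core B) om B (lift_point (cp B) u) *
    phi (lift_point (cp B) u) = 0.
  transitivity (\sum_(B in Ps) \sum_(x in cpts B) om B x * phi x).
    apply: eq_bigr => B _; rewrite coreE big_imset //=.
    by move=> u v _ _; apply: pinj.
  rewrite (exchange_big_dep predT) //= big1 // => x _.
  rewrite -mulr_suml (eq_bigl (mem (Mp x))) ?om_sum ?mul0r // => B.
  by rewrite !inE.
rewrite (bigD1 B0) //= (bigD1 u0) //= !eqxx mulr1 big1 => [|u /andP[_ ne]]; last first.
  by rewrite (negbTE ne) mulr0.
rewrite big1 => [|B /andP[_ ne]]; last first.
  by rewrite big1 // => u _; rewrite (negbTE ne) mulr0.
rewrite !addr0 sub0r => /eqP; rewrite oppr_eq0; apply/negP; apply: om_neq0 => //.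
by rewrite coreE imset_f.
Qed.

End Lift.

(** * Tight sets spread over several copies *)

Lemma card_bigcup_leq (I T : finType) (A : {set I}) (F : I -> {set T}) :
  #|\bigcup_(i in A) F i| <= \sum_(i in A) #|F i|.
Proof.
elim/big_rec2: _ => [|i m B _ le]; first by rewrite cards0.
by apply: leq_trans (leq_add (leqnn _) le); rewrite -cardsUI leq_addr.
Qed.

Section Bodies.
Import GRing.Theory.
Variables (I L Y body : finType) (W : zmodType) (da db : L -> W).
Variable pl : I * L -> gvert -> Y.

Definition leval (l : L) (u : gvert) : W := (da l *+ gslope u + db l)%R.

Definition torsion_free : Prop :=
  forall (w : W) (d : nat), 0 < d <= 10000 -> (w *+ d = 0)%R -> w = 0%R.

(** In [inc_join] the two points may come from different lines over an index; only the index is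
    recovered. *)
Record incidence : Prop := Incidence {
  inc_line : forall l l', da l = da l' -> db l = db l' -> l = l';
  inc_torsion : torsion_free;
  inc_same : forall i l l' u u',
    pl (i, l) u = pl (i, l') u' <-> u = u' /\ leval l u = leval l' u;
  inc_join : forall c c' d d' u u' v v', pl c u = pl c' u' -> pl d v = pl d' v' ->
    c.1 = d.1 -> c'.1 = d'.1 -> u != v -> gjoin u v -> c.1 = c'.1 }.

Variables (Ps : {set body}) (cp : body -> I * L) (es : body -> {set {set gvert}}).
Implicit Types (B : body) (Q : {set body}).
Definition labels B := cover (es B).
Definition pts B := pl (cp B) @: labels B.
Definition ptsU Q := \bigcup_(B in Q) pts B.

(* [Ps] is a partition, with as few parts as possible, of a tight set of edges that does
   not lie in one copy into tight parts [B] that do: [B] is the copy [cp B] of [es B]. *)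
Record config : Prop := Config {
  cf_sub : {in Ps, forall B, es B \subset gadget};
  cf_pos : {in Ps, forall B, 0 < #|es B|};
  cf_card : {in Ps, forall B, #|labels B| = #|es B| + 2};
  cf_pair : {in Ps &, forall B B', B != B' -> #|pts B :&: pts B'| <= 1};
  cf_part : forall Q, Q \subset Ps -> 1 < #|Q| < #|Ps| ->
    \sum_(B in Q) #|es B| + 3 <= #|ptsU Q|;
  cf_all : #|ptsU Ps| <= \sum_(B in Ps) #|es B| + 2;
  cf_size : 3 < #|Ps|;
  cf_edges : \sum_(B in Ps) #|es B| <= 6 }.

Hypotheses (inc : incidence) (cf : config).

Lemma pl_inj c : injective (pl c).
Proof. by case: c => i l u v /(inc_same inc)[]. Qed.

Lemma card_pts B : B \in Ps -> #|pts B| = #|es B| + 2.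
Proof. by move=> BP; rewrite card_imset ?(cf_card cf) //; apply: pl_inj. Qed.

Lemma edges_rest B : B \in Ps ->
  #|es B| + \sum_(B' in Ps :\ B) #|es B'| = \sum_(B' in Ps) #|es B'|.
Proof. by move=> BP; rewrite [RHS](big_setD1 B). Qed.

Lemma card_le_edges Q : Q \subset Ps -> #|Q| <= \sum_(B in Q) #|es B|.
Proof.
move=> sQ; rewrite -sum1_card; apply: leq_sum => B /(subsetP sQ); exact: cf_pos.
Qed.

Lemma es_le3 B : B \in Ps -> #|es B| <= 3.
Proof.
move=> BP; have := edges_rest BP; have := card_le_edges (subsetDl Ps [set B]).
have := cardsD1 B Ps; rewrite BP; have := cf_size cf; have := cf_edges cf.
by move: #|Ps| #|Ps :\ B| #|es B| (\sum_(B in _) _) (\sum_(B in Ps :\ _) _); clear => *; lia.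
Qed.

Lemma labels_join B : B \in Ps -> {in labels B &, forall u v, u != v -> gjoin u v}.
Proof.
move=> BP u v uB vB; apply: (@gadget_light (es B)) => //; first exact: (cf_sub cf).
  by rewrite (cf_pos cf) ?es_le3.
by rewrite -(cf_card cf).
Qed.

(** The other parts span at least three points more than they have edges, [B] two more, and all
    together at most two more: 3 + 2 - 2 points are common. *)
Lemma core_ge3 B : B \in Ps -> 3 <= #|pts B :&: \bigcup_(B' in Ps | B' != B) pts B'|.
Proof.
move=> BP; have e : \bigcup_(B' in Ps | B' != B) pts B' = ptsU (Ps :\ B).
  by apply: eq_bigl => B'; rewrite !inE andbC.
have eU : ptsU Ps = pts B :|: ptsU (Ps :\ B) by rewrite /ptsU (big_setD1 B).
have := cf_part cf (subsetDl Ps [set B]); have := cf_all cf; have := edges_rest BP.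
have := cardsD1 B Ps; have := cf_size cf; have := cardsUI (pts B) (ptsU (Ps :\ B)).
rewrite BP card_pts // -eU e.
move: #|Ps| #|Ps :\ B| #|es B| (\sum_(B in _) _) (\sum_(B in Ps :\ _) _) #|ptsU Ps|.
by move: #|ptsU (_ :\ B)| #|_ :&: _|; clear => *; lia.
Qed.

(** * Several parts over one index and others elsewhere *)

Section MixedClasses.
Variable i0 : I.
Let C := [set B in Ps | (cp B).1 == i0].
Let F := [set B in Ps | (cp B).1 != i0].

(** The labels of a part are pairwise joined, so two points in common with the class would put [B]
    over [i0]. *)
Lemma foreign_meet B : B \in F -> #|pts B :&: ptsU C| <= 1.
Proof.
rewrite in_set => /andP[BP ni]; rewrite leqNgt; apply/negP => /card_gt1P[x [y []]].
move=> /setIP[/imsetP[u uB ->] /bigcupP[B1 B1C /imsetP[u' _ eu]]].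
move=> /setIP[/imsetP[v vB ->] /bigcupP[B2 B2C /imsetP[v' _ ev]]].
move: B1C B2C; rewrite [B1 \in _]in_set [B2 \in _]in_set => /andP[_ /eqP i1] /andP[_ /eqP i2] xy.
have uv : u != v by apply: contra xy => /eqP->.
have := inc_join inc eu ev erefl _ uv (labels_join BP uB vB uv).
by rewrite i1 i2 => /(_ erefl) e; rewrite e eqxx in ni.
Qed.

(** Class and rest each span at least three points more than they have edges, so they share at least
    four, while each foreign part supplies at most one. This forces four foreign edges; outside the
    class they cut distinct pairs from the three points of [Z], which has only three pairs. *)
Lemma mixed_class_free : 1 < #|C| -> F != set0 -> False.
Proof.
move=> C2 F0; have CP : C \subset Ps by apply/subsetP => B; rewrite inE => /andP[].
have FP : F \subset Ps by apply/subsetP => B; rewrite inE => /andP[].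
have PE : Ps = C :|: F.
  by apply/setP => B; rewrite !inE -andb_orr orbN andbT.
have dCF : [disjoint C & F].
  rewrite -setI_eq0; apply/eqP/setP => B; rewrite !inE.
  by case: (B \in Ps) => //=; case: eqP.
have cP : #|Ps| = #|C| + #|F|.
  by rewrite PE cardsU (eqP (_ : C :&: F == set0)) ?cards0 ?subn0 // setI_eq0.
have sP : \sum_(B in Ps) #|es B| = \sum_(B in C) #|es B| + \sum_(B in F) #|es B|.
  by rewrite {1}PE sum_disjU.
have F1 : 0 < #|F| by rewrite card_gt0.
have F3 : 3 <= #|F|.
  have /card_gt0P[B BF] := F1; have BP := subsetP FP _ BF.
  have ni : (cp B).1 != i0 by move: BF; rewrite inE => /andP[].
  have sub : pts B :&: \bigcup_(B' in Ps | B' != B) pts B' \subset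
      (pts B :&: ptsU C) :|: \bigcup_(B' in F :\ B) (pts B :&: pts B').
    apply/subsetP => x /setIP[xB /bigcupP[B' /andP[BP' ne] xB']].
    rewrite in_setU in_setI xB /=; have [i'|i'] := eqVneq (cp B').1 i0.
      by apply/orP; left; apply/bigcupP; exists B'; rewrite // inE BP' i' eqxx.
    apply/orP; right; apply/bigcupP; exists B'; first by rewrite !inE ne BP' i'.
    by rewrite inE xB.
  have := leq_trans (core_ge3 BP) (subset_leq_card sub).
  have [le _] := leq_card_setU (pts B :&: ptsU C) (\bigcup_(B' in F :\ B) (pts B :&: pts B')).
  have le1 := foreign_meet BF.
  have le2 : #|\bigcup_(B' in F :\ B) (pts B :&: pts B')| <= #|F :\ B|.
    apply: leq_trans (card_bigcup_leq _ _) _; rewrite -sum1_card; apply: leq_sum => B'.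
    rewrite in_setD1 => /andP[ne BF']; apply: (cf_pair cf) => //; last by rewrite eq_sym.
    exact: (subsetP FP).
  have := cardsD1 B F; rewrite BF; move: le le1 le2.
  move: #|_ :|: _| #|_ :&: _| #|\bigcup_(B' in _) _| #|F| #|_ :\ _|; clear => *; lia.
have UP : ptsU Ps = ptsU C :|: ptsU F by rewrite /ptsU PE bigcup_setU.
have cI : #|ptsU C :&: ptsU F| <= #|F|.
  apply: leq_trans (_ : #|\bigcup_(B in F) (pts B :&: ptsU C)| <= _).
    apply: subset_leq_card; apply/subsetP => x /setIP[xC /bigcupP[B BF xB]].
    by apply/bigcupP; exists B; rewrite // inE xB.
  apply: leq_trans (card_bigcup_leq _ _) _; rewrite -sum1_card.
  by apply: leq_sum => B; apply: foreign_meet.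
have hC := cf_part cf CP; have hF := cf_part cf FP.
have hA := cf_all cf; have hE := cf_edges cf.
have lC := card_le_edges CP; have lF := card_le_edges FP.
have := cardsUI (ptsU C) (ptsU F); rewrite -UP => hU.
have [F4 EF UI UF] : [/\ #|F| = 4, \sum_(B in F) #|es B| = 4, #|ptsU C :&: ptsU F| = 4 &
    #|ptsU F| = 7].
  move: cP sP F3 C2 cI hC hF hA hE lC lF hU; clear.
  move: #|Ps| #|C| #|F| (\sum_(B in Ps) _) (\sum_(B in C) _) (\sum_(B in F) _).
  move: #|ptsU Ps| #|ptsU C| #|ptsU F| #|_ :&: _|; clear => *; split; lia.
pose Z := ptsU F :\: ptsU C.
have cZ : #|Z| = 3.
  have := cardsID (ptsU C) (ptsU F); rewrite setIC UI UF -/Z; move: #|Z|; clear; lia.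
have es1 B : B \in F -> #|es B| = 1.
  move=> BF; have := @big_setD1 _ _ addn _ B F (fun B => #|es B|) BF; rewrite /= EF.
  have := card_le_edges (subset_trans (subsetDl F [set B]) FP).
  have := cardsD1 B F; rewrite BF F4; have := cf_pos cf (subsetP FP _ BF).
  by move: #|es B| (\sum_(B in _ :\ _) _) #|_ :\ _|; clear => *; lia.
have sZ B : B \in F -> pts B :\: ptsU C \subset Z.
  by move=> BF; apply: setSD; apply: bigcup_sup.
have ge2 B : B \in F -> 2 <= #|pts B :\: ptsU C|.
  move=> BF; have := cardsID (ptsU C) (pts B); have := foreign_meet BF.
  rewrite card_pts ?(subsetP FP) // es1 //.
  by move: #|_ :&: _| #|_ :\: _|; clear; lia.
have inj : {in F &, injective (fun B => pts B :\: ptsU C)}.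
  move=> B B' BF BF' e; apply/eqP/negPn/negP => ne.
  have := cf_pair cf (subsetP FP _ BF) (subsetP FP _ BF') ne.
  rewrite leqNgt => /negP; apply; apply: leq_trans (ge2 B BF) (subset_leq_card _).
  by rewrite subsetI subsetDl e subsetDl.
have eq2 B : B \in F -> #|pts B :\: ptsU C| = 2.
  move=> BF; apply/eqP; rewrite eqn_leq ge2 // andbT leqNgt; apply/negP => c3.
  have eZ : pts B :\: ptsU C = Z by apply/eqP; rewrite eqEcard sZ // cZ.
  have [B' BF' ne] : exists2 B', B' \in F & B != B'.
    have /card_gt1P[a [b [aF bF ab]]] : 1 < #|F| by rewrite F4.
    by have [Ba|Ba] := eqVneq B a; [exists b; rewrite // Ba|exists a].
  have := cf_pair cf (subsetP FP _ BF) (subsetP FP _ BF') ne.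
  rewrite leqNgt => /negP; apply; apply: leq_trans (ge2 B' BF') (subset_leq_card _).
  rewrite subsetI subsetDl andbT (subset_trans (sZ B' BF')) // -eZ; exact: subsetDl.
have : #|[set pts B :\: ptsU C | B in F]| <= 'C(#|Z|, 2).
  rewrite -cards_draws; apply: subset_leq_card; apply/subsetP => A /imsetP[B BF ->].
  by rewrite inE sZ // eq2.
by rewrite (card_in_imset inj) F4 cZ.
Qed.

End MixedClasses.
End Bodies.

(** * Degenerate line configurations *)

Section LineAlgebra.
Import GRing.Theory Num.Theory.
Local Open Scope ring_scope.
Variable W : zmodType.
Hypothesis tf : torsion_free W.
Implicit Types (a b x y w : W) (s t u v z : int).

Lemma torsion_int w z : (0 < `|z| <= 10000)%N -> w *~ z = 0 -> w = 0.
Proof.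
move=> hz h; apply: (tf hz); rewrite -[w *+ _]/(w *~ `|z|%N%:Z) abszE.
case: (ger0P z) => // _; by rewrite mulrNz h oppr0.
Qed.

Lemma line_third a b s t v :
  (a *~ v + b) *~ (s - t) = (a *~ s + b) *~ (v - t) + (a *~ t + b) *~ (s - v).
Proof.
rewrite !mulrzDl -!mulrzA addrACA -!mulrzDr; congr (_ *~ _ + _ *~ _); ring.
Qed.

Lemma line_diff a b a' b' s : a *~ s + b = a' *~ s + b' -> (a - a') *~ s = b' - b.
Proof.
move=> /(congr1 (fun x => x - a' *~ s - b)); rewrite addrAC addrK mulrzBl => ->.
by rewrite (addrC _ b') addrK.
Qed.

Lemma two_lines a b a' b' s v : a *~ s + b = a' *~ s + b' ->
  a *~ v + b = a' *~ v + b' -> (0 < `|s - v| <= 10000)%N -> a = a' /\ b = b'.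
Proof.
move=> e1 e2 h; have ea : a = a'.
  apply/eqP; rewrite -subr_eq0; apply/eqP/(torsion_int h).
  by rewrite mulrzBr (line_diff e1) (line_diff e2) subrr.
by split=> //; move: e1; rewrite ea => /addrI.
Qed.

(** Measured from the third line, the first vanishes at [t], the second at [v], and they agree at
    [s]. *)
Lemma line_join a b a' b' a0 b0 s t v : a *~ s + b = a' *~ s + b' ->
  a *~ t + b = a0 *~ t + b0 -> a' *~ v + b' = a0 *~ v + b0 ->
  (a - a0) *~ (s - t) = (a' - a0) *~ (s - v).
Proof.
move=> e1 e2 e3; rewrite !mulrzBr (line_diff e2) (line_diff e3).
have -> : (a - a0) *~ s = (a' - a0) *~ s + (b' - b).
  rewrite -(line_diff e1) -mulrzDl; congr (_ *~ _).
  by rewrite [RHS]addrC addrA subrK.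
rewrite -addrA; congr (_ + _); rewrite !opprB.
by rewrite addrA subrK.
Qed.

Lemma scale_eq x y s t v : x *~ s = y *~ t -> x *~ (s * v) = y *~ (t * v).
Proof. by move=> e; rewrite !mulrzA e. Qed.

Definition pasch_det (s12 s13 s14 s23 s24 s34 : int) : int :=
  (s12 - s14) * (s23 - s24) * (s13 - s34) - (s12 - s24) * (s23 - s34) * (s13 - s14).

Lemma pasch_lines (a1 b1 a2 b2 a3 b3 a4 b4 : W) (s12 s13 s14 s23 s24 s34 : int) :
  a1 *~ s12 + b1 = a2 *~ s12 + b2 -> a1 *~ s13 + b1 = a3 *~ s13 + b3 ->
  a1 *~ s14 + b1 = a4 *~ s14 + b4 -> a2 *~ s23 + b2 = a3 *~ s23 + b3 ->
  a2 *~ s24 + b2 = a4 *~ s24 + b4 -> a3 *~ s34 + b3 = a4 *~ s34 + b4 ->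
  (0 < `|pasch_det s12 s13 s14 s23 s24 s34| <= 10000)%N -> a1 = a4.
Proof.
move=> e12 e13 e14 e23 e24 e34 h; apply/eqP; rewrite -subr_eq0; apply/eqP/(torsion_int h).
have h12 := line_join e12 e14 e24.
have h23 := line_join e23 e24 e34.
have h13 := line_join e13 e14 e34.
have k12 := scale_eq ((s23 - s24) * (s13 - s34)) h12.
have k23 := scale_eq ((s12 - s24) * (s13 - s34)) h23.
have k13 := scale_eq ((s12 - s24) * (s23 - s34)) h13.
rewrite mulrzBr -[_ * _ * (s13 - s34)]mulrA k12 [(s12 - s24) * _]mulrCA k23.
rewrite [(s12 - s24) * (s23 - s34) * _]mulrC k13.
by apply/eqP; rewrite subr_eq0; apply/eqP; congr (_ *~ _); ring.
Qed.

Lemma third_diff x y x' y' (al be : int) : x *~ al + y *~ be = x' *~ al + y' *~ be ->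
  (x - x') *~ al = (y' - y) *~ be.
Proof. by move=> /line_diff ->; rewrite mulrzBl. Qed.

Lemma cyclic_sum (x y z : W) : (y - x) + (z - y) + (x - z) = 0.
Proof. by rewrite [y - x + _]addrC subrKA subrKA subrr. Qed.

Definition grid_det (al0 al1 al2 be0 be1 be2 : int) : int :=
  al0 * be1 * be2 + be0 * al1 * be2 + be0 * be1 * al2.

(** The three differences of the [y] are proportional to x - x' and sum to zero around the cycle. *)
Lemma grid23_lines (x x' y0 y1 y2 : W) (al0 al1 al2 be0 be1 be2 : int) :
  x *~ al0 + y0 *~ be0 = x' *~ al0 + y1 *~ be0 ->
  x *~ al1 + y1 *~ be1 = x' *~ al1 + y2 *~ be1 ->
  x *~ al2 + y2 *~ be2 = x' *~ al2 + y0 *~ be2 ->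
  (0 < `|grid_det al0 al1 al2 be0 be1 be2| <= 10000)%N -> x = x'.
Proof.
move=> /third_diff e0 /third_diff e1 /third_diff e2 h.
apply/eqP; rewrite -subr_eq0; apply/eqP/(torsion_int h).
have -> : grid_det al0 al1 al2 be0 be1 be2 =
  al0 * (be1 * be2) + al1 * (be0 * be2) + al2 * (be0 * be1) by rewrite /grid_det; ring.
rewrite !mulrzDr (mulrzA _ al0) (mulrzA _ al1) (mulrzA _ al2) e0 e1 e2 -!mulrzA.
have -> : be1 * (be0 * be2) = be0 * (be1 * be2) by ring.
have -> : be2 * (be0 * be1) = be0 * (be1 * be2) by ring.
by rewrite -!mulrzDl cyclic_sum mul0rz.
Qed.

Definition hexagon_det (al be al' be' : int) : int :=
  (al' * be) ^+ 3 - (al * be') ^+ 3.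

(** Consecutive differences of the [x] satisfy m d = k d', and after three steps they return, so m^3
    - k^3 kills them. If m = k they are equal with sum zero, hence killed by 3. *)
Lemma hexagon_lines (x0 x1 x2 y0 y1 y2 : W) (al be al' be' : int) :
  x0 *~ al + y0 *~ be = x1 *~ al + y1 *~ be ->
  x1 *~ al + y1 *~ be = x2 *~ al + y2 *~ be ->
  x0 *~ al' + y1 *~ be' = x1 *~ al' + y2 *~ be' ->
  x1 *~ al' + y2 *~ be' = x2 *~ al' + y0 *~ be' ->
  (0 < `|(al' * be)%R| <= 10000)%N ->
  ((al' * be == al * be') || (0 < `|hexagon_det al be al' be'| <= 10000)%N) -> x0 = x1.
Proof.
move=> e01 e12 f01 f12; rewrite /hexagon_det; set m := al' * be; set k := al * be' => hm hmk.
have step (x y x' y' z z' : W) : x *~ al' + y *~ be' = x' *~ al' + y' *~ be' ->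
    z *~ al + y *~ be = z' *~ al + y' *~ be -> (x - x') *~ m = (z - z') *~ k.
  move=> /third_diff h1 /third_diff h2.
  by rewrite /m /k (scale_eq be h1) (scale_eq be' h2) mulrC.
have d0 : (x0 - x1) *~ m = (x1 - x2) *~ k by apply: (step _ y1 _ y2).
have d1 : (x1 - x2) *~ m = (x2 - x0) *~ k.
  by apply: (step _ y2 _ y0) => //; rewrite e01 e12.
have d2 : (x2 - x0) *~ m = (x0 - x1) *~ k.
  by apply: (step _ y0 _ y1) => //; rewrite -f12 -f01.
apply/eqP; rewrite -subr_eq0; apply/eqP.
case: eqP hmk => [mk _|_ /= hmk]; last first.
  apply: (torsion_int hmk); rewrite mulrzBr; apply/eqP; rewrite subr_eq0; apply/eqP.
  have k0 := scale_eq (m * m) d0; have k1 := scale_eq (k * m) d1.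
  have k2 := scale_eq (k * k) d2.
  transitivity ((x0 - x1) *~ (m * (m * m))); first by congr (_ *~ _); ring.
  rewrite k0; transitivity ((x1 - x2) *~ (m * (k * m))); first by congr (_ *~ _); ring.
  rewrite k1; transitivity ((x2 - x0) *~ (m * (k * k))); first by congr (_ *~ _); ring.
  by rewrite k2; congr (_ *~ _); ring.
have tm w w' : w *~ m = w' *~ m -> w = w'.
  move=> h; apply/eqP; rewrite -subr_eq0; apply/eqP/(torsion_int hm).
  by rewrite mulrzBl h subrr.
move: d0 d1; rewrite -mk => /tm d0 /tm d1.
apply: (@torsion_int _ 3) => //.
have -> : (x0 - x1) *~ 3 = (x0 - x1) + (x1 - x2) + (x2 - x0).
  by rewrite -d1 -d0 -[3]/(1 + 1 + 1 : int) !mulrzDr !mulr1z.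
by rewrite !subrKA subrr.
Qed.

End LineAlgebra.

(** * The determinants of the five slopes *)

Section ColourDeterminants.
Local Open Scope ring_scope.

Definition slopez (c : nat) : int := (cslope c)%:Z.
Definition all_colours (P : nat -> bool) : bool := all P (iota 0 5).
Definition det_ok (z : int) : bool := (0 < `|z| <= 10000)%N.

Lemma all_coloursP P c : all_colours P -> (c < 5)%N -> P c.
Proof. by move=> /allP h c5; apply: h; rewrite mem_iota. Qed.

Lemma slope_colours : all_colours (fun c => all_colours (fun d => (c != d) ==> det_ok (slopez c - slopez d))).
Proof. by vm_compute. Qed.

(** Meeting points on a common line have distinct colours; opposite points, such as 12 and 34, may
    share one. *)
Lemma pasch_colours :
  all_colours (fun c12 => all_colours (fun c13 => (c12 == c13) || all_colours (fun c14 =>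
    (c12 == c14) || (c13 == c14) || all_colours (fun c23 => (c12 == c23) || (c13 == c23) ||
    all_colours (fun c24 => (c12 == c24) || (c14 == c24) || (c23 == c24) || all_colours (fun c34 =>
    (c13 == c34) || (c14 == c34) || (c23 == c34) || (c24 == c34) ||
    det_ok (pasch_det (slopez c12) (slopez c13) (slopez c14) (slopez c23) (slopez c24) (slopez c34)))))))).
Proof. by vm_compute. Qed.

Lemma grid_colours :
  all_colours (fun r => all_colours (fun s => (r == s) || all_colours (fun l0 => (r == l0) || (s == l0) ||
    all_colours (fun l1 => (r == l1) || (s == l1) || all_colours (fun l2 => (r == l2) || (s == l2) ||
    ((l0 != l1) && (l1 != l2) && (l0 != l2)) ||
    det_ok (grid_det (slopez l0 - slopez s) (slopez l1 - slopez s) (slopez l2 - slopez s)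
                     (slopez r - slopez l0) (slopez r - slopez l1) (slopez r - slopez l2))))))).
Proof. by vm_compute. Qed.

Lemma hexagon_colours :
  all_colours (fun r => all_colours (fun s => (r == s) || all_colours (fun l => (r == l) || (s == l) ||
    all_colours (fun l' => (r == l') || (s == l') ||
    let al := slopez l - slopez s in let be := slopez r - slopez l in
    let al' := slopez l' - slopez s in let be' := slopez r - slopez l' in
    det_ok (al' * be) && ((al' * be == al * be') || det_ok (hexagon_det al be al' be')))))).
Proof. by vm_compute. Qed.

End ColourDeterminants.

Lemma card3P (T : finType) (A : {set T}) : #|A| = 3 ->
  exists a b c, [/\ a != b, a != c, b != c & A = [set a; b; c]].
Proof.
move=> cA; have /card_gt2P[a [b [c [[aA bA cA'] [ab bc ca]]]]] : 2 < #|A| by rewrite cA.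
exists a, b, c; split=> //; first by rewrite eq_sym.
apply/eqP; rewrite eq_sym eqEcard cA cards3 // 1?eq_sym // andbT.
by apply/subsetP => x; rewrite !inE -orbA => /or3P[]/eqP->.
Qed.

(** Every fibre has two elements or an element of [D]. *)
Lemma card_fibres (T U : finType) (f : T -> U) (A D : {set T}) :
  {in A, forall x, x \notin D -> exists y, [/\ y \in A, y != x & f y = f x]} ->
  2 * #|f @: A| <= #|A| + #|D :&: A|.
Proof.
move=> h; rewrite -!sum1_card (partition_big_imset f) /= big_distrr /=.
rewrite [X in _ <= _ + X](partition_big f (mem (f @: A))) /=; last first.
  by move=> x; rewrite inE => /andP[_ xA]; apply: imset_f.
rewrite -big_split /=; apply: leq_sum => u /imsetP[x xA ->].
rewrite muln1 !sum1_card.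
have [xD|xD] := boolP (x \in D).
  have h1 : 0 < #|[pred y in A | f y == f x]|.
    by apply/card_gt0P; exists x; rewrite !inE xA eqxx.
  have h2 : 0 < #|[pred y in D :&: A | f y == f x]|.
    by apply/card_gt0P; exists x; rewrite !inE xA xD eqxx.
  by rewrite (leq_add h1 h2).
have [y [yA yx fy]] := h x xA xD; apply: (@leq_trans #|[pred y in A | f y == f x]|).
  by apply/card_gt1P; exists x, y; rewrite !inE xA yA fy eqxx eq_sym.
exact: leq_addr.
Qed.

(** * Blocks over a single index *)

Section SameClass.
Import GRing.Theory.
Variables (I L Y body : finType) (W : zmodType) (da db : L -> W).
Variable pl : I * L -> gvert -> Y.
Variables (Ps : {set body}) (cp : body -> I * L) (es : body -> {set {set gvert}}).
Hypotheses (inc : incidence da db pl) (cf : config pl Ps cp es).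
Variable i0 : I.
Hypothesis same : {in Ps, forall B, (cp B).1 = i0}.
Implicit Types (B X Z : body).
Local Notation labels := (labels es).
Local Notation pts := (pts pl cp es).
Local Notation ptsU := (ptsU pl cp es).

Definition row B : L := (cp B).2.
Definition ev B (u : gvert) : W := leval da db (row B) u.
Definition share B X (u : gvert) := [&& u \in labels B, u \in labels X & ev B u == ev X u].
Definition core B := [set u in labels B | [exists X in Ps, (X != B) && share B X u]].

Lemma evE B u : ev B u = (da (row B) *~ slopez (gcol u) + db (row B))%R.
Proof. by []. Qed.

Lemma cpE B : B \in Ps -> cp B = (i0, row B).
Proof. by move=> /same <-; rewrite /row; case: (cp B). Qed.

Lemma pl_eq B X u v : B \in Ps -> X \in Ps ->
  pl (cp B) u = pl (cp X) v <-> u = v /\ ev B u = ev X u.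
Proof. by move=> BP XP; rewrite !cpE //; apply: (inc_same inc). Qed.

Lemma shareC B X u : share B X u = share X B u.
Proof. by rewrite /share eq_sym andbCA. Qed.

Lemma share_trans B X Z u : share B X u -> share X Z u -> share B Z u.
Proof.
move=> /and3P[uB uX /eqP e] /and3P[_ uZ /eqP e'].
by apply/and3P; split=> //; rewrite e e'.
Qed.

Lemma share_uniq B X u v : B \in Ps -> X \in Ps -> B != X ->
  share B X u -> share B X v -> u = v.
Proof.
move=> BP XP ne /and3P[uB uX /eqP eu] /and3P[vB vX /eqP ev'].
apply/eqP/negPn/negP => uv; have := cf_pair cf BP XP ne; rewrite leqNgt => /negP; apply.
have inp w : w \in labels B -> w \in labels X -> ev B w = ev X w ->
    pl (cp B) w \in pts B :&: pts X.
  move=> wB wX e; rewrite inE imset_f //=; apply/imsetP; exists w => //.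
  by apply/pl_eq.
apply/card_gt1P; exists (pl (cp B) u), (pl (cp B) v); split; [exact: inp|exact: inp|].
by rewrite (inj_eq (pl_inj inc (c:=cp B))).
Qed.

Lemma coreP B u : u \in core B -> exists X, [/\ X \in Ps, X != B & share B X u].
Proof. by rewrite inE => /andP[_ /exists_inP[X XP /andP[XB h]]]; exists X. Qed.

Lemma core_card B : B \in Ps -> 3 <= #|core B|.
Proof.
move=> BP; apply: leq_trans (core_ge3 inc cf BP) _.
rewrite -(card_imset _ (pl_inj inc (c := cp B))); apply: subset_leq_card.
apply/subsetP => x /setIP[/imsetP[u uB ->] /bigcupP[X /andP[XP ne] /imsetP[v vX]]].
move=> /(pl_eq _ _ BP XP)[uv e]; apply: imset_f.
rewrite inE uB; apply/exists_inP; exists X => //.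
by rewrite ne /share uB uv vX -uv e eqxx.
Qed.

Lemma core_sub B : core B \subset labels B.
Proof. by apply/subsetP => u; rewrite inE => /andP[]. Qed.

Lemma join_col B u v : B \in Ps -> u \in labels B -> v \in labels B -> u != v ->
  gcol u != gcol v.
Proof. by move=> BP uB vB uv; apply: gjoin_col; apply: (labels_join cf BP). Qed.

(** Two parts share at most one label, so each part of [Q] accounts for at most one of the at least
    three core labels. *)
Lemma core_leq B (Q : {set body}) : B \in Ps -> Q \subset Ps :\ B ->
  (forall u, u \in core B -> exists2 X, X \in Q & share B X u) -> 3 <= #|Q|.
Proof.
move=> BP sQ h; apply: leq_trans (core_card BP) _.
apply: leq_trans (_ : #|\bigcup_(X in Q) [set u | share B X u]| <= _).
  apply: subset_leq_card; apply/subsetP => u /h[X XQ sh]; apply/bigcupP.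
  by exists X; rewrite ?inE.
apply: leq_trans (card_bigcup_leq _ _) _; rewrite -sum1_card; apply: leq_sum => X XQ.
have := subsetP sQ _ XQ; rewrite !inE => /andP[ne XP].
rewrite leqNgt; apply/negP => /card_gt1P[u [v []]]; rewrite !inE => su sv /negP; apply.
by apply/eqP; apply: share_uniq su sv; rewrite // eq_sym.
Qed.

(** * Four parts *)

Section FourBodies.
Hypothesis four : #|Ps| = 4.

Lemma four_share B X : B \in Ps -> X \in Ps -> X != B -> exists u, share B X u.
Proof.
move=> BP XP ne; have [/existsP//|/existsPn no] := boolP [exists u, share B X u].
have := @core_leq B (Ps :\ B :\ X) BP (subsetDl _ _).
have := cardsD1 B Ps; have := cardsD1 X (Ps :\ B); rewrite BP !inE ne XP four.
move: #|_ :\ X| #|_ :\ B| => m n h1 h2 h; suff : 3 <= m by move: h1 h2; clear; lia.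
apply: h => u /coreP[Z [ZP ZB sh]]; exists Z => //; rewrite !inE ZB ZP !andbT.
by apply: contraL sh => /eqP->.
Qed.

Lemma four_distinct B X Z u v : B \in Ps -> X \in Ps -> Z \in Ps -> X != B -> Z != B ->
  X != Z -> share B X u -> share B Z v -> u != v.
Proof.
move=> BP XP ZP XB ZB XZ su sv; apply/negP => /eqP uv.
have := @core_leq B (Ps :\ B :\ X) BP (subsetDl _ _).
have := cardsD1 B Ps; have := cardsD1 X (Ps :\ B); rewrite BP !inE XB XP four.
move: #|_ :\ X| #|_ :\ B| => m n h1 h2 h; suff : 3 <= m by move: h1 h2; clear; lia.
apply: h => w /coreP[T [TP TB sh]].
have [TX|TX] := eqVneq T X; last by exists T; rewrite ?inE ?TX ?TB.
exists Z; first by rewrite !inE eq_sym XZ ZB.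
have wu : w = u by apply: share_uniq BP XP _ _ su; rewrite 1?eq_sym // -TX.
by rewrite wu uv.
Qed.

(** Any two of the four parts meet, and the three meeting points on a part are distinct: a Pasch
    configuration of lines. *)
Lemma four_rows B X : B \in Ps -> X \in Ps -> row B = row X.
Proof.
move=> B4P B1P; have [->//|ne] := eqVneq B X; move: ne; set B4 := B; set B1 := X => n14.
have : #|Ps :\ B4 :\ B1| = 2.
  have := cardsD1 B4 Ps; have := cardsD1 B1 (Ps :\ B4).
  by rewrite B4P !inE eq_sym n14 B1P four; clear; lia.
move=> /eqP/cards2P[B2 [B3 [n23 e]]].
have : B2 \in Ps :\ B4 :\ B1 by rewrite e !inE eqxx.
rewrite !inE => /and3P[n21 n24 B2P].
have : B3 \in Ps :\ B4 :\ B1 by rewrite e !inE eqxx orbT.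
rewrite !inE => /and3P[n31 n34 B3P].
have [u12 s12] := four_share B1P B2P n21.
have [u13 s13] := four_share B1P B3P n31.
have [u14 s14] := four_share B1P B4P n14.
have n32 : B3 != B2 by rewrite eq_sym.
have [u23 s23] := four_share B2P B3P n32.
have n42 : B4 != B2 by rewrite eq_sym.
have n43 : B4 != B3 by rewrite eq_sym.
have n41 : B1 != B4 by rewrite eq_sym.
have n12 : B1 != B2 by rewrite eq_sym.
have n13 : B1 != B3 by rewrite eq_sym.
have [u24 s24] := four_share B2P B4P n42.
have [u34 s34] := four_share B3P B4P n43.
have t12 := s12; have t13 := s13; have t14 := s14; have t23 := s23.
have t24 := s24; have t34 := s34.
rewrite shareC in t12; rewrite shareC in t13; rewrite shareC in t14.
rewrite shareC in t23; rewrite shareC in t24; rewrite shareC in t34.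
have col D X1 X2 u v : D \in Ps -> X1 \in Ps -> X2 \in Ps -> X1 != D -> X2 != D -> X1 != X2 ->
    share D X1 u -> share D X2 v -> (gcol u == gcol v) = false.
  move=> DP X1P X2P n1 n2 nn su sv; apply/negbTE; apply: (join_col DP).
  - by case/and3P: su.
  - by case/and3P: sv.
  - exact: four_distinct su sv.
have h := all_coloursP (all_coloursP pasch_colours (gcol_lt u12)) (gcol_lt u13).
rewrite (col B1 B2 B3) //= in h; have {}h := all_coloursP h (gcol_lt u14).
rewrite (col B1 B2 B4) //= (col B1 B3 B4) //= in h.
have {}h := all_coloursP h (gcol_lt u23).
rewrite (col B2 B1 B3) //= (col B3 B1 B2) //= in h.
have {}h := all_coloursP h (gcol_lt u24).
rewrite (col B2 B1 B4) //= (col B4 B1 B2) //= (col B2 B3 B4) //= in h.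
have {}h := all_coloursP h (gcol_lt u34).
rewrite (col B3 B1 B4) //= (col B4 B1 B3) //= (col B3 B2 B4) //= (col B4 B2 B3) //= in h.
have eqv D D' u : share D D' u -> 
    (da (row D) *~ slopez (gcol u) + db (row D) = da (row D') *~ slopez (gcol u) + db (row D'))%R.
  by case/and3P => _ _ /eqP; rewrite !evE.
have ea : da (row B1) = da (row B4).
  exact: (pasch_lines (inc_torsion inc) (eqv _ _ _ s12) (eqv _ _ _ s13) (eqv _ _ _ s14)
    (eqv _ _ _ s23) (eqv _ _ _ s24) (eqv _ _ _ s34) h).
apply/esym; apply: (inc_line inc) => //.
by move: (eqv _ _ _ s14); rewrite ea => /addrI.
Qed.

End FourBodies.

(** * Five or six parts: the grid of a frame *)

Section Frames.
Hypothesis five : 4 < #|Ps|.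
Let E := \bigcup_(B in Ps) es B.

Lemma edge_used B e : B \in Ps -> e \in es B -> e \in E.
Proof. by move=> BP eB; apply/bigcupP; exists B. Qed.

Lemma frame_swap r s a b : frame E r s a b -> frame E s r a b.
Proof.
move=> [[e eE re] h /and3P[rs ra sa] /andP[rb sb]].
have sw c : [set r; s; c] = [set s; r; c] by rewrite (setUC [set r]).
split.
- by exists e => //; case: (h e eE (or_introl re)) => ->; rewrite !inE eqxx ?orbT.
- move=> e' e'E or; rewrite -!sw; apply: h => //; tauto.
- by rewrite gjoinC rs ra sa.
- by rewrite rb sb.
Qed.

Lemma frame_third r s a b : frame E r s a b -> frame E r s b a.
Proof.
move=> [h1 h2 /and3P[rs ra sa] /andP[rb sb]]; split=> //.
- by move=> e eE h; have [|] := h2 e eE h; tauto.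
- by rewrite rs rb sb.
- by rewrite ra sa.
Qed.

Lemma frame_neq r s a b : frame E r s a b ->
  [/\ r != s, r != a, s != a, r != b & s != b].
Proof. by move=> [_ _ /and3P[rs ra sa] /andP[rb sb]]; split; apply: gjoin_neq. Qed.

Lemma frame_rs r s a b B : frame E r s a b -> B \in Ps -> r \in labels B -> s \in labels B.
Proof.
move=> [_ h _ _] BP /bigcupP[e eB re]; apply/bigcupP; exists e => //.
by case: (h e (edge_used BP eB) (or_introl re)) => ->; rewrite !inE eqxx ?orbT.
Qed.

Lemma edges_le2 B : B \in Ps -> #|es B| <= 2.
Proof.
move=> BP; have := edges_rest es BP; have := card_le_edges cf (subsetDl Ps [set B]).
have := cardsD1 B Ps; rewrite BP; have := cf_edges cf; move: five.
by move: #|Ps| #|Ps :\ B| #|es B| (\sum_(B in _) _) (\sum_(B in Ps :\ _) _); clear => *; lia.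
Qed.

Lemma two_edges_uniq : #|[set B in Ps | #|es B| == 2]| + #|Ps| <= 6.
Proof.
apply: leq_trans (cf_edges cf); rewrite -!sum1_card.
rewrite (eq_bigl (fun B => (B \in Ps) && (#|es B| == 2))); last by move=> B; rewrite inE.
rewrite big_mkcondr -big_split /=; apply: leq_sum => B BP.
by have := cf_pos cf BP; case: eqP => [->|_] // h; rewrite add0n.
Qed.

Lemma card_le6 : #|Ps| <= 6.
Proof. exact: leq_trans (card_le_edges cf (subxx _)) (cf_edges cf). Qed.

Lemma frame_single r s a b B : frame E r s a b -> B \in Ps -> #|es B| = 1 ->
  r \in labels B -> labels B = [set r; s; a] \/ labels B = [set r; s; b].
Proof.
move=> [_ h _ _] BP /eqP/cards1P[e eB]; rewrite /labels eB cover1 => re.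
by apply: h; [apply: (edge_used BP); rewrite eB inE|left].
Qed.

(** If one of two edges avoided [r] and [s], it would meet the other in at most one vertex, and the
    part would have five labels instead of four. *)
Lemma frame_labels r s a b B : frame E r s a b -> B \in Ps -> r \in labels B ->
  labels B \subset [set r; s; a; b].
Proof.
move=> F BP rB; have [rs ra sa rb sb] := frame_neq F.
have le2 := edges_le2 BP; have pos := cf_pos cf BP.
have [h|h] := ltnP #|es B| 2.
  have e1 : #|es B| = 1 by move: h pos; clear; lia.
  have [->|->] := frame_single F BP e1 rB; apply/subsetP => x; rewrite !inE.
    by move=> ->.
  by case/orP => ->; rewrite ?orbT.
have e2 : #|es B| = 2 by apply/eqP; rewrite eqn_leq le2.
have [_ he _ _] := F.
have sub e : e \in es B -> (r \in e) || (s \in e) -> e \subset [set r; s; a; b].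
  move=> eB /orP/(he e (edge_used BP eB))[]->; apply/subsetP => x; rewrite !inE.
    by move=> ->.
  by case/orP => ->; rewrite ?orbT.
have [/forall_inP all|] := boolP [forall e in es B, (r \in e) || (s \in e)].
  by apply/bigcupsP => e eB; apply: sub => //; apply: all.
rewrite negb_forall_in => /exists_inP[f fB]; rewrite negb_or => /andP[rf sf].
have /bigcupP[e eB re] := rB.
have ef : e != f by apply: contraL re => /eqP->.
have eE : es B = [set e; f].
  by apply/esym/eqP; rewrite eqEcard cards2 ef e2 subset_set2 eB fB.
have [h3 _ _] := gadget_sparse.
have ce : #|e| = 3 by apply: h3; apply: (subsetP (cf_sub cf BP)).
have cf' : #|f| = 3 by apply: h3; apply: (subsetP (cf_sub cf BP)).
have := cf_card cf BP; rewrite /labels eE cover2 cards2 ef.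
have := cardsUI e f; rewrite ce cf'.
suff : #|e :&: f| <= 1 by move: #|_ :&: _| #|_ :|: _|; clear; lia.
have [c ec] : exists c, e = [set r; s; c].
  by case: (he e (edge_used BP eB) (or_introl re)) => ->; [exists a|exists b].
apply: (@leq_trans #|[set c]|); last by rewrite cards1.
apply: subset_leq_card; apply/subsetP => x; rewrite ec !inE.
by case/andP => /orP[/orP[]|] /eqP -> //; rewrite ?(negbTE rf) ?(negbTE sf).
Qed.

Lemma single_core B : B \in Ps -> #|es B| = 1 -> core B = labels B.
Proof.
move=> BP e1; apply/eqP; rewrite eqEcard core_sub /=.
by rewrite (cf_card cf BP) e1 core_card.
Qed.

Definition through r := [set B in Ps | r \in labels B].
Definition at_label r := (fun B => pl (cp B) r) @: through r.

Lemma frame_through r s a b : frame E r s a b -> through r = through s.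
Proof.
move=> F; apply/setP => B; rewrite !inE; case: (boolP (B \in Ps)) => //= BP.
by apply/idP/idP; [apply: frame_rs F BP|apply: frame_rs (frame_swap F) BP].
Qed.

Lemma through_gt0 r s a b : frame E r s a b -> 0 < #|through r|.
Proof.
move=> [[e /bigcupP[B BP eB] re] _ _ _]; apply/card_gt0P; exists B.
by rewrite inE BP; apply/bigcupP; exists e.
Qed.

(** A lone remaining part would share its labels only with parts through [r], so its core would lie
    in the two labels [a] and [b]. *)
Lemma rest_neq1 r s a b : frame E r s a b -> #|through r| + 1 != #|Ps|.
Proof.
move=> F; apply/negP => /eqP e.
have : #|Ps :\: through r| = 1.
  have sub : through r \subset Ps by apply/subsetP => B; rewrite inE => /andP[].
  by rewrite -(cardsID (through r) Ps) (setIidPr sub) in e; move: e; clear; lia.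
move=> /eqP/cards1P[B eB]; have : B \in Ps :\: through r by rewrite eB inE.
rewrite !inE; case: (boolP (B \in Ps)) => [BP|]; rewrite ?andbF //= andbT => rB.
have sB : s \notin labels B by apply: contra rB; apply: frame_rs (frame_swap F) BP.
have := core_card BP; rewrite ltnNge => /negP; apply.
apply: leq_trans (_ : #|[set a; b]| <= _); last by rewrite cards2; case: eqP.
apply: subset_leq_card; apply/subsetP => u uB.
have ul := subsetP (core_sub B) _ uB.
have [X [XP XB /and3P[_ uX _]]] := coreP uB.
have rX : r \in labels X.
  apply/negPn/negP => rX; have : X \in Ps :\: through r by rewrite !inE XP rX.
  by rewrite eB inE (negbTE XB).
have := subsetP (frame_labels F XP rX) _ uX; rewrite !inE -!orbA => /or4P[] h.
- by rewrite (eqP h) (negbTE rB) in ul.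
- by rewrite (eqP h) (negbTE sB) in ul.
- by rewrite h.
- by rewrite h orbT.
Qed.

Lemma through_rs r s a b B X : frame E r s a b -> B \in through r -> X \in through r ->
  ev B r = ev X r -> ev B s = ev X s -> B = X.
Proof.
move=> F; rewrite !inE => /andP[BP rB] /andP[XP rX] er ees.
have [rs _ _ _ _] := frame_neq F; apply/eqP/negPn/negP => ne.
have sB := frame_rs F BP rB; have sX := frame_rs F XP rX.
have := @share_uniq B X r s BP XP ne; rewrite /share rB rX sB sX er ees !eqxx => /(_ isT isT).
by move=> e; rewrite e eqxx in rs.
Qed.

Lemma grid_leq r s a b : frame E r s a b -> #|through r| <= #|at_label r| * #|at_label s|.
Proof.
move=> F; rewrite -cardsX -(card_in_imset (f := fun B => (pl (cp B) r, pl (cp B) s))).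
  apply: subset_leq_card; apply/subsetP => x /imsetP[B BN ->].
  by rewrite !inE /= imset_f // imset_f // -(frame_through F).
have NP Z : Z \in through r -> Z \in Ps by rewrite inE => /andP[].
move=> B X BN XN [e1 e2]; apply: (through_rs F BN XN).
  by have [] := (pl_eq r r (NP _ BN) (NP _ XN)).1 e1.
by have [] := (pl_eq s s (NP _ BN) (NP _ XN)).1 e2.
Qed.

Definition loose r := [set B | r \notin core B] :&: through r.

Lemma at_label_leq r : 2 * #|at_label r| <= #|through r| + #|loose r|.
Proof.
apply: card_fibres => B; rewrite [B \in through r]in_set [B \in [set _ | _]]in_set negbK.
move=> /andP[BP rB] /coreP[X [XP XB sh]].
have /and3P[_ rX /eqP e] := sh; exists X; split=> //; first by rewrite inE XP.
by apply/pl_eq.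
Qed.

Lemma looseE r B : (B \in loose r) = [&& r \notin core B, B \in Ps & r \in labels B].
Proof. by rewrite /loose in_setI; congr (_ && _); rewrite in_set. Qed.

Lemma loose_two r B : B \in loose r -> #|es B| = 2.
Proof.
rewrite looseE => /and3P[rc BP rB]; have le := edges_le2 BP; have pos := cf_pos cf BP.
apply/eqP; rewrite eqn_leq le /= ltnNge; apply: contra rc => le1.
by rewrite single_core //; apply/eqP; rewrite eqn_leq le1.
Qed.

(** A loose part has two edges and four labels, at least three of them in the core, so it is loose
    at one label only; and at most 6 - #|Ps| parts have two edges. *)
Lemma loose_leq r s a b : frame E r s a b -> #|loose r| + #|loose s| + #|Ps| <= 6.
Proof.
move=> F; apply: leq_trans two_edges_uniq; rewrite leq_add2r.
have [rs _ _ _ _] := frame_neq F.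
have d : loose r :&: loose s = set0.
  apply/setP => B; rewrite [RHS]inE; apply/negbTE/negP; rewrite in_setI => /andP[Br Bs].
  have := Br; rewrite looseE => /and3P[rc BP rB]; have := Bs; rewrite looseE => /and3P[sc _ sB].
  have := core_card BP; have lc : core B \subset labels B :\ r :\ s.
    apply/subsetP => u uc; rewrite !inE (subsetP (core_sub B)) // andbT.
    by apply/andP; split; [apply: contra sc|apply: contra rc] => /eqP <-.
  move=> h; have := leq_trans h (subset_leq_card lc).
  have := cardsD1 r (labels B); have := cardsD1 s (labels B :\ r).
  rewrite (cf_card cf BP) (loose_two Br) rB !inE eq_sym rs sB.
  by move: #|_ :\ s| #|_ :\ r|; clear => *; lia.
rewrite -cardsUI d cards0 addn0; apply: subset_leq_card; apply/subsetP => B.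
rewrite in_setU => Bl; have e2 : #|es B| = 2 by case/orP: Bl => /loose_two.
by rewrite inE e2 eqxx andbT; case/orP: Bl; rewrite looseE => /and3P[].
Qed.

(** A point at [r] or [s] carries two parts unless its part is loose there, which bounds [R] and [S]
    from above, while [grid_leq] bounds their product from below; arithmetic leaves these grids. *)
Lemma frame_counts r s a b : frame E r s a b ->
  let n := #|through r| in let R := #|at_label r| in let S := #|at_label s| in
  #|Ps| = 6 /\ n = 4 /\ R = 2 /\ S = 2 \/
  #|Ps| = n /\ (R = 3 /\ S = 2 \/ R = 2 /\ S = 3) \/
  #|Ps| = 6 /\ n = 6 /\ R = 3 /\ S = 3.
Proof.
move=> F; have h1 := through_gt0 F; have h2 := rest_neq1 F; have h3 := grid_leq F.
have h4 := at_label_leq r; have h5 := at_label_leq s; have h6 := loose_leq F.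
rewrite -(frame_through F) in h5.
have h7 : #|through r| <= #|Ps| by apply: subset_leq_card; apply/subsetP => B; rewrite inE => /andP[].
have h8 := card_le6; have h9 := five.
have bR : #|at_label r| <= 3 by move: h4 h6 h7 h8 h9; clear; lia.
have bS : #|at_label s| <= 3 by move: h5 h6 h7 h8 h9; clear; lia.
move: h1 h2 h3 h4 h5 h6 h7 h8 h9 bR bS; clear.
move: #|through r| #|at_label r| #|at_label s| #|Ps| #|loose r| #|loose s|.
move=> n R S t x y; case: R => [|[|[|[|R]]]] //; case: S => [|[|[|[|S]]]] //; lia.
Qed.

Lemma all_through r B : #|through r| = #|Ps| -> B \in Ps -> r \in labels B.
Proof.
move=> e BP; have sub : through r \subset Ps by apply/subsetP => X; rewrite inE => /andP[].
have /eqP eq : through r == Ps by rewrite eqEcard sub e /=.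
by move: BP; rewrite -{1}eq inE => /andP[].
Qed.

Lemma mem_at_label r B : B \in Ps -> r \in labels B -> pl (cp B) r \in at_label r.
Proof. by move=> BP rB; apply: imset_f; rewrite inE BP. Qed.

Lemma pl_ev B X u : B \in Ps -> X \in Ps -> (pl (cp B) u == pl (cp X) u) = (ev B u == ev X u).
Proof.
by move=> BP XP; apply/eqP/eqP => [/(pl_eq _ _ BP XP)[]|e]; last by apply/pl_eq.
Qed.

Lemma at_label_disj r s : r != s -> [disjoint at_label r & at_label s].
Proof.
move=> rs; rewrite -setI_eq0; apply/eqP/setP => x; rewrite !inE; apply/negP.
case/andP => /imsetP[B + ->] /imsetP[X +]; rewrite !inE => /andP[BP _] /andP[XP _].
by move=> /(pl_eq _ _ BP XP)[e]; rewrite e eqxx in rs.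
Qed.

Lemma at_label_rest r (Q : {set body}) : Q \subset Ps -> [disjoint Q & through r] ->
  [disjoint at_label r & ptsU Q].
Proof.
move=> QP d; rewrite -setI_eq0; apply/eqP/setP => x; rewrite [RHS]inE; apply/negP.
move=> /setIP[/imsetP[B + ->] /bigcupP[X XQ /imsetP[u uX]]]; rewrite inE => /andP[BP _].
have XP := subsetP QP _ XQ; move=> /(pl_eq _ _ BP XP)[e _].
by have := disjointFr d XQ; rewrite inE XP e uX.
Qed.

Lemma at_label_sub r : at_label r \subset ptsU Ps.
Proof.
apply/subsetP => x /imsetP[B + ->]; rewrite inE => /andP[BP rB].
by apply/bigcupP; exists B => //; apply: imset_f.
Qed.

Lemma six_single B : #|Ps| = 6 -> B \in Ps -> #|es B| = 1.
Proof.
move=> six BP; have := two_edges_uniq; rewrite six => h.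
have /eqP/setP/(_ B) : [set B in Ps | #|es B| == 2] == set0.
  by rewrite -cards_eq0; move: h; clear; lia.
rewrite !inE BP /= => ne; have := cf_pos cf BP; have := edges_le2 BP.
by case: #|es B| ne => [|[|[|]]].
Qed.

(** The two parts off the frame span at least five points, apart from the four of the grid: nine,
    where eight are allowed. *)
Lemma small_grid_free r s a b : frame E r s a b -> #|Ps| = 6 -> #|through r| = 4 ->
  #|at_label r| = 2 -> #|at_label s| = 2 -> False.
Proof.
move=> F six n4 R2 S2; have [rs _ _ _ _] := frame_neq F.
pose Q := Ps :\: through r; have QP : Q \subset Ps := subsetDl _ _.
have dQ : [disjoint Q & through r] by rewrite -setI_eq0 /Q setIDAC setDIl setDv setI0.
have cQ : #|Q| = 2.
  have sub : through r \subset Ps by apply/subsetP => B; rewrite inE => /andP[].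
  have := cardsID (through r) Ps; rewrite (setIidPr sub) -/Q six n4; clear; lia.
have := cf_part cf QP; rewrite cQ six => /(_ isT) hQ.
have hc := card_le_edges cf QP; rewrite cQ in hc.
have dr := at_label_rest QP dQ; rewrite (frame_through F) in dQ.
have ds := at_label_rest QP dQ; have drs := at_label_disj rs.
have h1 : #|at_label r :|: at_label s| = 4.
  by rewrite cardsU R2 S2 (eqP (_ : _ :&: _ == set0)) ?cards0 // setI_eq0.
have h2 : #|(at_label r :|: at_label s) :|: ptsU Q| = 4 + #|ptsU Q|.
  rewrite cardsU h1 (eqP (_ : (_ :|: _) :&: ptsU Q == set0)) ?cards0 ?subn0 //.
  by rewrite setIUl setU_eq0 !setI_eq0 dr ds.
have : #|(at_label r :|: at_label s) :|: ptsU Q| <= #|ptsU Ps|.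
  apply: subset_leq_card; rewrite !subUset !at_label_sub /=.
  by apply/bigcupsP => B BQ; apply: bigcup_sup; apply: (subsetP QP).
rewrite h2; have := cf_all cf; have := cf_edges cf.
move: hQ hc; move: (\sum_(B in Q) _) (\sum_(B in Ps) _) #|ptsU Q| #|ptsU Ps|.
by clear => *; lia.
Qed.

(** The point of [y] at [a] lies on a further part [z]. Then [xa], [xb] and [z] avoid the point of
    [d] at [s], hence share the other one and differ at [r], also from [d]: four points at [r]
    instead of three. *)
Lemma five_bodies_key r s a b d xa xb y : frame E r s a b -> #|through r| = #|Ps| ->
  #|at_label r| = 3 -> #|at_label s| = 2 -> a != b ->
  d \in Ps -> r \notin core d -> s \in labels d ->
  xa \in Ps -> xb \in Ps -> y \in Ps -> y != d -> #|es xb| = 1 -> #|es y| = 1 ->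
  share d xa a -> share d xb b -> xa != d -> xb != d ->
  share d y s -> labels y = [set r; s; a] -> False.
Proof.
move=> F nt R3 S2 ab dP rd sd xaP xbP yP yd xb1 y1 sha shb xad xbd shy ly.
have [rs ra sa rb sb] := frame_neq F.
have allr B : B \in Ps -> r \in labels B by move=> BP; apply: all_through nt BP.
have alls B : B \in Ps -> s \in labels B by move=> BP; apply: frame_rs F BP (allr B BP).
have ay : a \in core y by rewrite single_core // ly !inE eqxx orbT.
have [z [zP zy shz]] := coreP ay.
have ney (x : body) : x \in Ps -> x != y -> share y x a -> ~~ share d x s.
  move=> xP xy shx; apply/negP => sh.
  have h : share y x s by apply: share_trans sh; rewrite shareC.
  by have := share_uniq yP xP _ shx h; rewrite eq_sym xy => /(_ isT) e; rewrite e eqxx in sa.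
have dy : d != y by rewrite eq_sym.
have nda : ~~ share y d a.
  apply/negP => sh; have := ney d dP dy sh; rewrite /share sd eqxx //.
have zd : z != d by apply: contra nda => /eqP<-.
have zxa : z != xa.
  apply: contra nda => /eqP e; apply: share_trans (_ : share z d a); first by [].
  by rewrite e shareC.
have zxb : z != xb.
  apply: contra ab => /eqP e; have : b \in labels xb by case/and3P: shb.
  have : a \in labels xb by case/and3P: shz => _; rewrite e.
  have [->|->] := frame_single F xbP xb1 (allr _ xbP); rewrite !inE; last first.
    by rewrite eq_sym (negbTE ra) eq_sym (negbTE sa) /= => ->.
  by move=> _; rewrite eq_sym (negbTE rb) eq_sym (negbTE sb) /= eq_sym.
have xab : xa != xb.
  apply: contra ab => /eqP e; apply/eqP; apply: (share_uniq dP xaP _ sha _); rewrite 1?eq_sym //.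
  by rewrite e.
have sNd x c : x \in Ps -> x != d -> c != s -> share d x c -> pl (cp x) s != pl (cp d) s.
  move=> xP xd cs' sh; rewrite pl_ev //; apply: contra cs' => e; apply/eqP.
  apply: (share_uniq dP xP _ sh _); first by rewrite eq_sym.
  by apply/and3P; split; [exact: alls|exact: alls|rewrite eq_sym].
have sza : pl (cp z) s != pl (cp d) s.
  rewrite pl_ev //; apply: contra (ney z zP zy shz) => e.
  by apply/and3P; split; [exact: alls|exact: alls|rewrite eq_sym].
have sxa := sNd xa a xaP xad _ sha; rewrite eq_sym sa in sxa; have {}sxa := sxa isT.
have sxb := sNd xb b xbP xbd _ shb; rewrite eq_sym sb in sxb; have {}sxb := sxb isT.
have two x x' : x \in Ps -> x' \in Ps -> pl (cp x) s != pl (cp d) s ->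
    pl (cp x') s != pl (cp d) s -> pl (cp x) s = pl (cp x') s.
  move=> xP x'P n1 n2; have := mem_at_label xP (alls x xP).
  have := mem_at_label x'P (alls x' x'P); have := mem_at_label dP (alls d dP).
  move/eqP/cards2P: S2 => [p [q [pq ->]]]; rewrite !inE.
  move=> /orP[]/eqP ed /orP[]/eqP e' /orP[]/eqP e; move: n1 n2; rewrite ed e e' ?eqxx //.
have rdist x x' : x \in Ps -> x' \in Ps -> pl (cp x) s = pl (cp x') s ->
    pl (cp x) r = pl (cp x') r -> x = x'.
  move=> xP x'P /eqP es' /eqP er; apply: (through_rs F); rewrite ?inE ?xP ?x'P ?allr //.
    by apply/eqP; rewrite -pl_ev.
  by apply/eqP; rewrite -pl_ev.
have rNd x : x \in Ps -> x != d -> pl (cp x) r != pl (cp d) r.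
  move=> xP xd; rewrite pl_ev //; apply: contra rd => e; rewrite inE allr //=.
  apply/exists_inP; exists x; rewrite // xd /=.
  by apply/and3P; split; [exact: allr|exact: allr|rewrite eq_sym].
have eab := two _ _ xaP xbP sxa sxb; have eaz := two _ _ xaP zP sxa sza.
have ebz := two _ _ xbP zP sxb sza.
have c4 : #|[set d; xa; xb; z]| = 4.
  rewrite setUC cardsU1 cards3 ?inE 1?eq_sym // 1?eq_sym //.
  by rewrite !negb_or zd zxa zxb.
suff : 4 <= #|at_label r| by rewrite R3.
rewrite -c4 -(card_in_imset (f := fun B => pl (cp B) r)); last first.
  move=> B X; rewrite !inE -!orbA => /or4P[]/eqP-> /or4P[]/eqP-> // e; apply/eqP; move/eqP: e.
  - by rewrite eq_sym (negbTE (rNd _ xaP xad)).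
  - by rewrite eq_sym (negbTE (rNd _ xbP xbd)).
  - by rewrite eq_sym (negbTE (rNd _ zP zd)).
  - by rewrite (negbTE (rNd _ xaP xad)).
  - by move=> /eqP/(rdist _ _ xaP xbP eab)->.
  - by move=> /eqP/(rdist _ _ xaP zP eaz)->.
  - by rewrite (negbTE (rNd _ xbP xbd)).
  - by move=> /eqP/(rdist _ _ xbP xaP (esym eab))->.
  - by move=> /eqP/(rdist _ _ xbP zP ebz)->.
  - by rewrite (negbTE (rNd _ zP zd)).
  - by move=> /eqP/(rdist _ _ zP xaP (esym eaz))->.
  - by move=> /eqP/(rdist _ _ zP xbP (esym ebz))->.
apply: subset_leq_card; apply/subsetP => p /imsetP[B + ->]; rewrite !inE -!orbA.
by move=> /or4P[]/eqP->; apply: mem_at_label => //; apply: allr.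
Qed.

(** Since 2 * 3 > 5, some part [d] is loose at [r]. It is the one with two edges, and its other
    three labels are all shared. *)
Lemma five_bodies_free r s a b : frame E r s a b -> #|Ps| = 5 -> #|through r| = 5 ->
  #|at_label r| = 3 -> #|at_label s| = 2 -> False.
Proof.
move=> F P5 n5 R3 S2; have nt : #|through r| = #|Ps| by rewrite n5 P5.
have [rs ra sa rb sb] := frame_neq F.
have allr B : B \in Ps -> r \in labels B by move=> BP; apply: all_through nt BP.
have alls B : B \in Ps -> s \in labels B by move=> BP; apply: frame_rs F BP (allr B BP).
have /card_gt0P[d dl] : 0 < #|loose r|.
  by have := at_label_leq r; rewrite n5 R3; clear; case: #|loose r|.
have := dl; rewrite looseE => /and3P[rd dP _]; have d2 := loose_two dl.
have single B : B \in Ps -> B != d -> #|es B| = 1.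
  move=> BP Bd; have := cf_pos cf BP; have := edges_le2 BP.
  have : #|es B| != 2.
    apply/negP => e2; have := two_edges_uniq; rewrite P5 leqNgt => /negP; apply.
    suff : 1 < #|[set B in Ps | #|es B| == 2]| by clear; lia.
    by apply/card_gt1P; exists B, d; rewrite !inE BP dP d2 e2.
  by case: #|es B| => [|[|[|]]].
have ld : labels d = [set r; s; a; b].
  apply/eqP; rewrite eqEcard (frame_labels F dP (allr d dP)) (cf_card cf dP) d2 /=.
  rewrite setUC cardsU1; apply: leq_trans (leq_add (leq_b1 _) (leqnn _)) _.
  rewrite setUC cardsU1; apply: leq_trans (leq_add (leqnn _) (leq_add (leq_b1 _) (leqnn _))) _.
  by rewrite cards2; case: (r != s).
have ab : a != b.
  apply: contraL (ltnSn 3) => /eqP e; rewrite -leqNgt.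
  have <- : #|labels d| = 4 by rewrite (cf_card cf dP) d2.
  rewrite ld e -setUA setUid setUC cardsU1; apply: leq_trans (leq_add (leq_b1 _) (leqnn _)) _.
  by rewrite cards2; case: (r != s).
have cd u : u \in labels d -> u != r -> u \in core d.
  move=> ul ur; suff -> : core d = labels d :\ r by rewrite !inE ur.
  apply/eqP; rewrite eqEcard; apply/andP; split.
    by rewrite subsetD1 core_sub rd.
  have := cardsD1 r (labels d); rewrite (cf_card cf dP) d2 allr //.
  by have := core_card dP; move: #|core d| #|_ :\ r|; clear; lia.
have [xa [xaP xad sha]] : exists X, [/\ X \in Ps, X != d & share d X a].
  by apply: coreP; apply: cd; rewrite ?ld ?inE ?eqxx ?orbT // eq_sym.
have [xb [xbP xbd shb]] : exists X, [/\ X \in Ps, X != d & share d X b].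
  by apply: coreP; apply: cd; rewrite ?ld ?inE ?eqxx ?orbT // eq_sym.
have [y [yP yd shy]] : exists X, [/\ X \in Ps, X != d & share d X s].
  by apply: coreP; apply: cd; rewrite ?alls // eq_sym.
have y1 := single y yP yd; have a1 := single xa xaP xad; have b1 := single xb xbP xbd.
have sd := alls d dP.
case: (frame_single F yP y1 (allr y yP)) => ly.
  exact: (five_bodies_key F nt R3 S2 ab dP rd sd xaP xbP yP yd b1 y1 sha shb).
rewrite eq_sym in ab.
exact: (five_bodies_key (frame_third F) nt R3 S2 ab dP rd sd xbP xaP yP yd a1 y1 shb sha).
Qed.

Definition third a b B := if a \in labels B then a else b.

Lemma third_labels r s a b B : frame E r s a b -> #|Ps| = 6 -> B \in Ps -> r \in labels B ->
  labels B = [set r; s; third a b B].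
Proof.
move=> F six BP rB; have [rs ra sa rb sb] := frame_neq F; rewrite /third.
have [->|->] := frame_single F BP (six_single six BP) rB; rewrite !inE ?eqxx ?orbT //.
rewrite eq_sym (negbTE ra) eq_sym (negbTE sa) /=.
by case: (a =P b) => [->|].
Qed.

Lemma third_cases a b B : third a b B = a \/ third a b B = b.
Proof. by rewrite /third; case: ifP; [left|right]. Qed.

Definition chord_r (s l : gvert) : int := (slopez (gcol l) - slopez (gcol s))%R.
Definition chord_s (r l : gvert) : int := (slopez (gcol r) - slopez (gcol l))%R.

Lemma share_line r s B X l : share B X l ->
  (ev B r *~ chord_r s l + ev B s *~ chord_s r l = ev X r *~ chord_r s l + ev X s *~ chord_s r l)%R.
Proof. by case/and3P=> _ _ /eqP e; rewrite !evE -!line_third -!evE e. Qed.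

Lemma frame_cols r s a b l : frame E r s a b -> l = a \/ l = b ->
  (gcol r == gcol l) = false /\ (gcol s == gcol l) = false.
Proof.
move=> [_ _ /and3P[_ ra sa] /andP[rb sb]] [] ->.
  by rewrite !(negbTE (gjoin_col _)).
by rewrite !(negbTE (gjoin_col _)).
Qed.

Lemma frame_col_rs r s a b : frame E r s a b -> (gcol r == gcol s) = false.
Proof. by move=> [_ _ /and3P[rs _ _] _]; apply/negbTE/gjoin_col. Qed.

Lemma grid_cycle r s a b (B0 B1 B2 C0 C1 C2 : body) l0 l1 l2 : frame E r s a b ->
  [/\ l0 = a \/ l0 = b, l1 = a \/ l1 = b & l2 = a \/ l2 = b] ->
  ev B1 r = ev B0 r -> ev B2 r = ev B0 r -> ev C1 r = ev C0 r -> ev C2 r = ev C0 r ->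
  ev C0 s = ev B0 s -> ev C1 s = ev B1 s -> ev C2 s = ev B2 s ->
  share B0 C1 l0 -> share B1 C2 l1 -> share B2 C0 l2 -> ev B0 r = ev C0 r.
Proof.
move=> F [h0 h1 h2] b1 b2 c1 c2 e0 e1 e2 sh0 sh1 sh2.
have := share_line r s sh0; rewrite c1 e1 => k0.
have := share_line r s sh1; rewrite b1 c2 e2 => k1.
have := share_line r s sh2; rewrite b2 e0 => k2.
apply: (grid23_lines (inc_torsion inc) k0 k1 k2).
have h := all_coloursP (all_coloursP grid_colours (gcol_lt r)) (gcol_lt s).
rewrite (frame_col_rs F) /= in h.
have {}h := all_coloursP h (gcol_lt l0); have [f1 f2] := frame_cols F h0; rewrite f1 f2 /= in h.
have {}h := all_coloursP h (gcol_lt l1); have [f3 f4] := frame_cols F h1; rewrite f3 f4 /= in h.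
have {}h := all_coloursP h (gcol_lt l2); have [f5 f6] := frame_cols F h2; rewrite f5 f6 /= in h.
(* Three labels among [a] and [b] cannot have three colours, so the exceptional branch of
   [grid_colours] is void. *)
have nd : (gcol l0 != gcol l1) && (gcol l1 != gcol l2) && (gcol l0 != gcol l2) = false.
  by case: h0 => ->; case: h1 => ->; case: h2 => ->; rewrite ?eqxx ?andbF.
by rewrite nd in h.
Qed.

Lemma hexagon_cycle r s a b (B0 B1 B2 C0 C1 C2 : body) l l' : frame E r s a b ->
  (l = a \/ l = b) -> (l' = a \/ l' = b) ->
  ev C0 r = ev B0 r -> ev C1 r = ev B1 r -> ev C2 r = ev B2 r ->
  ev C0 s = ev B1 s -> ev C1 s = ev B2 s -> ev C2 s = ev B0 s ->
  share B0 B1 l -> share B1 B2 l -> share C0 C1 l' -> share C1 C2 l' -> ev B0 r = ev B1 r.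
Proof.
move=> F hl hl' c0 c1 c2 e0 e1 e2 sh0 sh1 sh2 sh3.
have k0 := share_line r s sh0; have k1 := share_line r s sh1.
have := share_line r s sh2; rewrite c0 c1 e0 e1 => k2.
have := share_line r s sh3; rewrite c1 c2 e1 e2 => k3.
have h := all_coloursP (all_coloursP hexagon_colours (gcol_lt r)) (gcol_lt s).
rewrite (frame_col_rs F) /= in h.
have {}h := all_coloursP h (gcol_lt l); have [f1 f2] := frame_cols F hl; rewrite f1 f2 /= in h.
have {}h := all_coloursP h (gcol_lt l'); have [f3 f4] := frame_cols F hl'; rewrite f3 f4 /= in h.
have /andP[hm hk] := h.
exact: (hexagon_lines (inc_torsion inc) k0 k1 k2 k3 hm hk).
Qed.

(** * Six single edges through a frame *)

Section SixBodies.
Variables (r s a b : gvert).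
Hypotheses (F : frame E r s a b) (six : #|Ps| = 6) (n6 : #|through r| = 6).
Local Notation th := (third a b).
Local Notation pr B := (pl (cp B) r).
Local Notation ps B := (pl (cp B) s).

Lemma six_r B : B \in Ps -> r \in labels B.
Proof. by apply: all_through; rewrite n6 six. Qed.

Lemma six_s B : B \in Ps -> s \in labels B.
Proof. by move=> BP; apply: (frame_rs F BP (six_r BP)). Qed.

Lemma six_labels B : B \in Ps -> labels B = [set r; s; th B].
Proof. by move=> BP; apply: (third_labels F six BP (six_r BP)). Qed.

Lemma six_third B : B \in Ps -> th B \in labels B.
Proof. by move=> BP; rewrite (six_labels BP) !inE eqxx !orbT. Qed.

Lemma six_third_neq B : [/\ th B != r & th B != s].
Proof.
have [_ ra sa rb sb] := frame_neq F; rewrite eq_sym [_ == s]eq_sym.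
by case: (third_cases a b B) => ->.
Qed.

Lemma six_share_third B X : B \in Ps -> X \in Ps -> share B X (th B) -> th B = th X.
Proof.
move=> BP XP /and3P[_ + _]; have [n1 n2] := six_third_neq B.
by rewrite (six_labels XP) !inE (negbTE n1) (negbTE n2) => /eqP.
Qed.

Lemma six_apart B X : B \in Ps -> X \in Ps -> B != X -> share B X (th B) ->
  pr B != pr X /\ ps B != ps X.
Proof.
move=> BP XP ne sh; have [n1 n2] := six_third_neq B.
split; rewrite pl_ev //; apply/negP => e.
  have h : share B X r by apply/and3P; split; [exact: six_r|exact: six_r|].
  by have := share_uniq BP XP ne sh h => e'; rewrite e' eqxx in n1.
have h : share B X s by apply/and3P; split; [exact: six_s|exact: six_s|].
by have := share_uniq BP XP ne sh h => e'; rewrite e' eqxx in n2.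
Qed.

Lemma six_partner B : B \in Ps -> exists X, [/\ X \in Ps, X != B & share B X (th B)].
Proof. by move=> BP; apply: coreP; rewrite single_core ?six_single ?six_third. Qed.

Lemma six_eq B X : B \in Ps -> X \in Ps -> pr B = pr X -> ps B = ps X -> B = X.
Proof.
move=> BP XP /eqP e1 /eqP e2; rewrite !pl_ev // in e1 e2.
by apply: (through_rs F _ _ (eqP e1) (eqP e2)); rewrite inE ?BP ?XP six_r.
Qed.

(** The parts fill the 2 x 3 grid. A part shares its third point with one in the other row and
    another column, and parts of one row have different partners; so the partners form a 3-cycle of
    the columns, against [grid_cycle]. *)
Lemma six_grid_free : #|at_label r| = 2 -> #|at_label s| = 3 -> False.
Proof.
move=> /eqP/cards2P[x [x' [xx Rx]]] /card3P[y0 [y1 [y2 [n01 n02 n12 Sy]]]].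
have img : (fun B => (pr B, ps B)) @: Ps = setX (at_label r) (at_label s).
  apply/eqP; rewrite eqEcard; apply/andP; split.
    by apply/subsetP => z /imsetP[B BP ->]; rewrite inE !mem_at_label ?six_r ?six_s.
  rewrite cardsX Rx Sy cards2 xx cards3 // card_in_imset ?six //.
  by move=> B X BP XP [e1 e2]; apply: six_eq.
have get p q : p \in at_label r -> q \in at_label s ->
    exists B, [/\ B \in Ps, pr B = p & ps B = q].
  move=> pR qS; have : (p, q) \in setX (at_label r) (at_label s) by rewrite inE pR.
  by rewrite -img => /imsetP[B BP [-> ->]]; exists B.
have xR : x \in at_label r by rewrite Rx !inE eqxx.
have x'R : x' \in at_label r by rewrite Rx !inE eqxx orbT.
have part B z : B \in Ps -> pr B = z -> z \in at_label r -> exists X,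
    [/\ X \in Ps, share B X (th B), pr X = (if z == x then x' else x) & ps X != ps B].
  move=> BP Bz zR; have [X [XP XB sh]] := six_partner BP.
  have BX : B != X by rewrite eq_sym.
  have [p1 p2] := six_apart BP XP BX sh; exists X; split=> //; last by rewrite eq_sym.
  have := mem_at_label XP (six_r XP); move: zR p1; rewrite Bz Rx !inE.
  by move=> /orP[]/eqP-> q1 /orP[]/eqP eX; move: q1; rewrite eX ?eqxx // (eq_sym x') (negbTE xx).
(* Stated for any order of the columns, to serve both 3-cycles. *)
have cyc z0 z1 z2 B0 B1 B2 C0 C1 C2 :
  [/\ z0 != z1, z0 != z2, z1 != z2 & at_label s = [set z0; z1; z2]] ->
  [/\ B0 \in Ps, pr B0 = x & ps B0 = z0] -> [/\ B1 \in Ps, pr B1 = x & ps B1 = z1] ->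
  [/\ B2 \in Ps, pr B2 = x & ps B2 = z2] -> [/\ C0 \in Ps, pr C0 = x' & ps C0 = z0] ->
  [/\ C1 \in Ps, pr C1 = x' & ps C1 = z1] -> [/\ C2 \in Ps, pr C2 = x' & ps C2 = z2] ->
  share B0 C1 (th B0) -> False.
  move=> [m01 m02 m12 Sz] [b0 p0 q0] [b1 p1 q1] [b2 p2 q2] [c0 u0 v0] [c1 u1 v1] [c2 u2 v2] sh0.
  have alt B C : B \in Ps -> pr B = x -> C \in Ps -> pr C = x' -> share B C (th B) ->
      B != B0 -> C != C1.
    move=> BP Bx CP Cx sh ne; apply/negP => /eqP e; rewrite e in sh.
    have t1 := six_share_third BP c1 sh; have t0 := six_share_third b0 c1 sh0.
    have sBB : share B0 B (th B0).
      by apply: (share_trans sh0); rewrite shareC t0 -t1.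
    have ne' : B0 != B by rewrite eq_sym.
    by have [] := six_apart b0 BP ne' sBB; rewrite p0 Bx eqxx.
  have n10 : B1 != B0 by apply: contra m01 => /eqP e; rewrite -q0 -q1 e.
  have n20 : B2 != B0 by apply: contra m02 => /eqP e; rewrite -q0 -q2 e.
  have n21 : B2 != B1 by apply: contra m12 => /eqP e; rewrite -q1 -q2 e.
  have look B : B \in Ps -> pr B = x -> exists C,
      [/\ share B C (th B), ps C != ps B & C = C0 \/ C = C1 \/ C = C2].
    move=> BP Bx; have [X [XP sh e ne]] := part B x BP Bx xR; rewrite eqxx in e.
    exists X; split=> //; have := mem_at_label XP (six_s XP); rewrite Sz !inE -!orbA.
    move=> /or3P[]/eqP e'; [left|right; left|right; right]; apply: six_eq; rewrite ?e ?e' //.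
  have [X1 [shX1 neX1 X1E]] := look B1 b1 p1.
  have {X1E shX1 neX1} sh1 : share B1 C2 (th B1) \/ share B1 C0 (th B1).
    case: X1E shX1 neX1 => [->|[->|->]] sh; rewrite ?q1 ?v1 ?eqxx // => _; [by right|by left].
  have [X2 [shX2 neX2 X2E]] := look B2 b2 p2.
  have sh2 : share B2 C0 (th B2).
    case: X2E shX2 neX2 => [->|[->|->]] sh; rewrite ?q2 ?v2 ?eqxx // => _.
    by have := alt B2 C1 b2 p2 c1 u1 sh n20; rewrite eqxx.
  have {}sh1 : share B1 C2 (th B1).
    case: sh1 => // sh1; have t1 := six_share_third b1 c0 sh1.
    have t2 := six_share_third b2 c0 sh2.
    have sBB : share B2 B1 (th B2).
      by apply: (share_trans sh2); rewrite shareC t2 -t1.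
    by have [] := six_apart b2 b1 n21 sBB; rewrite p1 p2 eqxx.
  have peq B X u : B \in Ps -> X \in Ps -> pl (cp B) u = pl (cp X) u -> ev B u = ev X u.
    by move=> BP XP /(pl_eq _ _ BP XP)[].
  suff : pr B0 = pr C0 by rewrite p0 u0 => e; rewrite e eqxx in xx.
  apply/pl_eq => //; split=> //.
  apply: (@grid_cycle r s a b B0 B1 B2 C0 C1 C2 (th B0) (th B1) (th B2) F) => //.
  - by split; apply: third_cases.
  - by apply: peq => //; rewrite p0 p1.
  - by apply: peq => //; rewrite p0 p2.
  - by apply: peq => //; rewrite u0 u1.
  - by apply: peq => //; rewrite u0 u2.
  - by apply: peq => //; rewrite v0 q0.
  - by apply: peq => //; rewrite v1 q1.
  - by apply: peq => //; rewrite v2 q2.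
have yS y : y \in [set y0; y1; y2] -> y \in at_label s by rewrite Sy.
have [||B0 hB0] := get x y0; rewrite ?yS ?inE ?eqxx ?orbT //.
have [||B1 hB1] := get x y1; rewrite ?yS ?inE ?eqxx ?orbT //.
have [||B2 hB2] := get x y2; rewrite ?yS ?inE ?eqxx ?orbT //.
have [||C0 hC0] := get x' y0; rewrite ?yS ?inE ?eqxx ?orbT //.
have [||C1 hC1] := get x' y1; rewrite ?yS ?inE ?eqxx ?orbT //.
have [||C2 hC2] := get x' y2; rewrite ?yS ?inE ?eqxx ?orbT //.
have [b0 p0 q0] := hB0; have [X [XP sh e ne]] := part B0 x b0 p0 xR; rewrite eqxx in e.
have := mem_at_label XP (six_s XP); rewrite Sy !inE -!orbA => /or3P[]/eqP e'.
- by rewrite e' q0 eqxx in ne.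
- have [c1 u1 v1] := hC1; have XC : X = C1 by apply: six_eq; rewrite ?e ?e'.
  by apply: (cyc y0 y1 y2 B0 B1 B2 C0 C1 C2); rewrite -?XC.
- have [c2 u2 v2] := hC2; have XC : X = C2 by apply: six_eq; rewrite ?e ?e'.
  have Sy' : at_label s = [set y0; y2; y1] by rewrite Sy setUAC.
  by apply: (cyc y0 y2 y1 B0 B2 B1 C0 C2 C1) => //; rewrite -?XC // [y2 == _]eq_sym.
Qed.

Local Notation tp B := (pl (cp B) (th B)).

Lemma tp_share B X : B \in Ps -> X \in Ps -> tp B = tp X -> share B X (th B).
Proof.
move=> BP XP /(pl_eq _ _ BP XP)[e /eqP ee]; apply/and3P; split=> //.
  exact: six_third.
by rewrite e six_third.
Qed.

Lemma tp_apart B X : B \in Ps -> X \in Ps -> tp B = tp X -> B != X ->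
  pr B != pr X /\ ps B != ps X.
Proof. by move=> BP XP e ne; apply: six_apart => //; apply: tp_share. Qed.

(** Of at most eight points, six have label [r] or [s]. *)
Lemma card_thirds : #|at_label r| = 3 -> #|at_label s| = 3 ->
  #|(fun B => tp B) @: Ps| <= 2.
Proof.
move=> R3 S3; have [rs _ _ _ _] := frame_neq F.
have dis u : u = r \/ u = s -> [disjoint at_label u & (fun B => tp B) @: Ps].
  move=> hu; rewrite -setI_eq0; apply/eqP/setP => x; rewrite [RHS]inE; apply/negP.
  move=> /setIP[/imsetP[B + ->] /imsetP[X XP]]; rewrite inE => /andP[BP _].
  move=> /(pl_eq _ _ BP XP)[e _]; have [n1 n2] := six_third_neq X.
  by move: n1 n2; rewrite -e; case: hu => ->; rewrite eqxx.
have h1 : #|at_label r :|: at_label s| = 6.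
  rewrite cardsU R3 S3 (eqP (_ : _ :&: _ == set0)) ?cards0 // setI_eq0.
  exact: at_label_disj.
have h2 : #|(at_label r :|: at_label s) :|: (fun B => tp B) @: Ps| =
    6 + #|(fun B => tp B) @: Ps|.
  rewrite cardsU h1 (eqP (_ : (_ :|: _) :&: _ == set0)) ?cards0 ?subn0 //.
  by rewrite setIUl setU_eq0 !setI_eq0 !dis //; [right|left].
have : #|(at_label r :|: at_label s) :|: (fun B => tp B) @: Ps| <= #|ptsU Ps|.
  apply: subset_leq_card; rewrite !subUset !at_label_sub /=.
  apply/subsetP => x /imsetP[B BP ->]; apply/bigcupP; exists B => //.
  by apply: imset_f; apply: six_third.
rewrite h2; have := cf_all cf; have := cf_edges cf.
move: (\sum_(B in Ps) _) #|_ @: _| #|ptsU Ps|; clear => *; lia.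
Qed.

Lemma card_fibre (Q : {set body}) : Q \subset Ps -> {in Q &, forall B X, tp B = tp X} ->
  {in Q &, injective (fun B => pr B)} /\ {in Q &, injective (fun B => ps B)}.
Proof.
move=> QP h; split=> B X BQ XQ /eqP e; apply/eqP/negPn/negP => ne.
  have [] := tp_apart (subsetP QP _ BQ) (subsetP QP _ XQ) (h B X BQ XQ) ne.
  by rewrite e.
have [] := tp_apart (subsetP QP _ BQ) (subsetP QP _ XQ) (h B X BQ XQ) ne.
by rewrite e.
Qed.

(** Each of the two third points carries exactly three parts, which match the points at [r] with
    those at [s]. The two matchings are disjoint, so they differ by a 3-cycle, and [hexagon_cycle]
    makes two points at [r] coincide. *)
Lemma six_hexagon_free : #|at_label r| = 3 -> #|at_label s| = 3 -> False.
Proof.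
move=> R3 S3; have h2 := card_thirds R3 S3.
have sub_r (Q : {set body}) : Q \subset Ps -> (fun B => pr B) @: Q \subset at_label r.
  move=> QP; apply/subsetP => x /imsetP[B BQ ->]; have BP := subsetP QP _ BQ.
  by apply: mem_at_label => //; apply: six_r.
have sub_s (Q : {set body}) : Q \subset Ps -> (fun B => ps B) @: Q \subset at_label s.
  move=> QP; apply/subsetP => x /imsetP[B BQ ->]; have BP := subsetP QP _ BQ.
  by apply: mem_at_label => //; apply: six_s.
have le3 (Q : {set body}) : Q \subset Ps -> {in Q &, forall B X, tp B = tp X} -> #|Q| <= 3.
  move=> QP /(card_fibre QP)[inj _]; rewrite -(card_in_imset inj) -R3.
  exact: subset_leq_card (sub_r Q QP).
have [B BP] : exists B, B \in Ps by apply/card_gt0P; rewrite six.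
pose F1 := [set X in Ps | tp X == tp B]; pose F2 := [set X in Ps | tp X != tp B].
have F1P : F1 \subset Ps by apply/subsetP => X; rewrite inE => /andP[].
have F2P : F2 \subset Ps by apply/subsetP => X; rewrite inE => /andP[].
have t1 : {in F1 &, forall X Z, tp X = tp Z}.
  by move=> X Z; rewrite !in_set => /andP[_ /eqP->] /andP[_ /eqP->].
have t2 : {in F2 &, forall X Z, tp X = tp Z}.
  move=> X Z; rewrite !in_set => /andP[XP nX] /andP[ZP nZ]; apply/eqP/negPn/negP => XZ.
  move: h2; rewrite leqNgt => /negP; apply; apply/card_gt2P.
  exists (tp B), (tp X), (tp Z); split; last by split; rewrite // eq_sym.
  by split; apply: (imset_f (fun B => tp B)).
have c1 := le3 F1 F1P t1; have c2 := le3 F2 F2P t2.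
have c12 : #|F1| + #|F2| = 6.
  rewrite -six -(cardsID F1 Ps) (setIidPr F1P); congr (_ + _); apply: eq_card => X.
  by rewrite /F1 /F2 !inE; case: (X \in Ps); rewrite ?andbF ?andbT.
have {}c1 : #|F1| = 3 by move: c1 c2 c12; clear; lia.
have {c12}c2 : #|F2| = 3 by move: c1 c2 c12; clear; lia.
have [i1 j1] := card_fibre F1P t1; have [i2 j2] := card_fibre F2P t2.
have im_r (Q : {set body}) : Q \subset Ps -> #|Q| = 3 -> {in Q &, injective (fun B => pr B)} ->
    (fun B => pr B) @: Q = at_label r.
  by move=> QP cQ inj; apply/eqP; rewrite eqEcard sub_r // card_in_imset // R3 cQ.
have im_s (Q : {set body}) : Q \subset Ps -> #|Q| = 3 -> {in Q &, injective (fun B => ps B)} ->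
    (fun B => ps B) @: Q = at_label s.
  by move=> QP cQ inj; apply/eqP; rewrite eqEcard sub_s // card_in_imset // S3 cQ.
have [B0 [B1 [B2 [n01 n02 n12 F1E]]]] := card3P c1.
have m0 : B0 \in F1 by rewrite F1E !inE eqxx.
have m1 : B1 \in F1 by rewrite F1E !inE eqxx !orbT.
have m2 : B2 \in F1 by rewrite F1E !inE eqxx !orbT.
have mate X : X \in F1 -> exists C, [/\ C \in F2, pr C = pr X & ps C != ps X].
  move=> XF; have XP := subsetP F1P _ XF.
  have : pr X \in (fun B => pr B) @: F2.
    by rewrite im_r //; apply: mem_at_label => //; apply: six_r.
  move=> /imsetP[C CF e]; exists C; split=> //; apply/negP => /eqP e'.
  have CX := six_eq (subsetP F2P _ CF) XP (esym e) e'.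
  by move: CF XF; rewrite CX !in_set => /andP[_ /negbTE->]; rewrite andbF.
have val X : X \in F2 -> ps X = ps B0 \/ ps X = ps B1 \/ ps X = ps B2.
  move=> XF; have XP := subsetP F2P _ XF.
  have := mem_at_label XP (six_s XP); rewrite -(im_s F1 F1P c1 j1) F1E.
  move=> /imsetP[Z + ->]; rewrite !inE -!orbA.
  by move=> /or3P[]/eqP->; [left|right; left|right; right].
have [C0 [f0 p0 q0]] := mate B0 m0; have [C1 [f1 p1 q1]] := mate B1 m1.
have [C2 [f2 p2 q2]] := mate B2 m2.
have pne X Z : X \in F1 -> Z \in F1 -> X != Z -> pr X != pr Z.
  by move=> XF ZF; apply: contra => /eqP e; apply/eqP; apply: i1.
have sne X Z : X \in F2 -> Z \in F2 -> pr X != pr Z -> ps X != ps Z.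
  by move=> XF ZF; apply: contra => /eqP e; rewrite (j2 X Z).
have s01 : ps C0 != ps C1 by apply: sne => //; rewrite p0 p1 pne.
have s02 : ps C0 != ps C2 by apply: sne => //; rewrite p0 p2 pne.
have s12 : ps C1 != ps C2 by apply: sne => //; rewrite p1 p2 pne.
have peq X Z u : X \in Ps -> Z \in Ps -> pl (cp X) u = pl (cp Z) u -> ev X u = ev Z u.
  by move=> XP ZP /(pl_eq _ _ XP ZP)[].
have b0 := subsetP F1P _ m0; have b1 := subsetP F1P _ m1; have b2 := subsetP F1P _ m2.
have e0 := subsetP F2P _ f0; have e1 := subsetP F2P _ f1; have e2 := subsetP F2P _ f2.
have shT (Q : {set body}) X Z U : Q \subset Ps -> {in Q &, forall B X, tp B = tp X} ->
    X \in Q -> Z \in Q -> U \in Q -> share X Z (th U).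
  move=> QP tQ XQ ZQ UQ; have XP := subsetP QP _ XQ.
  suff -> : th U = th X by apply: tp_share (tQ _ _ XQ ZQ) => //; apply: (subsetP QP).
  by have [] := (pl_eq _ _ (subsetP QP _ UQ) XP).1 (tQ _ _ UQ XQ).
have fin X1 X2 D1 D2 : X1 \in F1 -> X2 \in F1 -> D1 \in F2 -> D2 \in F2 ->
    pr D1 = pr X1 -> pr D2 = pr X2 -> ps C0 = ps X1 -> ps D1 = ps X2 -> ps D2 = ps B0 ->
    pr B0 = pr X1.
  move=> x1 x2 d1 d2 h3 h4 h5 h6 h7.
  have y1 := subsetP F1P _ x1; have y2 := subsetP F1P _ x2.
  have g1 := subsetP F2P _ d1; have g2 := subsetP F2P _ d2.
  apply/pl_eq => //; split=> //.
  apply: (@hexagon_cycle r s a b B0 X1 X2 C0 D1 D2 (th B0) (th C0) F).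
  - exact: third_cases.
  - exact: third_cases.
  - exact: peq.
  - exact: peq.
  - exact: peq.
  - exact: peq.
  - exact: peq.
  - exact: peq.
  - exact: (shT F1).
  - exact: (shT F1).
  - exact: (shT F2).
  - exact: (shT F2).
(* The point of [C0] at [s] decides which of the two 3-cycles occurs. *)
case: (val C0 f0) => [e|[e|e]]; first by rewrite e eqxx in q0.
- have eC2 : ps C2 = ps B0.
    case: (val C2 f2) => [//|[e'|e']]; first by rewrite e e' eqxx in s02.
    by rewrite e' eqxx in q2.
  have eC1 : ps C1 = ps B2.
    case: (val C1 f1) => [e'|[e'|//]]; first by rewrite e' eC2 eqxx in s12.
    by rewrite e' eqxx in q1.
  by have := fin B1 B2 C1 C2 m1 m2 f1 f2 p1 p2 e eC1 eC2; apply/eqP; apply: pne.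
- have eC1 : ps C1 = ps B0.
    case: (val C1 f1) => [//|[e'|e']]; first by rewrite e' eqxx in q1.
    by rewrite e e' eqxx in s01.
  have eC2 : ps C2 = ps B1.
    case: (val C2 f2) => [e'|[//|e']]; first by rewrite e' eC1 eqxx in s12.
    by rewrite e' eqxx in q2.
  by have := fin B2 B1 C2 C1 m2 m1 f2 f1 p2 p1 e eC2 eC1; apply/eqP; apply: pne.
Qed.

End SixBodies.

Lemma large_class_free : False.
Proof.
have sE : E \subset gadget by apply/bigcupsP => B BP; apply: (cf_sub cf BP).
have /card_gt0P[B BP] : 0 < #|Ps| by apply: leq_trans five.
have /card_gt0P[e eB] := cf_pos cf BP.
have E0 : E != set0 by apply/set0Pn; exists e; apply: edge_used BP eB.
have [r [s [a [b F]]]] := frame_exists sE E0.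
have nt := frame_through F; have F' := frame_swap F.
have key r' s' : frame E r' s' a b -> #|Ps| = #|through r'| -> #|at_label r'| = 3 ->
    #|at_label s'| = 2 -> False.
  move=> F0 hn R3 S2; have := five; have := card_le6; rewrite leq_eqVlt => /orP[/eqP six _|].
    have nt0 := frame_through F0.
    apply: (six_grid_free (frame_swap F0) six) => //; by rewrite -?nt0 -hn.
  move=> l6 l5; have P5 : #|Ps| = 5 by move: l6 l5; clear; lia.
  by apply: (five_bodies_free F0 P5) => //; rewrite -hn.
have [[six [n4 [R2 S2]]]|[[hn [[R3 S2]|[R2 S3]]]|[six [n6 [R3 S3]]]]] := frame_counts F.
- exact: small_grid_free F six n4 R2 S2.
- exact: key F hn R3 S2.
- by apply: (key s r F' _ S3 R2); rewrite -nt.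
- exact: six_hexagon_free F six n6 R3 S3.
Qed.

End Frames.
Lemma same_class_free : (exists B X, [/\ B \in Ps, X \in Ps & cp B != cp X]) -> False.
Proof.
move=> [B [X [BP XP ne]]]; have := cf_size cf; rewrite leq_eqVlt => /orP[/eqP four|five].
  by case/eqP: ne; rewrite !cpE // (four_rows (esym four) BP XP).
exact: large_class_free five.
Qed.

End SameClass.

(** * The graph of copies *)

Section TightSetsOfCopies.
Variables (I L Y : finType) (W : zmodType) (da db : L -> W).
Variable pl : I * L -> gvert -> Y.
Let edge := ((I * L) * {set gvert})%type.
Implicit Types (A B : {set edge}) (P Q : {set {set edge}}).
Hypothesis inc : incidence da db pl.
Hypothesis distinct_free : forall (P : {set {set edge}}) cp es, config pl P cp es ->
  {in P &, injective (fun B => (cp B).1)} -> False.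

Definition points A := \bigcup_(x in A) pl x.1 @: x.2.
Definition mono A := [forall x in A, forall y in A, x.1 == y.1].
Definition proper_edges A := {in A, forall x, x.2 \in gadget}.

Lemma monoP A : reflect {in A &, forall x y, x.1 = y.1} (mono A).
Proof.
apply: (iffP forall_inP) => [h x y xA yA|h x xA].
  by have /forall_inP/(_ y yA)/eqP := h x xA.
by apply/forall_inP => y yA; apply/eqP; apply: h.
Qed.

(** The packing recovers the index; two lines over it that agree at two different slopes are
    equal. *)
Lemma join_copy c c' u u' v v' : pl c u = pl c' u' -> pl c v = pl c' v' ->
  u != v -> gjoin u v -> c = c'.
Proof.
move=> eu ev uv juv; have := inc_join inc eu ev erefl erefl uv juv.
case: c c' eu ev => [i l] [i' l'] /= eu ev ii; rewrite -ii in eu ev *.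
have [_ e1] := (inc_same inc _ _ _ _ _).1 eu; have [_ e2] := (inc_same inc _ _ _ _ _).1 ev.
have h := all_coloursP (all_coloursP slope_colours (gcol_lt u)) (gcol_lt v).
rewrite (gjoin_col juv) /= in h; congr (_, _).
have E l0 w : leval da db l0 w = (da l0 *~ slopez (gcol w) + db l0)%R by [].
rewrite !E in e1 e2; have [a b] := two_lines (inc_torsion inc) e1 e2 h.
exact: (inc_line inc a b).
Qed.

Definition edges_of A : {set {set gvert}} := [set x.2 | x in A].

Lemma card_edges_of A : mono A -> #|edges_of A| = #|A|.
Proof.
move=> /monoP h; apply: card_in_imset => x y xA yA e.
by rewrite [x]surjective_pairing [y]surjective_pairing (h x y xA yA) e.
Qed.

Lemma points_mono A c : {in A, forall x, x.1 = c} -> points A = pl c @: cover (edges_of A).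
Proof.
move=> h; apply/setP => p; apply/bigcupP/imsetP => [[x xA /imsetP[u ux ->]]|[u]].
  by exists u; rewrite ?(h x xA) //; apply/bigcupP; exists x.2 => //; apply: imset_f.
move=> /bigcupP[e /imsetP[x xA ->] ux] ->; exists x => //.
by rewrite (h x xA); apply: imset_f.
Qed.

Lemma edges_of_sub A : proper_edges A -> edges_of A \subset gadget.
Proof. by move=> h; apply/subsetP => e /imsetP[x xA ->]; apply: h. Qed.

Lemma card_points_mono A : mono A -> A != set0 -> #|points A| = #|cover (edges_of A)|.
Proof.
move=> /monoP h /set0Pn[x xA]; rewrite (@points_mono A x.1) => [|y yA]; last exact: h.
by rewrite card_imset //; apply: (pl_inj inc).
Qed.

Definition tight_parts P := [forall B in P, mono B && (#|points B| <= #|B| + 2)].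

Lemma singleton_parts A : proper_edges A ->
  exists P, partition P A && tight_parts P.
Proof.
move=> pA; exists (preim_partition id A); rewrite preim_partitionP /=.
apply/forall_inP => B /imsetP[x xA ->]; set S := [set y in A | x == y].
have -> : S = [set x] by apply/setP => y; rewrite !inE eq_sym andb_idl // => /eqP->.
apply/andP; split; first by apply/monoP => y z /set1P-> /set1P->.
rewrite cards1 /points big_set1; apply: leq_trans (leq_imset_card _ _) _.
by have [h3 _ _] := gadget_sparse; rewrite h3 // pA.
Qed.

Lemma points_cover Q : points (cover Q) = \bigcup_(B in Q) points B.
Proof.
apply/setP => p; apply/bigcupP/bigcupP => [[x /bigcupP[B BQ xB] px]|[B BQ /bigcupP[x xB px]]].
  by exists B => //; apply/bigcupP; exists x.
by exists x => //; apply/bigcupP; exists B.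
Qed.

Lemma card_cover_sub P A Q : partition P A -> Q \subset P -> #|cover Q| = \sum_(B in Q) #|B|.
Proof. by move=> /and3P[_ tP _] QP; apply/esym/eqP; apply: trivIsetS tP. Qed.

Lemma merge_parts P A Q : partition P A && tight_parts P -> Q \subset P -> 1 < #|Q| ->
  mono (cover Q) -> #|points (cover Q)| <= #|cover Q| + 2 ->
  exists P', (partition P' A && tight_parts P') /\ #|P'| < #|P|.
Proof.
move=> /andP[pP /forall_inP tP] QP Q2 mQ tQ; exists (cover Q |: (P :\: Q)).
have /and3P[/eqP cP tr n0] := pP.
have Q0 : cover Q != set0.
  have /card_gt0P[B BQ] : 0 < #|Q| by apply: leq_trans Q2.
  apply: contra n0 => /eqP e; suff -> : set0 = B by apply: (subsetP QP).
  by apply/esym/eqP; rewrite -subset0 -e; apply: bigcup_sup.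
split; last first.
  have := cardsID Q P; rewrite (setIidPr QP) cardsU1 => <-; move: Q2.
  by case: (_ \notin _) => /=; move: #|Q| #|_ :\: _|; clear; lia.
apply/andP; split; last first.
  apply/forall_inP => B; rewrite !inE => /orP[/eqP->|/andP[_ BP]]; first by rewrite mQ.
  exact: tP.
have cU : cover (cover Q |: (P :\: Q)) = A.
  rewrite /cover bigcup_setU big_set1 -/(cover (P :\: Q)) -cP -[in RHS](setID P Q).
  by rewrite (setIidPr QP) coverU.
apply/and3P; split; first by rewrite cU.
  have dis B : B \in P :\: Q -> [disjoint cover Q & B].
    rewrite inE => /andP[BQ BP]; rewrite -setI_eq0; apply/eqP/setP => x; rewrite [RHS]inE.
    apply/negP => /setIP[/bigcupP[C CQ xC] xB].
    have CB : C != B by apply: contra BQ => /eqP<-.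
    have := trivIsetP tr C B (subsetP QP _ CQ) BP CB => d.
    by have := disjointFr d xC; rewrite xB.
  apply/trivIsetP => B C; rewrite !in_setU1 => /orP[/eqP->|BP] /orP[/eqP->|CP] ne.
  - by rewrite eqxx in ne.
  - exact: dis.
  - by rewrite disjoint_sym; apply: dis.
  - by apply: (trivIsetP tr) => //; apply: (subsetP (subsetDl P Q)).
by rewrite in_setU1 negb_or eq_sym Q0 inE negb_and n0 orbT.
Qed.

(** Induction on the number of edges, with a partition into as few tight one-copy parts as possible.
    The union of a proper subfamily of at least two parts is not tight: by induction it would lie in
    one copy and could be merged. Two parts would share two joined points, and three overlap too
    little; for four or more the indices all agree, partly agree or all differ. *)
Lemma mono_tight A : proper_edges A -> 0 < #|A| <= 6 -> #|points A| <= #|A| + 2 -> mono A.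
Proof.
have [n] := ubnP #|A|; elim: n A => // n IHn A ltn pA /andP[A0 A6] tA.
apply/negPn/negP => nmono.
have [P0 hP0] := singleton_parts pA.
have [P hP minP] := @arg_minnP _ P0 (fun P => partition P A && tight_parts P) (fun P => #|P|) hP0.
have nomerge Q : Q \subset P -> 1 < #|Q| -> mono (cover Q) ->
    #|points (cover Q)| <= #|cover Q| + 2 -> False.
  move=> QP Q2 mQ tQ; have [P' [hP' lt]] := merge_parts hP QP Q2 mQ tQ.
  by have := minP P' hP'; rewrite leqNgt lt.
have /andP[pP /forall_inP tP] := hP; have /and3P[/eqP cP tr n0] := pP.
have subA B : B \in P -> B \subset A by move=> BP; rewrite -cP; apply: bigcup_sup.
have pos B : B \in P -> 0 < #|B|.
  by move=> BP; rewrite card_gt0; apply: contra n0 => /eqP<-.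
have prB B : B \in P -> proper_edges B by move=> /subA sB x /(subsetP sB)/pA.
have sumP : #|A| = \sum_(B in P) #|B| by rewrite -cP (card_cover_sub pP).
have sum_ge (Q : {set {set edge}}) : Q \subset P -> #|Q| <= \sum_(B in Q) #|B|.
  by move=> QP; rewrite -sum1_card; apply: leq_sum => B /(subsetP QP)/pos.
have split_sum (Q : {set {set edge}}) : Q \subset P ->
    #|A| = \sum_(B in Q) #|B| + \sum_(B in P :\: Q) #|B|.
  move=> QP; rewrite sumP -{1}(setID P Q) (setIidPr QP) sum_disjU //.
  by rewrite -setI_eq0; apply/eqP/setP => B; rewrite !inE; case: (B \in Q).
have cardD (Q : {set {set edge}}) : Q \subset P -> #|P :\: Q| + #|Q| = #|P|.
  by move=> QP; rewrite -(cardsID Q P) (setIidPr QP) addnC.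
have P2 : 1 < #|P|.
  rewrite ltnNge; apply/negP => le1; case/negP: nmono.
  have P1 : #|P| = 1.
    apply/eqP; rewrite eqn_leq le1 card_gt0 /=; apply: contraL A0 => /eqP e.
    by rewrite -cP e /cover big_set0 cards0.
  have /eqP/cards1P[B PB] := P1; have /andP[mB _] : mono B && (#|points B| <= #|B| + 2).
    by apply: tP; rewrite PB inE.
  by rewrite -cP PB /cover big_set1.
have part (Q : {set {set edge}}) : Q \subset P -> 1 < #|Q| < #|P| ->
    \sum_(B in Q) #|B| + 3 <= #|\bigcup_(B in Q) points B|.
  move=> QP /andP[Q2 QlP]; rewrite -points_cover -(card_cover_sub pP QP) addnS ltnNge.
  apply/negP => tQ; have cQ := card_cover_sub pP QP.
  have l1 := split_sum Q QP; have l2 := sum_ge _ (subsetDl P Q); have l3 := cardD Q QP.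
  have l4 := sum_ge _ QP.
  have lt : #|cover Q| < #|A| by rewrite cQ; move: l1 l2 l3 QlP; clear; lia.
  apply: (nomerge Q QP Q2 _ tQ); apply: IHn => //.
  - by apply: leq_trans lt _; rewrite -ltnS.
  - by move=> x /bigcupP[B BQ xB]; apply: (prB B (subsetP QP _ BQ)).
  - rewrite cQ; move: l1 l4 Q2 A6; clear; lia.
have le5 B : B \in P -> #|B| <= 5.
  move=> BP; have sB : [set B] \subset P by rewrite sub1set.
  have := split_sum _ sB; have := sum_ge _ (subsetDl P [set B]); have := cardD _ sB.
  by rewrite big_set1 cards1; move: A6 P2; clear; lia.
have cE B : B \in P -> #|edges_of B| = #|B|.
  by move=> BP; have /andP[mB _] := tP B BP; apply: card_edges_of.
have cB B : B \in P -> #|points B| = #|B| + 2.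
  move=> BP; have /andP[mB tB] := tP B BP; apply/eqP; rewrite eqn_leq tB /=.
  rewrite card_points_mono // -?card_gt0 ?pos // -(cE B BP).
  have [_ h5 _] := gadget_sparse; apply: h5; first exact: edges_of_sub (prB B BP).
  by rewrite cE // pos // le5.
have [x0 x0A] : exists x0, x0 \in A by apply/card_gt0P.
pose cp B := if [pick x in B] is Some x then x.1 else x0.1.
have cpE B x : B \in P -> x \in B -> x.1 = cp B.
  move=> BP xB; rewrite /cp; case: pickP => [y yB|/(_ x)]; last by rewrite xB.
  by have /andP[/monoP mB _] := tP B BP; apply: mB.
have ptsE B : B \in P -> pts pl cp edges_of B = points B.
  by move=> BP; rewrite (@points_mono B (cp B)) // => x; apply: cpE.
have joinB B u v : B \in P -> #|B| <= 3 -> u \in cover (edges_of B) ->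
    v \in cover (edges_of B) -> u != v -> gjoin u v.
  move=> BP B3 uB vB; apply: (@gadget_light (edges_of B)) => //.
  - exact: edges_of_sub (prB B BP).
  - by rewrite cE // pos.
  - rewrite -card_points_mono ?cB ?cE //; last by rewrite -card_gt0 pos.
    by have /andP[] := tP B BP.
have cardU B X : #|points B :|: points X| + #|points B :&: points X| = #|points B| + #|points X|.
  by rewrite cardsUI.
have P3 : 2 < #|P|.
  rewrite ltnNge; apply/negP => le2; have /eqP/cards2P[B [X [BX PE]]] : #|P| = 2.
    by move: le2 P2; clear; lia.
  have BP : B \in P by rewrite PE !inE eqxx.
  have XP : X \in P by rewrite PE !inE eqxx orbT.
  have s2 : #|A| = #|B| + #|X|.
    rewrite sumP PE (big_setD1 B) ?inE ?eqxx //=; congr (_ + _).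
    rewrite (_ : _ :\ B = [set X]) ?big_set1 //.
    by apply/setP => Z; rewrite !inE; case: eqVneq => // ->; rewrite (negbTE BX).
  have pA2 : points A = points B :|: points X.
    rewrite -cP points_cover PE bigcup_setU !big_set1 //.
  have share2 : 1 < #|points B :&: points X|.
    have := cardU B X; rewrite -pA2 (cB B BP) (cB X XP); move: tA s2.
    by move: #|points A| #|A| #|B| #|X| #|_ :&: _|; clear => *; lia.
  (* One of the two parts has at most three edges, so that its labels are joined. *)
  have [Z [Z' [ZP Z'P ZE Z3]]] : exists Z Z', [/\ Z \in P, Z' \in P,
      points B :&: points X = points Z :&: points Z' /\ P = [set Z; Z'] & #|Z| <= 3].
    have [B3|B3] := leqP #|B| 3; first by exists B, X.
    exists X, B; split=> //; first by rewrite setIC PE setUC.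
    by move: B3 s2 A6; clear; lia.
  case: ZE => ZE PE'; move: share2; rewrite ZE => /card_gt1P[p [q [hp hq pq]]].
  move: hp hq; rewrite -!ptsE // => /setIP[/imsetP[u uZ pu] /imsetP[u' _ pu']].
  move=> /setIP[/imsetP[v vZ qv] /imsetP[v' _ qv']].
  have uv : u != v by apply: contra pq => /eqP e; rewrite pu qv e.
  rewrite pu in pu'; rewrite qv in qv'.
  have cc := join_copy pu' qv' uv (joinB Z u v ZP Z3 uZ vZ uv).
  case/negP: nmono; apply/monoP => x y; rewrite -cP PE' => /bigcupP[D + xD] /bigcupP[D' + yD].
  have cpD D0 z : D0 \in [set Z; Z'] -> z \in D0 -> z.1 = cp Z.
    rewrite !inE => /orP[]/eqP-> zD; first exact: cpE.
    by rewrite cc; apply: cpE.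
  by move=> /cpD/(_ xD)-> /cpD/(_ yD)->.
have pair B X : B \in P -> X \in P -> B != X -> #|points B :&: points X| <= 1.
  move=> BP XP BX; have := part [set B; X]; rewrite subset_set2 BP XP cards2 BX P3 => /(_ isT isT).
  rewrite bigcup_setU !big_set1 (big_setD1 B) ?inE ?eqxx //=.
  have -> : [set B; X] :\ B = [set X].
    by apply/setP => Z; rewrite !inE; case: eqVneq => // ->; rewrite (negbTE BX).
  rewrite big_set1; have := cardU B X; rewrite (cB B BP) (cB X XP).
  by move: #|B| #|X| #|_ :&: _| #|_ :|: _|; clear => *; lia.
have ptsA : points A = \bigcup_(B in P) points B by rewrite -cP points_cover.
have P4 : 3 < #|P|.
  rewrite ltnNge; apply/negP => le3; have /card3P[B [X [Z [BX BZ XZ PE]]]] : #|P| = 3.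
    by move: le3 P3; clear; lia.
  have BP : B \in P by rewrite PE !inE eqxx.
  have XP : X \in P by rewrite PE !inE eqxx orbT.
  have ZP : Z \in P by rewrite PE !inE eqxx !orbT.
  have := split_sum [set B; X]; rewrite subset_set2 BP XP => /(_ isT).
  have -> : P :\: [set B; X] = [set Z].
    rewrite PE; apply/setP => U; rewrite !inE.
    case: (eqVneq U Z) => [->|_]; last by rewrite orbF; case: (_ || _).
    by rewrite orbT andbT negb_or ![Z == _]eq_sym BZ XZ.
  rewrite big_set1 (big_setD1 B) ?inE ?eqxx //=.
  have -> : [set B; X] :\ B = [set X].
    by apply/setP => U; rewrite !inE; case: eqVneq => // ->; rewrite (negbTE BX).
  rewrite big_set1 => sA; have pA2 : points A = points B :|: points X :|: points Z.
    by rewrite ptsA PE !bigcup_setU !big_set1.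
  have := cardU B X; have := pair B X BP XP BX; have := pair B Z BP ZP BZ.
  have := pair X Z XP ZP XZ; have := cardsUI (points B :|: points X) (points Z).
  rewrite -pA2 setIUl; have [le _] := leq_card_setU (points B :&: points Z) (points X :&: points Z).
  move: le tA sA; rewrite (cB B BP) (cB X XP) (cB Z ZP); move: #|A| #|B| #|X| #|Z| #|points A|.
  move: #|points B :|: points X| #|points B :&: points X| #|points B :&: points Z|.
  by move: #|points X :&: points Z| #|_ :|: _|; clear => *; lia.
have cf : config pl P cp edges_of.
  split.
  - by move=> B BP; apply: edges_of_sub (prB B BP).
  - by move=> B BP; rewrite cE // pos.
  - move=> B BP; rewrite cE // -cB // card_points_mono // -?card_gt0 ?pos //.
    by have /andP[] := tP B BP.
  - by move=> B X BP XP BX; rewrite !ptsE // pair.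
  - move=> Q QP hQ; rewrite (eq_bigr (fun B : {set edge} => #|B|)) => [|B BQ]; last first.
      by rewrite cE // (subsetP QP).
    rewrite /ptsU (eq_bigr points) => [|B BQ]; last by rewrite ptsE // (subsetP QP).
    exact: part.
  - rewrite (eq_bigr (fun B : {set edge} => #|B|)) => [|B BQ]; last by rewrite cE.
    by rewrite /ptsU (eq_bigr points) => [|B BQ]; rewrite ?ptsE // -ptsA -sumP.
  - exact: P4.
  - by rewrite (eq_bigr (fun B : {set edge} => #|B|)) => [|B BQ]; rewrite ?cE // -sumP.
(* The index of an arbitrary part is the reference; [P] is nonempty, so the default [set0] never
   occurs. *)
have [/forall_inP samei|] := boolP [forall B in P, (cp B).1 == (cp (odflt set0 [pick B in P])).1].
  apply: (same_class_free inc cf (i0 := (cp (odflt set0 [pick B in P])).1)).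
    by move=> B /samei/eqP.
  have [/existsP[B /existsP[X /and3P[BP XP ne]]]|none] :=
    boolP [exists B, [exists X, [&& B \in P, X \in P & cp B != cp X]]].
    by exists B, X.
  case/negP: nmono; apply/monoP => x y; rewrite -cP => /bigcupP[B BP xB] /bigcupP[X XP yX].
  rewrite (cpE B x BP xB) (cpE X y XP yX); apply/eqP/negPn/negP => ne.
  case/negP: none; apply/existsP; exists B; apply/existsP; exists X.
  by rewrite BP XP.
rewrite negb_forall_in => /exists_inP[B1 B1P].
case: pickP => [B0 B0P|/(_ B1)]; last by rewrite B1P.
rewrite /= => n10.
have [/existsP[B /existsP[X /and4P[BP XP BX /eqP e]]]|inj] :=
  boolP [exists B, [exists X, [&& B \in P, X \in P, B != X & (cp B).1 == (cp X).1]]].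
  apply: (mixed_class_free inc cf (i0 := (cp B).1)).
    by apply/card_gt1P; exists B, X; rewrite !inE BP XP e !eqxx.
  have [e1|ne1] := eqVneq (cp B1).1 (cp B).1.
    by apply/set0Pn; exists B0; rewrite inE B0P -e1 eq_sym.
  by apply/set0Pn; exists B1; rewrite inE B1P ne1.
apply: (distinct_free cf) => B X BP XP e; apply/eqP/negPn/negP => BX.
case/negP: inj; apply/existsP; exists B; apply/existsP; exists X.
by rewrite BP XP BX e eqxx.
Qed.

Lemma six_edges_spread A : proper_edges A -> #|A| = 6 -> 9 <= #|points A|.
Proof.
move=> pA A6; rewrite ltnNge; apply/negP => le8.
have mA : mono A by apply: mono_tight; rewrite ?A6.
have A0 : A != set0 by rewrite -card_gt0 A6.
have [_ _ h6] := gadget_sparse; have := h6 (edges_of A) (edges_of_sub pA).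
by rewrite card_edges_of // A6 -card_points_mono // => /(_ erefl); rewrite ltnNge le8.
Qed.

Definition copy_graph : {set {set Y}} :=
  [set pl x.1 @: (x.2 : {set gvert}) | x in setX [set: I * L] gadget].

Lemma copy_edge_inj : {in setX [set: I * L] gadget &,
  injective (fun x : edge => pl x.1 @: x.2)}.
Proof.
move=> [c e] [c' e']; rewrite !in_setX !in_setT /= => eG eG' eq.
have [h3 _ _] := gadget_sparse.
have /card_gt1P[u [v [ue ve uv]]] : 1 < #|e| by rewrite h3.
have : pl c u \in pl c' @: e' by rewrite -eq imset_f.
have : pl c v \in pl c' @: e' by rewrite -eq imset_f.
move=> /imsetP[v' _ ev] /imsetP[u' _ eu].
have juv : gjoin u v.
  apply: (@gadget_light [set e]) => //; rewrite ?sub1set ?cards1 ?cover1 ?h3 //.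
have cc := join_copy eu ev uv juv; rewrite -cc in eq *.
by rewrite (imset_inj (pl_inj inc (c := c)) eq).
Qed.

Lemma card_copy_graph : #|copy_graph| = 61 * #|{: I * L}|.
Proof.
by rewrite (card_in_imset copy_edge_inj) cardsX cardsT card_gadget mulnC.
Qed.

Lemma copy_graph3 : {in copy_graph, forall e : {set Y}, #|e| = 3}.
Proof.
move=> e /imsetP[[c f]]; rewrite in_setX in_setT /= => fG ->.
rewrite card_imset; last exact: (pl_inj inc).
by have [h3 _ _] := gadget_sparse; apply: h3.
Qed.

Lemma copy_graph_free (K : {set {set Y}}) : K \subset copy_graph -> #|K| = 6 ->
  9 <= #|cover K|.
Proof.
move=> KG K6; pose A := [set x in setX [set: I * L] gadget | pl x.1 @: x.2 \in K].
have AS : A \subset setX [set: I * L] gadget by apply/subsetP => x; rewrite in_set => /andP[].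
have KA : K = (fun x : edge => pl x.1 @: x.2) @: A.
  apply/setP => k; apply/idP/imsetP => [kK|[x]]; last by rewrite in_set => /andP[_ +] ->.
  have /imsetP[x xS kx] := subsetP KG _ kK; exists x => //.
  by rewrite in_set xS -kx.
have cA : #|A| = 6.
  apply: etrans K6; rewrite KA card_in_imset // => x y xA yA; apply: copy_edge_inj; exact: (subsetP AS).
have -> : cover K = points A.
  rewrite KA; apply/setP => p; apply/bigcupP/bigcupP => [[k /imsetP[x xA ->] px]|[x xA px]].
    by exists x.
  by exists (pl x.1 @: x.2) => //; apply: imset_f.
apply: six_edges_spread cA => -[c e] /(subsetP AS).
by rewrite in_setX => /andP[].
Qed.

End TightSetsOfCopies.

(** * The lower bound *)

Lemma f3_embed (Y : finType) (n : nat) (G : {set {set Y}}) : #|Y| <= n ->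
  (forall e, e \in G -> #|e| = 3) ->
  (forall K : {set {set Y}}, K \subset G -> #|K| = 6 -> 9 <= #|cover K|) ->
  #|G| <= f3 n 8 6.
Proof.
move=> Yn G3 Gfree; pose h (y : Y) := widen_ord Yn (enum_rank y).
have hinj : injective h by move=> x y /(congr1 val) /= /val_inj/enum_rank_inj.
have iinj : injective (fun e : {set Y} => h @: e) := imset_inj hinj.
rewrite -(card_imset _ iinj) /f3.
apply: (@leq_bigmax_cond _ (fun H => is_3graph H && sk_free 8 6 H) (fun H => #|H|)).
apply/andP; split.
  by apply/forall_inP => e /imsetP[e' eG ->]; rewrite card_imset // G3.
apply/existsP => -[F /and3P[FG /eqP F6 F8]].
pose K := [set e in G | h @: e \in F].
have FE : F = (fun e : {set Y} => h @: e) @: K.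
  apply/setP => f; apply/idP/imsetP => [fF|[e]]; last by rewrite inE => /andP[_ +] ->.
  have /imsetP[e eG fe] := subsetP FG _ fF; exists e => //.
  by rewrite inE eG -fe.
have KG : K \subset G by apply/subsetP => e; rewrite inE => /andP[].
have K6 : #|K| = 6 by apply: etrans F6; rewrite FE card_imset.
have := Gfree K KG K6; rewrite ltnNge => /negP; apply; apply: leq_trans F8.
rewrite -(card_imset (mem (cover K)) hinj); apply: subset_leq_card.
apply/subsetP => x /imsetP[y /bigcupP[e eK ye] ->].
apply/bigcupP; exists (h @: e); last exact: imset_f.
by rewrite FE; apply: imset_f.
Qed.

Lemma common_multiple n : exists N, 0 < N /\ forall d, 0 < d <= n -> d %| N.
Proof. by exists n`!; split=> [|d]; rewrite ?fact_gt0 // => /dvdn_fact. Qed.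

(** Integers up to 10000 are invertible modulo [p] by size and modulo [M] by coprimality. *)
Lemma lift_torsion_free (I : finType) (p M : nat) : prime p -> 10000 < p -> 1 < M ->
  (forall d, 0 < d <= 10000 -> coprime M d) -> torsion_free (lift_coord I p M).
Proof.
move=> pp lp M1 cop [f z] d hd e0.
have pairMn m : ((f, z) *+ m = (f *+ m, z *+ m))%R.
  by elim: m => [|m IHm]; rewrite ?GRing.mulr0n // !GRing.mulrS IHm.
rewrite pairMn in e0; have ef : (f *+ d = 0)%R := congr1 fst e0.
have ez : (z *+ d = 0)%R := congr1 snd e0.
congr (_, _).
  apply/ffunP => k; have : ((f *+ d) k = 0)%R by rewrite ef ffunE.
  have -> : ((f *+ d) k = f k * d%:R)%R.
    rewrite GRing.mulr_natr; elim: (d) => [|m IHm]; first by rewrite !GRing.mulr0n ffunE.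
    by rewrite !GRing.mulrS ffunE IHm.
  move/eqP; rewrite GRing.mulf_eq0 ffunE => /orP[/eqP//|/eqP d0].
  have /andP[d1 d2] := hd; have := @natr_Fp_inj p d 0 pp (leq_ltn_trans d2 lp) (prime_gt0 pp) d0.
  by move=> e; rewrite e in d1.
apply/val_inj; have := congr1 val ez; rewrite Zp_mulrn /= => e.
have dv : M %| z * d by move/eqP: e; rewrite -/(dvdn _ _) [X in dvdn X _](Zp_cast M1).
rewrite Gauss_dvdl ?cop // in dv; apply/eqP; rewrite -[_ == _]negbK; apply/negP => z0.
have := dvdn_leq _ dv; rewrite lt0n => /(_ z0); rewrite leqNgt => /negP; apply.
by have := ltn_ord z; rewrite [X in (_ < X)%N]Zp_cast.
Qed.

(** * The packing after the lift *)

Section LiftedPacking.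
Variables (I X : finType) (T : I -> gvert -> X) (p M : nat).
Hypotheses (p_pr : prime p) (ltp : 10000 < p) (M1 : 1 < M).
Hypothesis cop : forall d, 0 < d <= 10000 -> coprime M d.
Hypothesis T_inj : forall i, injective (T i).
Hypothesis T_join : forall i j u v u' v', T i u = T j u' -> T i v = T j v' ->
  u != v -> gjoin u v -> i = j.

Definition direction (l : line I p M) : lift_coord I p M := l.1.
Definition offset (l : line I p M) : lift_coord I p M := l.2.

Lemma lift_incidence : incidence direction offset (@lift_point I X T p M).
Proof.
split.
- by move=> [a b] [a' b'] /= -> ->.
- exact: lift_torsion_free.
- by move=> i l l' u u'; apply: lift_pointE.
- move=> c c' d d' u u' v v' /(congr1 fst) /= eu /(congr1 fst) /= ev e1 e2.
  by move: ev; rewrite -e1 -e2; apply: T_join eu.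
Qed.

Lemma lift_distinct_free (P : {set {set (I * line I p M) * {set gvert}}}) cp es :
  config (@lift_point I X T p M) P cp es -> {in P &, injective (fun B => (cp B).1)} -> False.
Proof.
move=> cf inj; apply: (@distinct_index_free I X T p M p_pr ltp T_inj _ P cp (labels es)) => //.
- have h4 := cf_size cf; have h6 := leq_trans (card_le_edges cf (subxx _)) (cf_edges cf).
  by rewrite (leq_trans _ h4) // (leq_ltn_trans h6).
- by move=> B BP; apply: (labels_join cf BP).
- by move=> B BP; apply: (core_ge3 lift_incidence cf BP).
Qed.

Lemma lift_graph : exists (Y : finType) (G : {set {set Y}}),
  [/\ #|Y| = #|X| * (p ^ #|{: lift_index I p}| * M),
      #|G| = 61 * (#|I| * (p ^ #|{: lift_index I p}| * M) ^ 2),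
      forall e, e \in G -> #|e| = 3
    & forall K : {set {set Y}}, K \subset G -> #|K| = 6 -> 9 <= #|cover K|].
Proof.
have cW : #|{: lift_coord I p M}| = p ^ #|{: lift_index I p}| * M.
  rewrite card_prod card_ffun; congr (_ ^ _ * _); first exact: card_Fp.
  by rewrite card_ord Zp_cast.
exists (X * lift_coord I p M)%type, (copy_graph (@lift_point I X T p M)); split.
- by rewrite card_prod cW.
- by rewrite (card_copy_graph lift_incidence) card_prod card_prod cW mulnn.
- exact: copy_graph3 lift_incidence.
- exact: copy_graph_free lift_incidence lift_distinct_free.
Qed.

End LiftedPacking.

Lemma gjoin_some : 0 < #|[set w : gvert * gvert | gjoin w.1 w.2]|.
Proof.
by apply/card_gt0P; exists (inord 0, inord 1); rewrite inE /gjoin /vnum !inordK.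
Qed.

(** Only [M] varies with n; M = 1 mod N makes it coprime to all integers up to 10000. *)
Lemma dense_graphs k : 0 < k -> exists c g N : nat,
  [/\ 0 < c, 0 < N, c ^ 2 * k <= c ^ 2 + 330 * k * g
    & forall M, 1 < M -> N %| M.-1 -> forall n, c * M <= n -> 61 * (g * M ^ 2) <= f3 n 8 6].
Proof.
move=> k0; have [I [X [T [T_inj T_join X0 dens]]]] := near_packing gjoinC gjoin_some k0.
have [p lp pp] := prime_above 10000; have [N [N0 dvN]] := common_multiple 10000.
set K := p ^ #|{: lift_index I p}|.
exists (#|X| * K), (#|I| * K ^ 2), N; split=> //.
- by rewrite muln_gt0 X0 expn_gt0 prime_gt0.
- have le : k * #|[set w : gvert * gvert | gjoin w.1 w.2]| * #|I| <= 330 * k * #|I|.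
    by rewrite leq_mul2r (mulnC 330) leq_mul2l card_gjoin !orbT.
  have := leq_trans dens (leq_add (leqnn _) le) => h.
  have : (#|X| ^ 2 * k) * K ^ 2 <= (#|X| ^ 2 + 330 * k * #|I|) * K ^ 2 by rewrite leq_mul2r h orbT.
  rewrite expnMn; move: (#|X| ^ 2) (K ^ 2) #|I| => x y z.
  have -> : x * y * k = x * k * y by ring.
  by have -> : x * y + 330 * k * (z * y) = (x + 330 * k * z) * y by ring.
- move=> M M1 NM n cn.
  have cop d : 0 < d <= 10000 -> coprime M d.
    move=> hd; rewrite coprime_sym; apply: (coprime_dvdl (dvN d hd)).
    by apply: (coprime_dvdl NM); rewrite coprime_sym coprimenP // ltnW.
  have [Y [G [cY cG G3 Gf]]] := lift_graph pp lp M1 cop T_inj T_join.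
  have := @f3_embed Y n G; rewrite cY mulnA => /(_ cn G3 Gf); rewrite cG.
  by rewrite -/K expnMn (mulnA #|I|).
Qed.

(** Approximating n from below by c * M costs a linear term, the imperfect packing a fraction 1 /
    k. *)
Lemma f3_lower k : 0 < k -> exists D, forall n, D <= n ->
  61 * k * n ^ 2 <= 330 * k * f3 n 8 6 + 61 * n ^ 2 + 122 * k * D * n.
Proof.
move=> k0; have [c [g [N [c0 N0 dens low]]]] := dense_graphs k0.
exists (c * N.+1) => n Dn.
(* [M] is the largest number that is 1 mod [N] and at most n / c. *)
pose t := n %/ c; pose j := t.-1 %/ N; pose M := (N * j).+1.
have tN : N.+1 <= t by rewrite leq_divRL // mulnC.
have j1 : 0 < j by rewrite divn_gt0 //; move: tN; clear; lia.
have M1 : 1 < M by rewrite ltnS muln_gt0 N0.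
have Mt : M <= t.
  by have := leq_trunc_div t.-1 N; rewrite -/j mulnC /M; move: tN; clear; lia.
have tM : t < M + N.
  by have := ltn_ceil t.-1 N0; rewrite -/j mulSn mulnC /M; move: tN; clear; lia.
have cn : c * M <= n.
  by apply: leq_trans (leq_trunc_div n c); rewrite mulnC leq_mul2r Mt orbT.
have := low M M1 (dvdn_mulr _ (dvdnn _)) n cn.
have nc : n <= c * M + c * N.+1.
  have := ltn_ceil n c0; rewrite -/t => h.
  have : t.+1 * c <= (M + N) * c by rewrite leq_mul2r tM orbT.
  by move: h; rewrite mulnDl mulnS !(mulnC c); clear; lia.
have : c ^ 2 * k * M ^ 2 <= (c ^ 2 + 330 * k * g) * M ^ 2 by rewrite leq_mul2r dens orbT.
move: nc cn; set D := c * N.+1; set f := f3 n 8 6.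
have -> : c ^ 2 * k * M ^ 2 = k * (c * M) ^ 2 by rewrite expnMn; ring.
have -> : (c ^ 2 + 330 * k * g) * M ^ 2 = (c * M) ^ 2 + 330 * k * (g * M ^ 2).
  by rewrite expnMn; ring.
move: (c * M) (g * M ^ 2) => x y nx xn h1 h2.
have h3 : n ^ 2 <= x ^ 2 + 2 * D * n by move: nx xn; clear; nia.
have h4 : x ^ 2 <= n ^ 2 by rewrite leq_exp2r.
have h5 : k * n ^ 2 <= k * (x ^ 2 + 2 * D * n) by rewrite leq_mul2l h3 orbT.
have h6 : 330 * k * (61 * y) <= 330 * k * f by rewrite leq_mul2l h2 orbT.
move: h1 h4 h5 h6; rewrite mulnDr.
have -> : 330 * k * (61 * y) = 61 * (330 * k * y) by ring.
have -> : k * (2 * D * n) = 2 * (k * D * n) by ring.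
have -> : 122 * k * D * n = 122 * (k * D * n) by ring.
have -> : 61 * k * n ^ 2 = 61 * (k * n ^ 2) by ring.
move: (k * n ^ 2) (k * x ^ 2) (330 * k * y) (330 * k * f) (k * D * n) (n ^ 2) (x ^ 2).
by clear => *; lia.
Qed.

(** * The limit *)

From mathcomp Require Import all_classical all_reals all_analysis.
From mathcomp Require Import lra.
Import Order.TTheory GRing.Theory Num.Theory numFieldNormedType.Exports.
Local Open Scope ring_scope.
Local Open Scope classical_set_scope.

Theorem theorem1p3 (R : realType) :
  [sequence ((f3 n 8 6)%:R / (n%:R ^+ 2) : R)]_n @ \oo --> (61%:R / 330%:R : R).
Proof.
apply/cvgrPdist_le => e e0.
pose k := (Num.trunc (2 / e)).+1.
have k0 : (0 < k)%N by [].
have ke : 1 / k%:R <= e / 2 :> R.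
  rewrite ler_pdivrMr ?ltr0n // mulrC -ler_pdivrMr; last by rewrite divr_gt0.
  by rewrite div1r invf_div; apply/ltW/truncnS_gt.
have [D hD] := f3_lower k0.
(* The 12 is 3960 / 330 from the upper bound; 4 * D generously covers the linear term 122 * D / 330
   of the lower bound, next to the packing loss of at most e / 2. *)
pose n0 := (D + (Num.trunc ((4 * D%:R + 12) / e)).+1)%N.
exists n0 => // n /= n0n.
have nD : (D <= n)%N by apply: leq_trans n0n; apply: leq_addr.
have n1 : (0 < n)%N by apply: leq_trans n0n; rewrite /n0 addnS.
have nR : 0 < n%:R :> R by rewrite ltr0n.
have en : (4 * D%:R + 12) <= e * n%:R.
  rewrite [e * _]mulrC -ler_pdivrMr //; apply: (@le_trans _ _ n0%:R); last by rewrite ler_nat.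
  rewrite /n0 natrD; apply: (le_trans (ltW (truncnS_gt _))); by rewrite ler_wpDl.
have low : 61 * k%:R * n%:R ^+ 2 <= 330 * k%:R * (f3 n 8 6)%:R + 61 * n%:R ^+ 2 +
    122 * k%:R * D%:R * n%:R :> R.
  by rewrite -!natrX -!natrM -!natrD ler_nat; apply: hD.
have up : 330 * (f3 n 8 6)%:R <= 61 * n%:R ^+ 2 + 3960 * n%:R :> R.
  by rewrite -!natrX -!natrM -!natrD ler_nat; apply: f3_upper.
move: low up en nR; set f : R := (f3 n 8 6)%:R; set x : R := n%:R => low up en x0.
have kR : 0 < k%:R :> R by rewrite ltr0n.
have D0 : 0 <= D%:R :> R by rewrite ler0n.
have y0 : 0 < x ^+ 2 by rewrite exprn_gt0.
have low' : 61 * x ^+ 2 <= 330 * f + 61 * (1 / k%:R * x ^+ 2) + 122 * (D%:R * x).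
  rewrite -(ler_pM2l kR).
  have -> : k%:R * (330 * f + 61 * (1 / k%:R * x ^+ 2) + 122 * (D%:R * x)) =
      330 * k%:R * f + 61 * x ^+ 2 + 122 * k%:R * D%:R * x.
    by field; rewrite gt_eqF.
  by rewrite mulrCA mulrA.
have P1 : (4 * D%:R + 12) * x <= e * x ^+ 2 by rewrite expr2 mulrA ler_pM2r.
have P2 : 1 / k%:R * x ^+ 2 <= e / 2 * x ^+ 2 by rewrite ler_pM2r.
have Dx : 0 <= D%:R * x by rewrite mulr_ge0 // ltW.
have ex : 0 <= e * x ^+ 2 by rewrite mulr_ge0 // ltW.
have fE : f / x ^+ 2 * x ^+ 2 = f by rewrite divfK // gt_eqF.
rewrite ler_norml; apply/andP; split; rewrite -(ler_pM2r y0) mulrBl fE.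
  by move: up P1 Dx; rewrite mulrDl => up P1 Dx; lra.
by move: low' P1 P2 Dx; rewrite mulrDl => low' P1 P2 Dx; lra.
Qed.
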